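(* Let $\rho_0\in C_c^\infty(\mathbb{R}^2)$, $\rho_0\not\equiv 0$, be odd in $x_2$ (i.e. $\rho_0(x_1,-x_2)=-\rho_0(x_1,x_2)$) with $\rho_0\ge 0$ in $\mathbb{R}\times\mathbb{R}^+$. Assume that there is a global-in-time smooth solution $\rho(x,t)$ to the incompressible porous media (IPM) equation in $\mathbb{R}^2$ with initial data $\rho_0$. Then for every $s>0$ there is a finite constant $C(s,\rho_0)$, depending only on $s$ and $\rho_0$, such that $$\int_0^\infty \|\rho(t)\|_{\dot H^s(\mathbb{R}^2)}^{-\frac{4}{s}}\,dt\le C(s,\rho_0),$$ which implies $$\limsup_{t\to\infty} t^{-\frac{s}{4}}\|\rho(t)\|_{\dot H^s(\mathbb{R}^2)}=\infty\quad\text{for all } s>0.$$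
   Context: The IPM equation in $\mathbb{R}^2$ is $\partial_t\rho+(u\cdot\nabla)\rho=0$, $\nabla\cdot u=0$, $u+\nabla p=-(0,\rho)$, where the velocity is given by the Biot-Savart law $u=\nabla^\perp(-\Delta)^{-1}\partial_{x_1}\rho$, with $\nabla^\perp=(-\partial_{x_2},\partial_{x_1})$ and $(-\Delta)^{-1}$ the inverse Laplacian on $\mathbb{R}^2$. A global-in-time smooth solution is a solution $\rho$ that is smooth on $\mathbb{R}^2\times[0,\infty)$, with $\rho(\cdot,t)\in C_c^\infty(\mathbb{R}^2)$ for each $t\ge 0$ and $\rho(\cdot,0)=\rho_0$. The Fourier transform is $\hat f(\xi)=\frac{1}{2\pi}\int_{\mathbb{R}^2}e^{-i\xi\cdot x}f(x)\,dx$, and $\|f\|_{\dot H^s(\mathbb{R}^2)}^2=\int_{\mathbb{R}^2}|\xi|^{2s}|\hat f(\xi)|^2\,d\xi$. *)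

(* Defs.v *)
From HB Require Import structures.
From mathcomp Require Import all_boot all_order all_algebra.
From mathcomp Require Import all_classical all_reals all_analysis.
From mathcomp Require Import complex.

Set Implicit Arguments.
Unset Strict Implicit.
Unset Printing Implicit Defensive.

Import Order.TTheory GRing.Theory Num.Theory.
Import numFieldNormedType.Exports.
Import ComplexField.Normc.

Local Open Scope classical_set_scope.
Local Open Scope ring_scope.
Local Open Scope complex_scope.

Section Smoothness.
Context {R : realType} {V : normedModType R}.
Implicit Types (D : set V) (f : V -> R) (z v : V).

(* Directional derivatives along increments that stay in [D]; they are the
   usual ones at interior points of [D] and one-sided at the boundary of a
   half-space. *)
Definition quotient_within D f z v : set_system R :=
  (fun h : R => h^-1 * (f (h *: v + z) - f z))
    @ within [set h | D (h *: v + z)] 0^'.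

Definition derivable_within D f z v : Prop := cvg (quotient_within D f z v).

Definition derive_within D f z v : R := lim (quotient_within D f z v).

Definition iter_derive D (l : seq V) f : V -> R :=
  foldr (fun v g => derive_within D g ^~ v) f l.

(* C^oo on [D]: the iterated directional derivatives of every order exist and
   are continuous on [D], up to the boundary. *)
Definition smooth_on D f : Prop := forall l : seq V,
  {within D, continuous (iter_derive D l f)} /\
  (forall z v, D z -> derivable_within D (iter_derive D l f) z v).

End Smoothness.

Section Plane.
Context {R : realType}.
Local Notation plane := (R * R)%type.
Implicit Types (f : plane -> R) (x y xi : plane) (s t : R).

Definition e1 : plane := (1, 0).
Definition e2 : plane := (0, 1).

Definition dot x y : R := x.1 * y.1 + x.2 * y.2.

(* The library norm on a product is the max norm. *)
Definition enorm x : R := Num.sqrt (dot x x).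

Local Notation leb2 :=
  (@lebesgue_measure R \x @lebesgue_measure R)%E.

Definition Cc_smooth f : Prop :=
  smooth_on setT f /\ compact (closure [set x | f x != 0]).

(* (-Delta)^{-1}, as convolution with the fundamental solution
   -(2 pi)^{-1} ln |x| of -Delta in the plane. *)
Definition inv_neg_laplacian f x : R :=
  - (2 * pi)^-1 * \int[leb2]_y (ln (enorm (x - y)) * f y).

Definition biot_savart f x : plane :=
  let psi := inv_neg_laplacian (fun y => 'D_e1 f y) in
  (- 'D_e2 psi x, 'D_e1 psi x).

Definition cintegral (F : plane -> R[i]) : R[i] :=
  (\int[leb2]_x complex.Re (F x)) +i* (\int[leb2]_x complex.Im (F x)).

Definition expi (a : R) : R[i] := cos a +i* sin a.

Definition fourier f xi : R[i] :=
  ((2 * pi)^-1)%:C * cintegral (fun x => expi (- dot xi x) * (f x)%:C).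

Definition hdot_norm s f : \bar R :=
  sqrte (\int[leb2]_xi (enorm xi `^ (2 * s) * normc (fourier f xi) ^+ 2)%:E)%E.

Definition spacetime : set (R * plane) := [set z | 0 <= z.1].

Definition ipm_at (rho p : R -> plane -> R) t x : Prop :=
  let u := biot_savart (rho t) in
  [/\ derive_within spacetime (fun z => rho z.1 z.2) (t, x) (1, 0)
        + (u x).1 * 'D_e1 (rho t) x + (u x).2 * 'D_e2 (rho t) x = 0,
      'D_e1 (fun y => (u y).1) x + 'D_e2 (fun y => (u y).2) x = 0,
      differentiable (p t) x,
      (u x).1 + 'D_e1 (p t) x = 0
    & (u x).2 + 'D_e2 (p t) x = - rho t x].

(* Only the values [rho t] with [0 <= t] are constrained. *)
Record global_smooth_solution (rho0 : plane -> R) (rho : R -> plane -> R) :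
    Prop := GlobalSmoothSolution {
  gss_smooth : smooth_on spacetime (fun z => rho z.1 z.2) ;
  gss_Cc : forall t, 0 <= t -> Cc_smooth (rho t) ;
  gss_init : forall x, rho 0 x = rho0 x ;
  gss_ipm : exists p : R -> plane -> R, forall t x, 0 <= t -> ipm_at rho p t x
}.

End Plane.

(* Main.v *)
(** Functions of the density are transported by the divergence-free velocity, so
    their integrals are conserved, a priori only on time intervals on which the
    L^2 norm is bounded; since the norm is lower semicontinuous in time, a
    nested-interval argument removes this proviso. Conservation of the L^1 norm
    bounds the velocity locally in space and time, so the support grows at finite
    speed; an L^2 estimate on short intervals then propagates oddness in x_2, and
    transporting the negative part in the upper half-plane propagates positivity
    there. Hence the potential energy E = \int x_2 rho stays nonnegative, while it
    decreases at rate D = \int xi_1^2 / |xi|^2 |rho^|^2: the time integral of D is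
    at most E(0). As |rho^| is bounded by the L^1 norm, a box [|xi_1| <= a, |xi_2| <= h]
    of small area carries at most a quarter of the L^2 mass, and outside it either
    |xi| > h or |xi_1| / |xi| >= a / h; optimizing in h bounds the power -4/s of
    the H^s norm by a constant times D. *)
From HB Require Import structures.
Require Import Defs.
From mathcomp Require Import all_boot all_order all_algebra.
From mathcomp Require Import all_classical all_reals all_analysis.
From mathcomp Require Import measurable_realfun.
From mathcomp Require Import complex.
From mathcomp Require Import ring lra.
Import Order.TTheory GRing.Theory Num.Theory.
Import numFieldNormedType.Exports.
Set Implicit Arguments.
Unset Strict Implicit.
Unset Printing Implicit Defensive.
Local Open Scope classical_set_scope.
Local Open Scope ring_scope.

(** The density has compact support at each separate time, but no bound on the supports over a time
    interval is given, and the velocity has no compact support at all. Hence identities in time are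
    tested against spatial cutoffs, the errors being L^2 pairings of the velocity with the density
    times a cutoff gradient; this is why conservation first needs an L^2 bound. The L^2 bound on the
    velocity, the sign of the dissipation and its formula in frequency share one source, the
    quadratic form of - ln |x - y|. Frullani's formula writes - ln |x - y|^2 as the integral over t
    > 0 of (exp(- t |x - y|^2) - exp(- t)) / t; the subtracted constant disappears on functions of
    zero mean, and Gaussian forms are diagonal in frequency. Polarizing the resulting positive form
    takes the place of singular integral theory. The exponent 4/s comes from the box: at fixed area
    a is proportional to 1/h, so the dissipation enters with the factor (h/a)^2, of order h^4, while
    balancing the H^s term makes h^(2s) proportional to the square of the H^s norm. *)

(** * Borel measurability of continuous functions on products *)

Section CountableBase.
Context {R : realType}.

(* Members need not be open: a countable family of measurable sets that refines
   every neighbourhood is all that Borel measurability of open sets requires. *)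
Definition countable_msbasis {d} (T : measurableType d) (top : T -> set_system T) :=
  exists B : nat -> set T, (forall n, measurable (B n)) /\
    forall x A, top x A -> exists n, B n x /\ B n `<=` A.

Lemma countable_msbasis_real :
  @countable_msbasis _ (measurableTypeR R) (@nbhs R R).
Proof.
exists (fun n => if @unpickle (rat * rat)%type n is Some (q, r)
  then `]ratr q : R, ratr r[%classic else set0); split.
  move=> n; case: unpickle => [[q m]|]; last exact: measurable0.
  exact: measurable_itv.
move=> x A /nbhs_ballP[e /= e0 xA].
have [q /itvP qx] := @rat_in_itvoo R (x - e) x ltac:(lra).
have [r /itvP rx] := @rat_in_itvoo R x (x + e) ltac:(lra).
exists (pickle (q, r)); rewrite pickleK; split => [|y /itvP yqr].
  by rewrite /= in_itv/= qx rx.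
apply: xA; rewrite /ball/= ltr_norml.
have qy : ratr q < y by rewrite yqr.
have yr : y < ratr r by rewrite yqr.
have xr : ratr r < x + e by rewrite rx.
have xq : x - e < ratr q by rewrite qx.
lra.
Qed.

Lemma countable_msbasis_prod {d1 d2} (T1 : measurableType d1)
    (T2 : measurableType d2) top1 top2 :
  @countable_msbasis _ T1 top1 -> @countable_msbasis _ T2 top2 ->
  @countable_msbasis _ (T1 * T2)%type
    (fun x => filter_prod (top1 x.1) (top2 x.2)).
Proof.
move=> [B1 [mB1 b1]] [B2 [mB2 b2]].
exists (fun n => if @unpickle (nat * nat)%type n is Some (i, j)
  then B1 i `*` B2 j else set0); split.
  by move=> n; case: unpickle => [[i j]|]; [exact: measurableX|exact: measurable0].
move=> [x y] A /= [[A1 A2] /= [xA1 yA2] A12].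
have [i [xi iA]] := b1 _ _ xA1; have [j [yj jA]] := b2 _ _ yA2.
exists (pickle (i, j)); rewrite pickleK; split => // -[u v] /= [ui vj].
by apply: A12; split; [exact: iA|exact: jA].
Qed.

(** The preimage of an open interval is the union of the basis members that it contains, hence a
    countable union of measurable sets. The topology enters only through the neighbourhood map
    [top], so that product filters can be plugged in for iterated products. *)
Lemma continuous_measurable_msbasis {d} (T : measurableType d)
    (top : T -> set_system T) (f : T -> R) :
  countable_msbasis top ->
  (forall x (A : set R), nbhs (f x) A -> top x (f @^-1` A)) ->
  @measurable_fun _ _ T (measurableTypeR R) setT f.
Proof.
move=> [B [mB bB]] cf.
apply: (measurability (@RGenOpens.G R)); first exact: RGenOpens.measurableE.
move=> _ [_ [a [b ->] <-]]; rewrite setTI.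
pose P n := `[< B n `<=` f @^-1` `]a, b[%classic >].
have -> : f @^-1` `]a, b[%classic = \bigcup_(n in [set n | P n]) B n.
  apply/seteqP; split=> x.
    move=> fx; have := cf x `]a, b[%classic
      (open_nbhs_nbhs (conj (@interval_open R (BRight a) (BLeft b) erefl erefl) fx)).
    by move=> /bB[n [nx nA]]; exists n => //; exact/asboolP.
  by move=> [n /asboolP nP /nP].
by apply: bigcup_measurable => n _; exact: mB.
Qed.

Lemma continuous_measurable_plane (f : R * R -> R) :
  continuous f ->
  @measurable_fun _ _ (measurableTypeR R * measurableTypeR R)%type (measurableTypeR R) setT f.
Proof.
move=> cf; apply: (continuous_measurable_msbasis (countable_msbasis_prod countable_msbasis_real countable_msbasis_real)) => x A.
exact: cf.
Qed.

Lemma continuous_measurable_spacetime (f : R * (R * R) -> R) :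
  continuous f ->
  @measurable_fun _ _ (measurableTypeR R * (measurableTypeR R * measurableTypeR R))%type
    (measurableTypeR R) setT f.
Proof.
move=> cf; apply: (continuous_measurable_msbasis (countable_msbasis_prod countable_msbasis_real (countable_msbasis_prod countable_msbasis_real countable_msbasis_real))) => x A.
exact: cf.
Qed.

Lemma continuous_measurable_plane2 (f : (R * R) * (R * R) -> R) :
  continuous f ->
  @measurable_fun _ _ ((measurableTypeR R * measurableTypeR R) * (measurableTypeR R * measurableTypeR R))%type
    (measurableTypeR R) setT f.
Proof.
move=> cf; apply: (continuous_measurable_msbasis (countable_msbasis_prod (countable_msbasis_prod countable_msbasis_real countable_msbasis_real) (countable_msbasis_prod countable_msbasis_real countable_msbasis_real))) => x A.
exact: cf.
Qed.

End CountableBase.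

(** * Real-valued integrals, Fubini and tensor products *)

Section IntegralTools.
Context {R : realType} {d} {T : measurableType d}.
Variable mu : {measure set T -> \bar R}.
Implicit Types f g : T -> R.
Local Notation mint f := (mu.-integrable setT (EFin \o f)).

Lemma mint_meas f : mint f -> measurable_fun setT f.
Proof. by move/(measurable_int mu)/measurable_EFinP. Qed.

Lemma mintD f g : mint f -> mint g -> mint (fun x => f x + g x).
Proof. by move=> mf mg; have := integrableD measurableT mf mg. Qed.

Lemma mintN f : mint f -> mint (fun x => - f x).
Proof. by move=> mf; have := integrableN mf. Qed.

Lemma mintB f g : mint f -> mint g -> mint (fun x => f x - g x).
Proof. by move=> mf mg; apply: mintD => //; exact: mintN. Qed.

Lemma mintZ c f : mint f -> mint (fun x => c * f x).
Proof. by move=> mf; have := integrableZl measurableT c mf. Qed.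

Lemma mint_norm f : mint f -> mint (fun x => `|f x|).
Proof. by move=> mf; have := integrable_norm mf. Qed.

Lemma mint_le f g : measurable_fun setT f -> (forall x, `|f x| <= g x) ->
  mint g -> mint f.
Proof.
move=> mf fg mg; apply: (le_integrable measurableT _ _ mg).
  exact/measurable_EFinP.
by move=> x _; rewrite /= lee_fin (le_trans (fg x))// ler_norm.
Qed.

Lemma mintM f g K : measurable_fun setT g -> (forall x, `|g x| <= K) ->
  mint f -> mint (fun x => f x * g x).
Proof.
move=> mg gK mf; apply: (@mint_le _ (fun x => K * `|f x|)).
- by apply: measurable_funM => //; exact: mint_meas.
- by move=> x; rewrite normrM mulrC ler_wpM2r.
- exact/mintZ/mint_norm.
Qed.

Lemma RintD f g : mint f -> mint g ->
  \int[mu]_x (f x + g x) = \int[mu]_x f x + \int[mu]_x g x.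
Proof. exact: RintegralD. Qed.

Lemma RintB f g : mint f -> mint g ->
  \int[mu]_x (f x - g x) = \int[mu]_x f x - \int[mu]_x g x.
Proof. exact: RintegralB. Qed.

Lemma RintZ c f : mint f -> \int[mu]_x (c * f x) = c * \int[mu]_x f x.
Proof. exact: RintegralZl. Qed.

Lemma RintN f : mint f -> \int[mu]_x (- f x) = - \int[mu]_x f x.
Proof.
move=> mf; rewrite -mulN1r -RintZ//.
by apply: eq_Rintegral => x _; rewrite mulN1r.
Qed.

Lemma Rint_le f g : mint f -> mint g -> (forall x, f x <= g x) ->
  \int[mu]_x f x <= \int[mu]_x g x.
Proof. by move=> mf mg fg; apply: le_Rintegral. Qed.

Lemma Rint_norm_le f g : mint f -> mint g -> (forall x, `|f x| <= g x) ->
  `|\int[mu]_x f x| <= \int[mu]_x g x.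
Proof.
move=> mf mg fg; apply: le_trans (le_normr_Rintegral measurableT mf) _.
by apply: Rint_le => //; exact: mint_norm.
Qed.

Lemma Rint_ext f g : (forall x, f x = g x) ->
  \int[mu]_x f x = \int[mu]_x g x.
Proof. by move=> fg; apply: eq_Rintegral. Qed.

Lemma Rint_EFin f : mint f ->
  (\int[mu]_x (f x)%:E)%E = (\int[mu]_x f x)%:E.
Proof. by move=> mf; rewrite /Rintegral fineK// integrable_fin_num. Qed.

End IntegralTools.

Section FubiniReal.
Context {R : realType} {d1 d2} {T1 : measurableType d1} {T2 : measurableType d2}.
Variables (m1 : {sigma_finite_measure set T1 -> \bar R})
  (m2 : {sigma_finite_measure set T2 -> \bar R}).
Variable f : T1 * T2 -> R.

(** [Rintegral] gives a real value even to an infinite inner integral, so the iterated real integral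
    agrees with the extended one only where the slice is integrable. This holds almost everywhere,
    which is enough for both claims. *)
Lemma mint_prodl : (m1 \x m2)%E.-integrable setT (EFin \o f) ->
  m1.-integrable setT (EFin \o (fun x => \int[m2]_y f (x, y))) /\
  \int[m1]_x \int[m2]_y f (x, y) = \int[(m1 \x m2)%E]_z f z.
Proof.
move=> mf; have ae := ae_integrable1 mf.
have iF := integrable_fubini_F mf.
have mfin : measurable_fun setT (fun x => \int[m2]_y f (x, y)).
  rewrite /Rintegral; apply: (measurableT_comp (@fine_measurable R setT measurableT)) => //.
  exact: measurable_int iF.
have e : {ae m1, forall x, setT x -> fubini_F m2 (EFin \o f) x = (\int[m2]_y f (x, y))%:E}.
  apply: filterS ae => x ix _; rewrite /fubini_F /= /Rintegral fineK//.
  exact: integrable_fin_num.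
have i1 : m1.-integrable setT (EFin \o (fun x => \int[m2]_y f (x, y))).
  apply/integrableP; split; first exact/measurable_EFinP.
  have /integrableP[_] := iF; apply: le_lt_trans.
  rewrite le_eqVlt; apply/orP; left; apply/eqP; apply: ae_eq_integral => //.
  - by apply: measurableT_comp => //; exact/measurable_EFinP.
  - by apply: measurableT_comp => //; exact: measurable_int iF.
  - by apply: filterS e => x /= h _; rewrite h.
split => //; rewrite /Rintegral -(integral12_prod_meas1 mf); congr fine.
apply: ae_eq_integral => //.
- exact: measurable_int i1.
- exact: measurable_int iF.
- by apply: filterS e => x /= h _; rewrite h.
Qed.

Lemma mint_prodr : (m1 \x m2)%E.-integrable setT (EFin \o f) ->
  m2.-integrable setT (EFin \o (fun y => \int[m1]_x f (x, y))) /\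
  \int[m2]_y \int[m1]_x f (x, y) = \int[(m1 \x m2)%E]_z f z.
Proof.
move=> mf; have ae := ae_integrable2 mf.
have iF := measurable_fubini_G mf.
have mfin : measurable_fun setT (fun y => \int[m1]_x f (x, y)).
  by rewrite /Rintegral; apply: (measurableT_comp (@fine_measurable R setT measurableT)).
have e : {ae m2, forall y, setT y -> fubini_G m1 (EFin \o f) y = (\int[m1]_x f (x, y))%:E}.
  apply: filterS ae => x ix _; rewrite /fubini_G /= /Rintegral fineK//.
  exact: integrable_fin_num.
have i1 : m2.-integrable setT (EFin \o (fun y => \int[m1]_x f (x, y))).
  apply/integrableP; split; first exact/measurable_EFinP.
  have /(integrable21ltyP m1 m2 (measurable_int _ mf)) := mf; apply: le_lt_trans.
  apply: (@le_trans _ _ (\int[m2]_y `|fubini_G m1 (EFin \o f) y|)%E).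
    rewrite le_eqVlt; apply/orP; left; apply/eqP; apply: ae_eq_integral => //.
    - by apply: measurableT_comp => //; exact/measurable_EFinP.
    - by apply: measurableT_comp.
    - by apply: filterS e => x /= h _; rewrite h.
  apply: ge0_le_integral => //.
  - by apply: measurableT_comp.
  - have := @measurable_fun_fubini_tonelli_G _ _ _ _ R m1 (fun z => (`|f z|)%:E).
    by apply=> //; apply/measurable_EFinP; apply: measurableT_comp => //; exact: mint_meas mf.
  - move=> y _; apply: le_abse_integral => //.
    exact/measurable_EFinP/(measurableT_comp (mint_meas mf))/measurable_pair2.
split => //; rewrite /Rintegral -(integral21_prod_meas1 mf); congr fine.
apply: ae_eq_integral => //.
- exact: measurable_int i1.
- by apply: filterS e => x /= h _; rewrite h.
Qed.

Lemma mint_prod (A : T1 -> R) : measurable_fun setT f ->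
  (forall x, m2.-integrable setT (EFin \o (fun y => f (x, y)))) ->
  (forall x, \int[m2]_y `|f (x, y)| <= A x) ->
  m1.-integrable setT (EFin \o A) ->
  (m1 \x m2)%E.-integrable setT (EFin \o f).
Proof.
move=> mf i2 fA iA; apply/integrable12ltyP; first exact/measurable_EFinP.
have /integrableP[_] := iA; apply: le_lt_trans.
apply: ge0_le_integral => //.
- by move=> x _; exact: integral_ge0.
- have := @measurable_fun_fubini_tonelli_F _ _ _ _ R m2 (fun z => (`|f z|)%:E).
  apply=> //; apply/measurable_EFinP; exact: measurableT_comp.
- by apply: measurableT_comp => //; exact: measurable_int iA.
- move=> x _; rewrite /= (Rint_EFin (mint_norm (i2 x))) lee_fin.
  by rewrite (le_trans (fA x))// ler_norm.
Qed.

End FubiniReal.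

Section Tensor.
Context {R : realType} {d1 d2} {T1 : measurableType d1} {T2 : measurableType d2}.
Variables (m1 : {sigma_finite_measure set T1 -> \bar R})
  (m2 : {sigma_finite_measure set T2 -> \bar R}).
Variables (a : T1 -> R) (b : T2 -> R).
Hypotheses (ia : m1.-integrable setT (EFin \o a))
  (ib : m2.-integrable setT (EFin \o b)).

Lemma mint_tensor : (m1 \x m2)%E.-integrable setT
  (EFin \o (fun z => a z.1 * b z.2)).
Proof.
apply: (@mint_prod _ _ _ _ _ _ _ _ (fun x => (\int[m2]_y `|b y|) * `|a x|)).
- apply: measurable_funM.
  + by apply: (measurableT_comp (mint_meas ia)) => //; exact: measurable_fst.
  + by apply: (measurableT_comp (mint_meas ib)) => //; exact: measurable_snd.
- by move=> x /=; exact: mintZ.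
- move=> x /=; under eq_Rintegral do rewrite normrM.
  by rewrite RintZ 1?mulrC//; exact: mint_norm.
- exact/mintZ/mint_norm.
Qed.

Lemma Rint_tensor :
  \int[(m1 \x m2)%E]_z (a z.1 * b z.2) = (\int[m1]_x a x) * \int[m2]_y b y.
Proof.
rewrite -(mint_prodl mint_tensor).2 /= mulrC -RintZ//.
by apply: Rint_ext => x; rewrite RintZ// mulrC.
Qed.

End Tensor.

Lemma Rint_swap {R : realType} {d1 d2} {T1 : measurableType d1} {T2 : measurableType d2}
    (m1 : {sigma_finite_measure set T1 -> \bar R})
    (m2 : {sigma_finite_measure set T2 -> \bar R}) (f : T1 * T2 -> R) :
  (m1 \x m2)%E.-integrable setT (EFin \o f) ->
  \int[m1]_x \int[m2]_y f (x, y) = \int[m2]_y \int[m1]_x f (x, y).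
Proof. by move=> mf; rewrite (mint_prodl mf).2 (mint_prodr mf).2. Qed.

(** * Continuity rules and C^1 calculus on the plane *)

Section ContinuityRules.
Context {R : realType} {T : topologicalType}.
Implicit Types f g : T -> R.

Lemma cont_add f g : continuous f -> continuous g -> continuous (fun x => f x + g x).
Proof. by move=> cf cg x; apply: cvgD; [exact: cf|exact: cg]. Qed.

Lemma cont_mul f g : continuous f -> continuous g -> continuous (fun x => f x * g x).
Proof. by move=> cf cg x; apply: cvgM; [exact: cf|exact: cg]. Qed.

Lemma cont_opp f : continuous f -> continuous (fun x => - f x).
Proof. by move=> cf x; apply: cvgN; exact: cf. Qed.

Lemma cont_sub f g : continuous f -> continuous g -> continuous (fun x => f x - g x).
Proof. by move=> cf cg; apply: cont_add => //; exact: cont_opp. Qed.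

Lemma cont_cst {U : topologicalType} (c : U) : continuous (fun _ : T => c).
Proof. by move=> x; exact: cvg_cst. Qed.

Lemma cont_comp {U V : topologicalType} (f : T -> U) (g : U -> V) :
  continuous f -> continuous g -> continuous (fun x => g (f x)).
Proof. by move=> cf cg x; apply: (@continuous_comp _ _ _ f g); [exact: cf|exact: cg]. Qed.

Lemma cont_inv f : (forall x, f x != 0) -> continuous f -> continuous (fun x => (f x)^-1).
Proof. by move=> f0 cf x; apply: cvgV; [exact: f0|exact: cf]. Qed.

Lemma cont_exp f n : continuous f -> continuous (fun x => f x ^+ n).
Proof. by move=> cf; apply: (@cont_comp _ _ f (fun y => y ^+ n)) => //; exact: exprn_continuous. Qed.

Lemma cont_pair {U V : topologicalType} (f : T -> U) (g : T -> V) :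
  continuous f -> continuous g -> continuous (fun x => (f x, g x)).
Proof. by move=> cf cg x; exact: (cvg_pair (cf x) (cg x)). Qed.

Lemma cont_fst {U V : topologicalType} (f : T -> U * V) :
  continuous f -> continuous (fun x => (f x).1).
Proof. by move=> cf; apply: (cont_comp cf) => x; exact: cvg_fst. Qed.

Lemma cont_snd {U V : topologicalType} (f : T -> U * V) :
  continuous f -> continuous (fun x => (f x).2).
Proof. by move=> cf; apply: (cont_comp cf) => x; exact: cvg_snd. Qed.

Lemma cont_id : continuous (fun x : T => x).
Proof. by move=> x; exact: cvg_id. Qed.

End ContinuityRules.

Section PlaneCalculus.
Context {R : realType}.
Local Notation leb := (@lebesgue_measure R).
Local Notation mu2 := (leb \x leb)%E.
Local Notation plane := (R * R)%type.
Implicit Types (f g : plane -> R) (M : R).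
Local Notation mint f := (mu2.-integrable setT (EFin \o f)).

Lemma plane_norm_le (x : plane) M : (`|x| <= M) = (`|x.1| <= M) && (`|x.2| <= M).
Proof. by rewrite prod_normE ge_max. Qed.

Lemma compact_box (M : R) : compact [set x : plane | `|x| <= M].
Proof.
rewrite (_ : [set x | _] = `[- M, M]%classic `*` `[- M, M]%classic); last first.
  by apply/seteqP; split => -[x y] /=; rewrite plane_norm_le /= !in_itv/= -!ler_norml => /andP.
by apply: compact_setX; exact: segment_compact.
Qed.

Lemma compact_bounded_fun {V : topologicalType} (K : set V) (f : V -> R) :
  continuous f -> compact K -> exists C, 0 < C /\ forall x, K x -> `|f x| <= C.
Proof.
move=> cf cK; have : compact (f @` K).
  by apply: continuous_compact => //; exact: continuous_subspaceT.
move=> /compact_bounded[M [_ Mf]].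
exists (Num.max (M + 1) 1); split; first by rewrite lt_max ltr01 orbT.
move=> x Kx; have h : `|f x| <= M + 1 by apply: (Mf (M + 1)); [rewrite ltrDl|exists x].
by rewrite le_max h.
Qed.

(** Compact support is recorded as vanishing beyond some radius of the max norm; the radius directly
    feeds the boxes [ibox] used as dominating functions and the choice of cutoff radii. *)
Definition cc (f : plane -> R) :=
  continuous f /\ exists M, forall x, M < `|x| -> f x = 0.

Lemma cc_bounded f : cc f -> exists K, 0 < K /\ forall x, `|f x| <= K.
Proof.
move=> [cf [M fM]]; have [K [K0 fK]] := compact_bounded_fun cf (@compact_box M).
exists K; split=> // x; have [xM|Mx] := leP `|x| M; first exact: fK.
by rewrite fM// normr0 ltW.
Qed.

Lemma mint_itv (a b : R) : leb.-integrable setT (EFin \o (\1_`[a, b] : R -> R)).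
Proof. exact: integrable_indic_itv. Qed.

Definition ibox (M : R) (x : plane) : R :=
  \1_(`[- M, M]%classic) x.1 * \1_(`[- M, M]%classic) x.2.

Lemma iboxE M (x : plane) : ibox M x = (`|x| <= M)%R%:R.
Proof.
rewrite /ibox plane_norm_le !indicE -natrM mulnb; congr ((_ : bool)%:R).
by congr andb; rewrite mem_setE in_itv/= ler_norml.
Qed.

Lemma ibox_ge0 M x : 0 <= ibox M x. Proof. by rewrite iboxE. Qed.

Lemma mint_ibox M : mint (ibox M).
Proof. exact: (mint_tensor (mint_itv _ _) (mint_itv _ _)). Qed.

Lemma cc_mint f : cc f -> mint f.
Proof.
move=> cf; have [K [K0 fK]] := cc_bounded cf; have [? [M fM]] := cf.
apply: (@mint_le _ _ _ mu2 f (fun x => K * ibox M x)).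
- exact: continuous_measurable_plane.
- move=> x; rewrite iboxE; have [xM|Mx] := leP `|x| M; first by rewrite mulr1.
  by rewrite fM// normr0 mulr0.
- exact/mintZ/mint_ibox.
Qed.

Lemma cc_mulr f g : cc f -> continuous g -> cc (fun x => f x * g x).
Proof.
move=> [cf [M fM]] cg; split; first by move=> x; apply: cvgM; [exact: cf|exact: cg].
by exists M => x Mx; rewrite fM// mul0r.
Qed.

Lemma cc_mull f g : cc f -> continuous g -> cc (fun x => g x * f x).
Proof. by move=> cf cg; under eq_fun do rewrite mulrC; exact: cc_mulr. Qed.

Lemma cc_add f g : cc f -> cc g -> cc (fun x => f x + g x).
Proof.
move=> [cf [M fM]] [cg [N gN]]; split; first by move=> x; apply: cvgD; [exact: cf|exact: cg].
by exists (Num.max M N) => x; rewrite gt_max => /andP[Mx Nx]; rewrite fM// gN// addr0.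
Qed.

Lemma cc_scale c f : cc f -> cc (fun x => c * f x).
Proof. by move=> cf; apply: cc_mull => // x; exact: cvg_cst. Qed.

Lemma cc_comp (phi : R -> R) f : continuous phi -> phi 0 = 0 -> cc f ->
  cc (fun x => phi (f x)).
Proof.
move=> cphi phi0 [cf [M fM]]; split; last by exists M => x Mx; rewrite fM.
by move=> x; apply: (@continuous_comp _ _ _ f phi); [exact: cf|exact: cphi].
Qed.

Definition ej (j : bool) : plane := if j then e1 else e2.

(* [pd true] and [pd false] are the partial derivatives in x_1 and x_2. *)
Definition pd j (f : plane -> R) : plane -> R := 'D_(ej j) f.

Definition C1 (f : plane -> R) :=
  continuous f /\ forall j, (forall x, derivable f x (ej j)) /\ continuous (pd j f).

Lemma is_derive_line (f : plane -> R) x v a :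
  is_derive x v f a <-> is_derive (0 : R) 1 (fun s => f (s *: v + x)) a.
Proof.
have e : (fun h : R => h^-1 *: ((f \o shift x) (h *: v) - f x)) =
  (fun h : R => h^-1 *: (((fun s => f (s *: v + x)) \o shift 0) (h *: (1 : R))
     - f (0 *: v + x))).
  by apply/funext => h /=; rewrite scale0r add0r addr0 /GRing.scale/= mulr1.
by split=> -[dd dv]; split; move: dd dv; rewrite /derivable /derive e.
Qed.

Lemma is_derive_fst (f : plane -> R) x a :
  is_derive x e1 f a <-> is_derive x.1 1 (fun s => f (s, x.2)) a.
Proof.
have e : (fun h : R => h^-1 *: ((f \o shift x) (h *: e1) - f x)) =
  (fun h : R => h^-1 *: (((fun s => f (s, x.2)) \o shift x.1) (h *: (1 : R))
     - f (x.1, x.2))).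
  apply/funext => h; congr (_ *: (_ - _)); last by case: x.
  by congr f; rewrite /shift/= /e1; congr pair; rewrite /= scaler0 add0r.
by split=> -[dd dv]; split; move: dd dv; rewrite /derivable /derive e.
Qed.

Lemma is_derive_snd (f : plane -> R) x a :
  is_derive x e2 f a <-> is_derive x.2 1 (fun s => f (x.1, s)) a.
Proof.
have e : (fun h : R => h^-1 *: ((f \o shift x) (h *: e2) - f x)) =
  (fun h : R => h^-1 *: (((fun s => f (x.1, s)) \o shift x.2) (h *: (1 : R))
     - f (x.1, x.2))).
  apply/funext => h; congr (_ *: (_ - _)); last by case: x.
  by congr f; rewrite /shift/= /e2; congr pair; rewrite /= scaler0 add0r.
by split=> -[dd dv]; split; move: dd dv; rewrite /derivable /derive e.
Qed.

Lemma is_derive_chain (phi : R -> R) (f : plane -> R) x v a b :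
  is_derive (f x) 1 phi a -> is_derive x v f b ->
  is_derive x v (fun y => phi (f y)) (a * b).
Proof.
move=> dphi /is_derive_line df; apply/is_derive_line.
by apply: is_derive1_comp => //; rewrite scale0r add0r.
Qed.

Lemma C1_is_derive f j x : C1 f -> is_derive x (ej j) f (pd j f x).
Proof. by move=> [_ /(_ j)[df _]]; apply: DeriveDef. Qed.

Lemma C1_intro (f : plane -> R) (g : bool -> plane -> R) : continuous f ->
  (forall j, continuous (g j)) ->
  (forall j x, is_derive x (ej j) f (g j x)) -> C1 f /\ forall j, pd j f = g j.
Proof.
move=> cf cg fg; have e j : pd j f = g j.
  by apply/funext => x; exact: (derive_val (is_derive := fg j x)).
by split=> //; split=> // j; rewrite e; split=> // x; exact: (ex_derive (is_derive := fg j x)).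
Qed.

Lemma C1_comp (phi dphi : R -> R) f : C1 f -> continuous phi ->
  continuous dphi -> (forall s, is_derive s (1 : R) phi (dphi s)) ->
  C1 (fun x => phi (f x)) /\
  forall j, pd j (fun x => phi (f x)) = (fun x => dphi (f x) * pd j f x).
Proof.
move=> [cf df] cphi cdphi dp; apply: C1_intro.
- by move=> x; apply: (@continuous_comp _ _ _ f phi); [exact: cf|exact: cphi].
- move=> j x; apply: cvgM; last exact: (df j).2.
  by apply: (@continuous_comp _ _ _ f dphi); [exact: cf|exact: cdphi].
- by move=> j x; apply: is_derive_chain => //; exact: C1_is_derive.
Qed.

Lemma C1_mul f g : C1 f -> C1 g -> C1 (fun x => f x * g x) /\
  forall j, pd j (fun x => f x * g x) = (fun x => f x * pd j g x + g x * pd j f x).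
Proof.
move=> Cf Cg; have [cf df] := Cf; have [cg dg] := Cg; apply: C1_intro.
- by move=> x; apply: cvgM; [exact: cf|exact: cg].
- by move=> j x; apply: cvgD; apply: cvgM; [exact: cf|exact: (dg j).2|exact: cg|exact: (df j).2].
- by move=> j x; apply: is_deriveM; exact: C1_is_derive.
Qed.

Lemma C1_add f g : C1 f -> C1 g -> C1 (fun x => f x + g x) /\
  forall j, pd j (fun x => f x + g x) = (fun x => pd j f x + pd j g x).
Proof.
move=> Cf Cg; have [cf df] := Cf; have [cg dg] := Cg; apply: C1_intro.
- by move=> x; apply: cvgD; [exact: cf|exact: cg].
- by move=> j x; apply: cvgD; [exact: (df j).2|exact: (dg j).2].
- by move=> j x; apply: is_deriveD; exact: C1_is_derive.
Qed.

Lemma C1_cst c : C1 (fun=> c) /\ forall j, pd j (fun=> c) = (fun=> 0).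
Proof.
by apply: C1_intro => [x|j x]; [exact: cvg_cst|exact: cvg_cst].
Qed.

Lemma C1_scale c f : C1 f -> C1 (fun x => c * f x) /\
  forall j, pd j (fun x => c * f x) = (fun x => c * pd j f x).
Proof.
move=> Cf; have [Cc Dc] := C1_cst c; have [Ccf Dcf] := C1_mul Cc Cf.
by split=> // j; rewrite Dcf Dc; apply/funext => x; rewrite mulr0 addr0.
Qed.

Lemma cc_pd f j : C1 f -> cc f -> cc (pd j f).
Proof.
move=> [cf df] [_ [M fM]]; split; first exact: (df j).2.
exists M => x Mx.
have nx : \forall y \near x, f y = (fun=> 0) y.
  have o : open [set y : plane | M < `|y|].
    by apply: (@open_comp _ _ (fun y : plane => `|y|) [set t | M < t]);
      [move=> y _; exact: norm_continuous|exact: open_gt].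
  by have := open_nbhs_nbhs (conj o Mx); apply: filterS => y /= /fM.
by rewrite /pd (near_eq_derive _ nx) derive_cst.
Qed.

Lemma Rint_derive_line (F f : R -> R) (M : R) : continuous f ->
  (forall x, is_derive x (1 : R) F (f x)) -> (forall x, M < `|x| -> F x = 0) ->
  (forall x, M < `|x| -> f x = 0) -> \int[leb]_x f x = 0.
Proof.
move=> cf dF F0 f0; pose N := `|M| + 1.
have NM : M < N by rewrite /N; have := ler_norm M; lra.
have N0 : 0 < N by rewrite /N; have := normr_ge0 M; lra.
have -> : \int[leb]_x f x = \int[leb]_(x in `[- N, N]) f x.
  rewrite [RHS]Rintegral_mkcond; apply: Rint_ext => x; rewrite patchE mem_setE in_itv/=.
  by case: ifP => //; rewrite -ler_norml => /negbT; rewrite -ltNge => Nx; rewrite f0// (lt_trans NM).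
have cF : continuous F.
  move=> x; apply: differentiable_continuous; apply/derivable1_diffP.
  exact: (ex_derive (is_derive := dF x)).
rewrite /Rintegral (@continuous_FTC2 _ _ F) ?gtrN//.
- by rewrite !F0 ?normrN ?gtr0_norm// subee.
- exact: continuous_subspaceT.
- split; first by move=> x _; exact: (ex_derive (is_derive := dF x)).
  + by apply: cvg_at_right_filter; exact: cF.
  + by apply: cvg_at_left_filter; exact: cF.
- by move=> x _; rewrite derive1E; exact: (derive_val (is_derive := dF x)).
Qed.

(** Fubini makes the differentiated variable the inner one, and on each line the fundamental theorem
    of calculus gives 0. *)
Lemma Rint_pd f j : C1 f -> cc f -> \int[mu2]_x pd j f x = 0.
Proof.
move=> Cf ccf; have cDf := cc_pd j Cf ccf.
have iDf := cc_mint cDf; have [_ [M fM]] := ccf; have [cD [M' DM]] := cDf.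
move: cDf iDf cD M' DM; case: j => cDf iDf cD M' DM.
- rewrite -(mint_prodr iDf).2 (Rint_ext _ (g := fun=> 0)) ?Rintegral_cst ?mul0r// => y.
  apply: (@Rint_derive_line (fun s => f (s, y)) _ (Num.max M M')).
  + by move=> x; apply: (@cont_comp _ _ _ (fun s : R => (s, y)) (pd true f)) => //; apply: cont_pair; [exact: cont_id|exact: cont_cst].
  + by move=> x; exact: (is_derive_fst f (x, y) _).1 (C1_is_derive true (x, y) Cf).
  + by move=> x; rewrite gt_max => /andP[Mx _]; apply: fM; rewrite prod_normE lt_max Mx.
  + by move=> x; rewrite gt_max => /andP[_ Mx]; apply: DM; rewrite prod_normE lt_max Mx.
- rewrite -(mint_prodl iDf).2 (Rint_ext _ (g := fun=> 0)) ?Rintegral_cst ?mul0r// => y.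
  apply: (@Rint_derive_line (fun s => f (y, s)) _ (Num.max M M')).
  + by move=> x; apply: (@cont_comp _ _ _ (fun s : R => (y, s)) (pd false f)) => //; apply: cont_pair; [exact: cont_cst|exact: cont_id].
  + by move=> x; exact: (is_derive_snd f (y, x) _).1 (C1_is_derive false (y, x) Cf).
  + by move=> x; rewrite gt_max => /andP[Mx _]; apply: fM; rewrite prod_normE lt_max Mx orbT.
  + by move=> x; rewrite gt_max => /andP[_ Mx]; apply: DM; rewrite prod_normE lt_max Mx orbT.
Qed.

Lemma Rint_parts f g j : C1 f -> C1 g -> cc f ->
  \int[mu2]_x (f x * pd j g x) = - \int[mu2]_x (g x * pd j f x).
Proof.
move=> Cf Cg ccf; have [Cfg Dfg] := C1_mul Cf Cg.
have := Rint_pd j Cfg (cc_mulr ccf Cg.1); rewrite Dfg RintD.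
- by move/eqP; rewrite addr_eq0 => /eqP.
- by apply: cc_mint; apply: cc_mulr => //; exact: (Cg.2 j).2.
- by apply: cc_mint; apply: cc_mull; [exact: cc_pd|exact: Cg.1].
Qed.

End PlaneCalculus.

(** * Measure-preserving reflections, dominated convergence and derivative rules *)

Section Preserving.
Context {R : realType} {d} {T : measurableType d}.
Variable mu : {measure set T -> \bar R}.
Local Notation mint f := (mu.-integrable setT (EFin \o f)).

Definition preserves (phi : T -> T) := measurable_fun setT phi /\
  forall A, measurable A -> mu (phi @^-1` A) = mu A.

Lemma preserves_int phi (f : T -> R) : preserves phi -> mint f ->
  mint (fun x => f (phi x)) /\ \int[mu]_x f (phi x) = \int[mu]_x f x.
Proof.
move=> [mphi pphi] fi; have mf := mint_meas fi.
have ip : mint (fun x => f (phi x)).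
  apply/integrableP; split.
    by apply/measurable_EFinP; exact: (measurableT_comp mf mphi).
  have /integrableP[_] := fi; apply: le_lt_trans.
  rewrite le_eqVlt; apply/orP; left; apply/eqP; symmetry.
  rewrite (eq_measure_integral (pushforward mu phi)) => [|A mA _]; last exact/esym/pphi.
  rewrite ge0_integral_pushforward//.
  by apply: measurableT_comp => //; exact/measurable_EFinP.
split => //; rewrite /Rintegral; congr fine; symmetry.
rewrite (eq_measure_integral (pushforward mu phi)) => [|A mA _]; last exact/esym/pphi.
rewrite integral_pushforward ?preimage_setT//.
exact/measurable_EFinP.
Qed.

End Preserving.

Section PlanePreserving.
Context {R : realType}.
Local Notation leb := (@lebesgue_measure R).
Local Notation mu2 := (leb \x leb)%E.
Local Notation plane := (R * R)%type.
Local Notation mint f := (mu2.-integrable setT (EFin \o f)).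

Lemma preserves_id : preserves leb (fun s => s).
Proof. by split => //. Qed.

(** By uniqueness of Lebesgue measure it is enough to test half-open intervals. The preimage of []a,
    b]] is [[c - b, c - a[]: closed and open ends are exchanged, the length is kept. *)
Lemma preserves_reflect (c : R) : preserves leb (fun s => c - s).
Proof.
have mphi : measurable_fun setT (fun s : measurableTypeR R => c - s : measurableTypeR R).
  by apply: measurable_funB => //; exact: measurable_id.
split => // A mA.
suff : pushforward leb (fun s : R => c - s : measurableTypeR R) A = leb A by [].
apply/esym/lebesgue_measure_unique => // X /ocitvP[->|[[a b]/= ab ->]].
  by rewrite !measure0.
rewrite -[RHS]/(leb ((fun s => c - s) @^-1` `]a, b]%classic)) (_ : _ @^-1` _ = `[c - b, c - a[%classic).
  rewrite !lebesgue_measure_itv/= !lte_fin ab ltrD2l ltrN2 ab -!EFinB; congr EFin; ring.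
by apply/seteqP; split => s /=; rewrite !in_itv/=; lra.
Qed.

Lemma preserves_prod (p1 p2 : R -> R) : preserves leb p1 -> preserves leb p2 ->
  preserves mu2 (fun x : plane => (p1 x.1, p2 x.2)).
Proof.
move=> [m1 h1] [m2 h2].
have mphi : measurable_fun setT (fun x : measurableTypeR R * measurableTypeR R =>
    (p1 x.1, p2 x.2) : measurableTypeR R * measurableTypeR R).
  apply: measurable_fun_pair.
  - by apply: (measurableT_comp m1); exact: measurable_fst.
  - by apply: (measurableT_comp m2); exact: measurable_snd.
split => // X mX.
suff : pushforward mu2 (fun x : plane => (p1 x.1, p2 x.2) : measurableTypeR R * measurableTypeR R) X = mu2 X by [].
apply/esym/product_measure_unique => // A B mA mB.
rewrite -[LHS]/(mu2 ((p1 @^-1` A) `*` (p2 @^-1` B))).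
rewrite product_measure1E ?h1 ?h2//.
- by rewrite -[X in measurable X]setTI; exact: m1.
- by rewrite -[X in measurable X]setTI; exact: m2.
Qed.

Lemma Rint_reflect (x : plane) (f : plane -> R) : mint f ->
  mint (fun y => f (x - y)) /\ \int[mu2]_y f (x - y) = \int[mu2]_y f y.
Proof.
exact: (preserves_int (preserves_prod (preserves_reflect x.1) (preserves_reflect x.2))).
Qed.

Definition flip2 (x : plane) : plane := (x.1, - x.2).

Lemma Rint_flip2 (f : plane -> R) : mint f ->
  mint (fun y => f (flip2 y)) /\ \int[mu2]_y f (flip2 y) = \int[mu2]_y f y.
Proof.
have -> : flip2 = (fun x => (x.1, 0 - x.2)) by apply/funext => x; rewrite /flip2 sub0r.
exact: (preserves_int (preserves_prod preserves_id (preserves_reflect 0))).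
Qed.

End PlanePreserving.

Lemma dominated_cvg {R : realType} {d} {T : measurableType d}
    (mu : {measure set T -> \bar R}) (g : nat -> T -> R) (f G : T -> R) :
  (forall n, measurable_fun setT (g n)) -> measurable_fun setT f ->
  mu.-integrable setT (EFin \o G) -> (forall n y, `|g n y| <= G y) ->
  (forall y, g n y @[n --> \oo] --> f y) ->
  mu.-integrable setT (EFin \o f) /\
  \int[mu]_y g n y @[n --> \oo] --> \int[mu]_y f y.
Proof.
move=> mg mf iG gG gf.
have gf' y : (g n y)%:E @[n --> \oo] --> (f y)%:E.
  by apply: cvg_EFin; [exact: nearW|exact: gf].
have gG' y : forall n : nat, setT y -> (`|(g n y)%:E| <= (G y)%:E)%E.
  by move=> n _; exact: gG.
have [ip _ cI] := @dominated_convergence _ _ _ mu setT measurableT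
  (fun n y => (g n y)%:E) (fun y => (f y)%:E) (EFin \o G)
  (fun n => (measurable_EFinP _ _).2 (mg n)) ((measurable_EFinP _ _).2 mf)
  (aeW _ (fun y _ => gf' y)) iG (aeW _ gG').
by split => //; apply: fine_cvg; rewrite -(Rint_EFin ip); exact: cI.
Qed.

Section ParametricContinuity.
Context {R : realType} {V : normedModType R}.

Lemma seq_continuous_at (f : V -> R) (p : V) :
  (forall u : nat -> V, u n @[n --> \oo] --> p -> f (u n) @[n --> \oo] --> f p) ->
  {for p, continuous f}.
Proof.
move=> fu; apply: contrapT => nf.
have [e [e0 He]] : exists e : R, 0 < e /\ forall d : R, 0 < d ->
    exists x, `|p - x| < d /\ e <= `|f p - f x|.
  apply: contrapT => /forallNP h; apply: nf; apply/cvgrPdist_lt => e e0.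
  have := h e => /not_andP[//|/existsNP[d /not_implyP[d0 /forallNP hd]]].
  apply/nbhs_ballP; exists d => //= x; rewrite -ball_normE/= => px.
  by have := hd x => /not_andP[//|/negP]; rewrite -ltNge.
have /choice[u hu] : forall n : nat, exists x, `|p - x| < n.+1%:R^-1 /\ e <= `|f p - f x|.
  by move=> n; apply: He; rewrite invr_gt0.
have up : u n @[n --> \oo] --> p.
  apply/cvgrPdist_lt => d d0; near=> n.
  apply: (lt_trans (hu n).1); rewrite invf_plt ?posrE//.
  near: n; exists (Num.truncn d^-1) => // n /= dn.
  by rewrite (lt_le_trans (truncnS_gt _))// ler_nat.
have /cvgrPdist_lt/(_ e e0)[N _ /(_ N (leqnn _))/=] := fu u up.
by rewrite ltNge (hu N).2.
Unshelve. all: by end_near. Qed.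

Lemma dominated_continuous_at {d} {T : measurableType d}
    (mu : {measure set T -> \bar R}) (F : V -> T -> R) (p : V) (G : T -> R) (r : R) :
  0 < r -> (forall v, measurable_fun setT (F v)) ->
  mu.-integrable setT (EFin \o G) ->
  (forall v y, `|p - v| < r -> `|F v y| <= G y) ->
  (forall y, {for p, continuous (fun v => F v y)}) ->
  {for p, continuous (fun v => \int[mu]_y F v y)}.
Proof.
move=> r0 mF iG FG cF; apply: seq_continuous_at => u up.
(* The domination holds only within distance [r] of [p]. Replacing the terms outside that ball by
   [p] alters finitely many of them and makes the bound valid for all [n]. *)
pose u' n := if `|p - u n| < r then u n else p.
have uu' : \forall n \near \oo, u' n = u n.
  by move/cvgrPdist_lt : up => /(_ r r0); apply: filterS => n; rewrite /u' => ->.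
have u'r n : `|p - u' n| < r by rewrite /u'; case: ifP => //; rewrite subrr normr0.
have u'p : u' n @[n --> \oo] --> p.
  apply: cvg_trans up; apply: near_eq_cvg.
  by apply: filterS uu' => n ->.
have [_] := @dominated_cvg _ _ _ mu (fun n => F (u' n)) (F p) G (fun n => mF _) (mF p) iG
  (fun n y => FG _ y (u'r n)) (fun y => cvg_comp _ _ u'p (cF y)).
apply: cvg_trans; apply: near_eq_cvg.
by apply: filterS uu' => n ->.
Qed.

End ParametricContinuity.

Section DerivativeRules.
Context {R : realType} {V : normedModType R}.
Implicit Types (f g : V -> R) (x v : V).

Lemma dv_eq f x v a b : is_derive x v f a -> a = b -> is_derive x v f b.
Proof. by move=> df <-. Qed.

Lemma dv_add f g x v a b : is_derive x v f a -> is_derive x v g b ->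
  is_derive x v (fun y => f y + g y) (a + b).
Proof. by move=> df dg; exact: is_deriveD. Qed.

Lemma dv_opp f x v a : is_derive x v f a -> is_derive x v (fun y => - f y) (- a).
Proof. by move=> df; exact: is_deriveN. Qed.

Lemma dv_sub f g x v a b : is_derive x v f a -> is_derive x v g b ->
  is_derive x v (fun y => f y - g y) (a - b).
Proof. by move=> df dg; exact: is_deriveB. Qed.

Lemma dv_mul f g x v a b : is_derive x v f a -> is_derive x v g b ->
  is_derive x v (fun y => f y * g y) (f x * b + g x * a).
Proof. by move=> df dg; exact: is_deriveM. Qed.

Lemma dv_cst (c : R) x v : is_derive x v (fun=> c) 0.
Proof. exact: is_derive_cst. Qed.

Lemma dv_id (s : R) : is_derive s (1 : R) (fun t => t) 1.
Proof. exact: is_derive_id. Qed.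

End DerivativeRules.

Lemma dv_comp {R : realType} (f g : R -> R) (s a b : R) :
  is_derive (g s) 1 f a -> is_derive s 1 g b -> is_derive s 1 (fun t => f (g t)) (a * b).
Proof. by move=> df dg; exact: is_derive1_comp. Qed.

Lemma dv_sqr {R : realType} {V : normedModType R} (f : V -> R) (x v : V) a :
  is_derive x v f a -> is_derive x v (fun y => f y ^+ 2) (2 * f x * a).
Proof. by move=> df; apply: (dv_eq (dv_mul df df)); ring. Qed.

Lemma dv_inv {R : realType} (f : R -> R) (s a : R) : f s != 0 ->
  is_derive s 1 f a -> is_derive s 1 (fun t => (f t)^-1) (- a / f s ^+ 2).
Proof.
move=> f0 df; apply: (dv_eq (is_deriveV f0 df)).
by rewrite /GRing.scale/= mulNr mulrC mulNr.
Qed.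

Lemma dv_continuous {R : realType} (f df : R -> R) :
  (forall s : R, is_derive s (1 : R) f (df s)) -> continuous f.
Proof.
move=> dF x; apply: differentiable_continuous; apply/derivable1_diffP.
exact: (ex_derive (is_derive := dF x)).
Qed.

Lemma Rint_FTC {R : realType} (F f : R -> R) (a b : R) : a < b ->
  (forall s, a <= s <= b -> is_derive s 1 F (f s)) ->
  (forall s, a <= s <= b -> {for s, continuous f}) ->
  (\int[lebesgue_measure]_(s in `[a, b]) (f s)%:E)%E = (F b - F a)%:E.
Proof.
move=> ab dF cf.
have cF s : a <= s <= b -> {for s, continuous F}.
  move=> sab; apply: differentiable_continuous; apply/derivable1_diffP.
  exact: (ex_derive (is_derive := dF s sab)).
rewrite (@continuous_FTC2 _ _ F)//.
- apply: continuous_in_subspaceT => s; rewrite inE/= in_itv/= => ?; exact: cf.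
- split; first by move=> s; rewrite in_itv/= => /andP[? ?]; apply: (ex_derive (is_derive := dF s _)); rewrite !ltW.
  + by apply: cvg_at_right_filter; apply: cF; rewrite lexx ltW.
  + by apply: cvg_at_left_filter; apply: cF; rewrite lexx ltW.
- move=> s; rewrite in_itv/= => /andP[? ?]; rewrite derive1E.
  by apply: (derive_val (is_derive := dF s _)); rewrite !ltW.
Qed.

(** * The logarithmic kernel and its convolutions *)

Section LogKernel.
Context {R : realType}.
Local Notation leb := (@lebesgue_measure R).
Local Notation mu2 := (leb \x leb)%E.
Local Notation plane := (R * R)%type.
Local Notation mint f := (mu2.-integrable setT (EFin \o f)).
Implicit Types (f g : plane -> R).

Lemma is_derive_line_at f (w v : plane) (s : R) a :
  is_derive (s *: v + w) v f a <-> is_derive s 1 (fun t => f (t *: v + w)) a.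
Proof.
have e : (fun h : R => h^-1 *: ((f \o shift (s *: v + w)) (h *: v) - f (s *: v + w))) =
  (fun h : R => h^-1 *: (((fun t => f (t *: v + w)) \o shift s) (h *: (1 : R))
     - f (s *: v + w))).
  by apply/funext => h /=; rewrite [h%:A]mulr1 scalerDl addrA.
by split=> -[dd dv]; split; move: dd dv; rewrite /derivable /derive e.
Qed.

Lemma enorm_ge_fst (z : plane) : `|z.1| <= enorm z.
Proof.
rewrite /enorm /dot -sqrtr_sqr ler_wsqrtr// expr2 lerDl -expr2; exact: sqr_ge0.
Qed.

Lemma enorm_ge_snd (z : plane) : `|z.2| <= enorm z.
Proof.
rewrite /enorm /dot -sqrtr_sqr ler_wsqrtr// [leRHS]addrC expr2 lerDl -expr2; exact: sqr_ge0.
Qed.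

Lemma enorm_sqr (z : plane) : enorm z ^+ 2 = z.1 ^+ 2 + z.2 ^+ 2.
Proof. by rewrite sqr_sqrtr /dot -?expr2// addr_ge0 ?sqr_ge0. Qed.

Lemma enorm_le_sum (z : plane) : enorm z <= `|z.1| + `|z.2|.
Proof.
rewrite -(ler_sqr (x := enorm z)) ?nnegrE ?sqrtr_ge0 ?addr_ge0// enorm_sqr.
by rewrite -[z.1 ^+ 2]real_normK ?num_real// -[z.2 ^+ 2]real_normK ?num_real//; have := normr_ge0 z.1; have := normr_ge0 z.2; nra.
Qed.

Lemma continuous_enorm : continuous (@enorm R).
Proof.
apply: (@cont_comp _ _ _ (fun x => dot x x) Num.sqrt); last by move=> x; exact: sqrt_continuous.
apply: cont_add; apply: cont_mul; by [apply: cont_fst; exact: cont_id|apply: cont_snd; exact: cont_id].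
Qed.

Definition kern (z : plane) : R := ln (enorm z).

(** A majorant in one variable: bounding the kernel by a sum of such weights in each coordinate
    reduces its local integrability to tensor products. *)
Definition logweight (s : R) : R := `|ln `|s| | + `|s|.

Lemma logweight_ge0 s : 0 <= logweight s.
Proof. by rewrite addr_ge0. Qed.

(** For [enorm z >= 1] one has [ln r <= r], and [r] is at most the sum of the absolute coordinates.
    For smaller [z] the absolute logarithm decreases in the radius, so any nonzero coordinate gives
    an upper bound; at the origin [ln 0 = 0]. *)
Lemma kern_bound (z : plane) : `|kern z| <= logweight z.1 + logweight z.2.
Proof.
rewrite /kern; have [r1|r1] := leP 1 (enorm z).
  rewrite ger0_norm ?ln_ge0//; apply: (le_trans (ltW (ln_sublinear _))).
    by rewrite (lt_le_trans ltr01).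
  apply: (le_trans (enorm_le_sum z)).
  by rewrite /logweight; have := normr_ge0 (ln `|z.1|); have := normr_ge0 (ln `|z.2|); lra.
have ln_small (a : R) : 0 < a -> a <= enorm z -> `|ln (enorm z)| <= `|ln a|.
  move=> a0 az; have z0 := lt_le_trans a0 az.
  rewrite !ler0_norm ?ln_le0 ?(ltW r1)//; last by rewrite (le_trans az)// ltW.
  by rewrite lerN2 ler_ln ?posrE.
have [z10|z10] := eqVneq z.1 0.
  have [z20|z20] := eqVneq z.2 0.
    have -> : enorm z = 0 by rewrite /enorm /dot z10 z20 !mul0r addr0 sqrtr0.
    by rewrite ln0// normr0 addr_ge0 ?logweight_ge0.
  apply: (le_trans (ln_small `|z.2| _ (enorm_ge_snd z))); first by rewrite normr_gt0.
  by have := logweight_ge0 z.1; rewrite /logweight; have := normr_ge0 z.2; lra.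
apply: (le_trans (ln_small `|z.1| _ (enorm_ge_fst z))); first by rewrite normr_gt0.
by have := logweight_ge0 z.2; rewrite /logweight; have := normr_ge0 z.1; lra.
Qed.

Lemma Rint_ln_itv (a : R) : 0 < a -> a < 1 ->
  (\int[leb]_(s in `[a, 1%R]) (- ln s)%:E)%E = (1 - a + a * ln a)%:E.
Proof.
move=> a0 a1; rewrite (_ : 1 - a + a * ln a = (1 - 1 * ln 1) - (a - a * ln a)); last by rewrite ln1; ring.
apply: (@Rint_FTC _ (fun t => t - t * ln t) (fun t => - ln t)) => //.
- move=> s /andP[as_ _]; have s0 := lt_le_trans a0 as_.
  apply: (dv_eq (dv_sub (dv_id s) (dv_mul (dv_id s) (is_derive1_ln s0)))).
  by rewrite mulfV ?gt_eqF//; ring.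
- move=> s /andP[as_ _]; apply: cvgN; apply: continuous_ln; exact: lt_le_trans as_.
Qed.

Lemma mint_ln01 : leb.-integrable setT
  (EFin \o (fun s : R => - ln s * \1_(`]0%R, 1%R]%classic : set R) s)).
Proof.
have mln : measurable_fun setT (fun s : measurableTypeR R => - ln s : measurableTypeR R).
  by apply: measurable_funN; exact: measurable_ln.
have lnn (s : R) : `]0%R, 1%R]%classic s -> 0 <= - ln s.
  by rewrite /= in_itv/= => /andP[s0 s1]; rewrite oppr_ge0 ln_le0.
have nn (s : R) : 0 <= - ln s * \1_(`]0%R, 1%R]%classic : set R) s.
  rewrite indicE; case: (boolP (s \in _)) => [|_]; last by rewrite mulr0.
  by rewrite inE => /lnn; rewrite mulr1.
apply/integrableP; split.
  by apply/measurable_EFinP; apply: measurable_funM.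
have -> : (\int[leb]_s `|(EFin \o (fun s : R => (- ln s * \1_(`]0%R, 1%R]%classic : set R) s)%R)) s|
    = \int[leb]_(s in `]0%R, 1%R]) (- ln s)%:E)%E.
  rewrite [RHS]integral_mkcond; apply: eq_integral => s _ /=.
  rewrite ger0_norm// patchE indicE; case: ifPn => _; by rewrite ?mulr1 ?mulr0.
(* The index starts at 2 because [Rint_ln_itv] wants a left end strictly below 1. The integrals over
   these intervals are at most 1, and monotone convergence carries the bound to []0, 1]]. *)
pose F n := `[(n.+2%:R : R)^-1, 1%R]%classic : set R.
have UF : `]0%R, 1%R]%classic = \bigcup_n F n.
  apply/seteqP; split=> [s|s [n _]]; rewrite /F /= !in_itv/= => /andP[s0 s1]; last first.
    by rewrite s1 (lt_le_trans _ s0)// invr_gt0.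
  exists (Num.truncn s^-1) => //=; rewrite in_itv/= s1 andbT.
  rewrite -[leRHS]invrK lef_pV2 ?posrE ?invr_gt0//.
  by rewrite (le_trans (ltW (truncnS_gt _)))// ler_nat.
have F_cvg := @ge0_nondecreasing_set_cvg_integral _ (measurableTypeR R) R F (fun s => (- ln s)%:E) leb.
rewrite UF -(cvg_lim _ (F_cvg _ _ _ _))//.
- apply: (@le_lt_trans _ _ 1%:E); last exact: ltry.
  apply: lime_le; last first.
    apply: nearW => n; rewrite Rint_ln_itv ?invr_gt0 ?invf_lt1// ?ltr1n// lee_fin.
    have : (n.+2%:R : R)^-1 * ln (n.+2%:R)^-1 <= 0.
      by rewrite mulr_ge0_le0 ?invr_ge0// ln_le0// invf_le1// ler1n.
    have : 0 <= (n.+2%:R : R)^-1 by rewrite invr_ge0.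
    by move=> a0 b0; rewrite -[leRHS]addr0 lerD// gerBl.
  apply: ereal_nondecreasing_is_cvgn => n m nm.
  apply: ge0_subset_integral => //.
  + exact: measurable_itv.
  + exact: measurable_itv.
  + by apply/measurable_EFinP; exact: measurable_funS mln.
  + move=> s; rewrite /F /= in_itv/= => /andP[s0 s1]; rewrite lee_fin oppr_ge0 ln_le0//.
  + move=> s; rewrite /F /= !in_itv/= => /andP[s0 ->]; rewrite andbT (le_trans _ s0)//.
    by rewrite lef_pV2 ?posrE// ler_nat.
- move=> n m nm; apply/subsetPset => s; rewrite /F /= !in_itv/= => /andP[s0 ->]; rewrite andbT (le_trans _ s0)//.
  by rewrite lef_pV2 ?posrE// ler_nat.
- by move=> n; exact: measurable_itv.
- by move=> n; apply/measurable_EFinP; exact: measurable_funS mln.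
- by move=> n s; rewrite /F /= in_itv/= => /andP[s0 s1]; rewrite lee_fin oppr_ge0 ln_le0.
Qed.

(** For [|s| < 1] the logarithm is controlled by [- ln] on []0, 1]] or by its mirror image; for
    [1 <= |s| <= M] both terms of the weight are at most [|M|], whence the constant [2 * |M|]. *)
Lemma mint_logweight (M : R) : leb.-integrable setT
  (EFin \o (fun s : R => logweight s * \1_(`[- M, M]%classic : set R) s)).
Proof.
have [i1 _] := preserves_int (preserves_reflect (0 : R)) mint_ln01.
have ln_meas : measurable_fun setT (fun s : measurableTypeR R => logweight s : measurableTypeR R).
  apply: measurable_funD; last exact: normr_measurable.
  apply: measurableT_comp; first exact: normr_measurable.
  apply: measurableT_comp; [exact: measurable_ln|exact: normr_measurable].
apply: (@mint_le R _ (measurableTypeR R) leb _ (fun s : R => (- ln s * \1_(`]0%R, 1%R]%classic : set R) s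
  + - ln (0 - s) * \1_(`]0%R, 1%R]%classic : set R) (0 - s)) + 2 * `|M| * \1_(`[- M, M]%classic : set R) s)).
- apply: measurable_funM => //; exact: (mint_meas (mint_itv _ _)).
- move=> s; rewrite ger0_norm ?mulr_ge0 ?logweight_ge0//.
  rewrite !indicE !mem_setE !in_itv/= sub0r.
  have lnn (t : R) : 0 <= - ln t * (0 < t <= 1)%R%:R.
    case: (boolP (0 < t <= 1)) => [/andP[t0 t1]|_]; last by rewrite mulr0.
    by rewrite mulr1 oppr_ge0 ln_le0.
  have := lnn s; have := lnn (- s).
  case: (boolP (- M <= s <= M)) => [|_]; last by rewrite !mulr0 addr0; lra.
  rewrite -ler_norml => sM; rewrite !mulr1 /logweight => h1 h2.
  have MM := ler_norm M.
  have [s1|s1] := leP 1 `|s|.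
    rewrite [`|ln _|]ger0_norm ?ln_ge0//.
    by have := ln_sublinear (lt_le_trans ltr01 s1); lra.
  have [s0|s0|s0] := ltgtP s 0; last by rewrite s0 oppr0 normr0 ln0// normr0 oppr0 !mul0r !add0r mulr_ge0.
  - move: s1 h2; rewrite (ltr0_norm s0) => s1 h2; rewrite [`|ln _|]ler0_norm ?ln_le0 ?(ltW s1)//.
    move: sM; rewrite (ltr0_norm s0) oppr_gt0 s0 /= mulr1; lra.
  - move: s1 h1; rewrite (gtr0_norm s0) => s1 h1; rewrite [`|ln _|]ler0_norm ?ln_le0 ?(ltW s1)//.
    move: sM; rewrite (gtr0_norm s0) /= mulr1; lra.
- by have := mintD (mintD mint_ln01 i1) (mintZ (2 * `|M|) (mint_itv (- M) M)).
Qed.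

Lemma measurable_kern : @measurable_fun _ _ (measurableTypeR R * measurableTypeR R)%type
  (measurableTypeR R) setT kern.
Proof.
apply: measurableT_comp; first exact: measurable_ln.
by apply: continuous_measurable_plane; exact: continuous_enorm.
Qed.

Lemma mint_kern (M : R) : mint (fun z => kern z * ibox M z).
Proof.
have i1 := mint_tensor (mint_logweight M) (mint_itv (- M) M).
have i2 := mint_tensor (mint_itv (- M) M) (mint_logweight M).
apply: (mint_le _ _ (mintD i1 i2)).
- by apply: measurable_funM; [exact: measurable_kern|exact: (mint_meas (mint_ibox M))].
- move=> z; rewrite normrM [`|ibox _ _|]ger0_norm ?ibox_ge0//.
  apply: (le_trans (ler_wpM2r (ibox_ge0 _ _) (kern_bound z))).
  by rewrite /ibox le_eqVlt; apply/orP; left; apply/eqP; ring.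
Qed.

(** Unnormalized: the inverse Laplacian is [- (2 * pi)^-1] times this convolution, a factor restored
    in [vel]. *)
Definition kconv f (x : plane) : R := \int[mu2]_y (kern (x - y) * f y).

Lemma cont_reflect f (x : plane) : continuous f -> continuous (fun z : plane => f (x - z)).
Proof.
move=> cf; apply: (@cont_comp _ _ _ (fun z : plane => x - z) f) => // z.
by apply: cvgB; [exact: cvg_cst|exact: cvg_id].
Qed.

(** Once the translation is moved from the kernel to [f], one integrable function dominates for all
    [x] in the ball of radius [N]. Continuity and differentiation of the convolution both rest on
    this. *)
Lemma kconv_dom f (x : plane) K M : (forall z, `|f z| <= K) ->
  (forall z, M < `|z| -> f z = 0) -> forall (N : R) (z : plane), `|x| <= N ->
  `|kern z * f (x - z)| <= K * (`|kern z| * ibox (M + N) z).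
Proof.
move=> fK fM N z xN; rewrite normrM mulrCA iboxE ler_wpM2l//.
have [zN|Nz] := leP `|z| (M + N); first by rewrite mulr1.
rewrite fM ?normr0 ?mulr0//.
have := ler_normB x (x - z); rewrite opprB addrC subrK.
lra.
Qed.

Lemma kconv_mint f (x : plane) : cc f ->
  mint (fun z => kern z * f (x - z)) /\ mint (fun y => kern (x - y) * f y).
Proof.
move=> cf; have [K [K0 fK]] := cc_bounded cf; have [c [M fM]] := cf.
have i : mint (fun z => kern z * f (x - z)).
  apply: (@mint_le _ _ _ mu2 _ (fun z => K * (`|kern z| * ibox (M + `|x|) z))); last 2 first.
  - by move=> z; exact: kconv_dom.
  - apply: mintZ; under eq_fun do rewrite -[ibox _ _]ger0_norm ?ibox_ge0// -normrM.
    exact/mint_norm/mint_kern.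
  - apply: measurable_funM; first exact: measurable_kern.
    by apply: continuous_measurable_plane; exact: cont_reflect.
split=> //; have [i' _] := Rint_reflect x i.
by move: i'; under eq_fun do rewrite subKr.
Qed.

Lemma kconvE f (x : plane) : cc f -> kconv f x = \int[mu2]_z (kern z * f (x - z)).
Proof.
move=> cf; have [_ <-] := Rint_reflect x (kconv_mint x cf).1.
by apply: Rint_ext => y; rewrite subKr.
Qed.

Definition kmass (M : R) : R := \int[mu2]_z (`|kern z| * ibox M z).

Lemma mint_kmass M : mint (fun z => `|kern z| * ibox M z).
Proof.
by have := mint_norm (mint_kern M); under eq_fun do rewrite normrM [`|ibox _ _|]ger0_norm ?ibox_ge0//.
Qed.

Lemma kconv_le f K M N (x : plane) : cc f -> (forall z, `|f z| <= K) ->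
  (forall z, M < `|z| -> f z = 0) -> `|x| <= N ->
  `|kconv f x| <= K * kmass (M + N) /\
  \int[mu2]_y `|kern (x - y) * f y| <= K * kmass (M + N).
Proof.
move=> cf fK fM xN; have i := (kconv_mint x cf).1; have ik := mint_kmass (M + N).
rewrite kconvE// -RintZ//; split.
  by apply: Rint_norm_le => //; [exact: mintZ|move=> z; exact: kconv_dom].
have [_ e] := Rint_reflect x (mint_norm i).
have -> : \int[mu2]_y `|kern (x - y) * f y| = \int[mu2]_y `|kern y * f (x - y)|.
  by rewrite -e; apply: Rint_ext => y; rewrite subKr.
apply: Rint_le => //; [exact: mint_norm|exact: mintZ|move=> z; exact: kconv_dom].
Qed.

Lemma kconv_continuous f : cc f -> continuous (kconv f).
Proof.
move=> cf p; have [K [K0 fK]] := cc_bounded cf; have [c [M fM]] := cf.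
have -> : kconv f = (fun x => \int[mu2]_z (kern z * f (x - z))).
  by apply/funext => x; exact: kconvE.
apply: (@dominated_continuous_at _ _ _ _ mu2 _ p (fun z => K * (`|kern z| * ibox (M + (`|p| + 1)) z)) 1) => //.
- move=> v; apply: measurable_funM; first exact: measurable_kern.
  by apply: continuous_measurable_plane; exact: cont_reflect.
- exact/mintZ/mint_kmass.
- move=> v y pv; apply: kconv_dom => //.
  by have := ler_normB p (p - v); rewrite subKr; lra.
- move=> y; apply: cvgM; first exact: cvg_cst.
  apply: (@cont_comp _ _ _ (fun z : plane => z - y) f) => // z.
  by apply: cvgB; [exact: cvg_id|exact: cvg_cst].
Qed.

Lemma kconv_is_derive f j (x : plane) : C1 f -> cc f ->
  is_derive x (ej j) (kconv f) (kconv (pd j f) x).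
Proof.
move=> Cf cf; have cD := cc_pd j Cf cf.
have [K [K0 DK]] := cc_bounded cD; have [c [M DM]] := cD.
apply/is_derive_line.
pose F (s : R) (z : plane) := kern z * f (s *: ej j + x - z).
have dF (s : R) z : is_derive s 1 (fun s => F s z) (kern z * pd j f (s *: ej j + x - z)).
  apply: (dv_eq (dv_mul (dv_cst (kern z) s 1) _)); last by rewrite mulr0 addr0.
  have /= h := (is_derive_line_at f (x - z) (ej j) s (pd j f (s *: ej j + (x - z)))).1 (C1_is_derive j _ Cf).
  by move: h; rewrite addrA; under eq_fun do rewrite addrA.
have pF s z : partial1of2 F s z = kern z * pd j f (s *: ej j + x - z).
  by rewrite partial1of2E; exact: (derive_val (is_derive := dF s z)).
(* The parameter runs through []-1, 1[] and [ej j] has norm 1, so the base point stays within the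
   radius [|x| + 1]. The singular kernel is never differentiated. *)
pose G z := K * (`|kern z| * ibox (M + (`|x| + 1)) z).
have eF : (fun s : R => kconv f (s *: ej j + x)) = (fun s => \int[mu2]_z F s z).
  by apply/funext => s; rewrite kconvE.
have G0 z : 0 <= G z by rewrite /G !mulr_ge0 ?ibox_ge0// ltW.
have iG : mint G by exact/mintZ/mint_kmass.
have iF (s : R) : `]-1, 1[%classic s -> mint (F s).
  by move=> _; exact: (kconv_mint (s *: ej j + x) cf).1.
have GF (s : R) z : `]-1, 1[%classic s -> setT z -> `|partial1of2 F s z| <= G z.
  rewrite /= in_itv/= => /andP[s1 s2] _; rewrite pF; apply: kconv_dom => //.
  rewrite (le_trans (ler_normD _ _))// addrC lerD2l normrZ.
  have -> : `|ej j| = 1 :> R by rewrite prod_normE /ej; case: j {Cf cf cD DK c DM F dF pF G eF G0 iG iF}; rewrite /= normr0 normr1 ?maxEle ?ler01 ?ler10.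
  by rewrite mulr1 ler_norml !ltW.
have a0 : `]-1, 1[%classic (0 : R) by rewrite /= in_itv/= ltrN10 ltr01.
have dF' (s : R) (z : plane) : `]-1, 1[%classic s -> setT z -> derivable (F^~ z) s 1.
  by move=> _ _; exact: (ex_derive (is_derive := dF s z)).
rewrite eF; apply: DeriveDef.
  exact: (derivable_under_integral measurableT a0 iF dF' G0 iG GF).
rewrite -derive1E (differentiation_under_integral measurableT a0 iF dF' G0 iG GF).
rewrite kconvE//; apply: Rint_ext => z.
by rewrite pF scale0r add0r.
Qed.

Lemma kconv_C1 f : C1 f -> cc f -> C1 (kconv f) /\
  forall j, pd j (kconv f) = kconv (pd j f).
Proof.
move=> Cf cf; apply: C1_intro; first exact: kconv_continuous.
- by move=> j; apply: kconv_continuous; exact: cc_pd.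
- by move=> j x; exact: kconv_is_derive.
Qed.

Lemma kconv_add f g (x : plane) : cc f -> cc g ->
  kconv (fun y => f y + g y) x = kconv f x + kconv g x.
Proof.
move=> cf cg; rewrite /kconv -RintD; first by apply: Rint_ext => y; rewrite mulrDr.
- exact: (kconv_mint x cf).2.
- exact: (kconv_mint x cg).2.
Qed.

Lemma kconv_scale c f (x : plane) : cc f -> kconv (fun y => c * f y) x = c * kconv f x.
Proof.
move=> cf; rewrite /kconv -RintZ; first by apply: Rint_ext => y; rewrite mulrCA.
exact: (kconv_mint x cf).2.
Qed.

Lemma kconv_flip2 f (x : plane) : cc f ->
  kconv (fun y => f (flip2 y)) x = kconv f (flip2 x).
Proof.
move=> cf; rewrite /kconv; have [_ <-] := Rint_flip2 (kconv_mint (flip2 x) cf).2.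
apply: Rint_ext => y; congr (_ * _); rewrite /kern /enorm /dot /flip2 /=; congr (ln (Num.sqrt _)).
ring.
Qed.

End LogKernel.

(** * Gaussian integrals and their cosine transform *)

Section GaussianLine.
Context {R : realType}.
Local Notation leb := (@lebesgue_measure R).
Local Notation mint1 f := (leb.-integrable setT (EFin \o f)).

Definition gauss (a s : R) : R := expR (- a * s ^+ 2).

Lemma gauss_ge0 a s : 0 <= gauss a s. Proof. exact: expR_ge0. Qed.

Lemma continuous_gauss a : continuous (gauss a).
Proof.
apply: (@cont_comp _ _ _ (fun s : R => - a * s ^+ 2) expR); last exact: continuous_expR.
by apply: cont_mul; [exact: cont_cst|apply: cont_exp; exact: cont_id].
Qed.

Lemma measurable_cont (f : R -> R) : continuous f ->
  @measurable_fun _ _ (measurableTypeR R) (measurableTypeR R) setT f.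
Proof. by move=> cf; exact: continuous_measurable_fun. Qed.

Lemma Rint_ext1 (f g : R -> R) : (forall s, f s = g s) ->
  \int[leb]_s f s = \int[leb]_s g s.
Proof. by move=> h; apply: eq_Rintegral. Qed.

Lemma gauss_int (a : R) : 0 < a ->
  mint1 (gauss a) /\ \int[leb]_s gauss a s = Num.sqrt (pi / a).
Proof.
(* The normal law of variance [1 / (2 a)] has a density proportional to [gauss a]. *)
move=> a0; pose sg := Num.sqrt (2 * a)^-1.
have sg2 : sg ^+ 2 = (2 * a)^-1 by rewrite sqr_sqrtr// invr_ge0 ltW// mulr_gt0.
have sg0 : sg != 0 by rewrite gt_eqF// sqrtr_gt0 invr_gt0 mulr_gt0.
have e : normal_pdf 0 sg = (fun s => (Num.sqrt (pi / a))^-1 * gauss a s).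
  apply/funext => s; rewrite normal_pdfE// /normal_peak /normal_fun /gauss sg2 subr0.
  congr ((Num.sqrt _)^-1 * expR _); first by rewrite -mulr_natl; field; rewrite gt_eqF.
  by rewrite -mulr_natl; field; rewrite gt_eqF.
have c0 : 0 < Num.sqrt (pi / a) by rewrite sqrtr_gt0 divr_gt0// pi_gt0.
have i := integrable_normal_pdf 0 sg; have v := integral_normal_pdf 0 sg.
have ig : mint1 (gauss a).
  have := @mintZ _ _ _ leb (Num.sqrt (pi / a)) _ i; rewrite e.
  by under eq_fun do rewrite mulVKf ?gt_eqF//.
split => //; move: v; rewrite e.
rewrite (Rint_EFin (mintZ _ ig)) RintZ// => -[] h.
have c1 : Num.sqrt (pi / a) != 0 by rewrite gt_eqF.
by apply: (mulfI (invr_neq0 c1)); rewrite h mulVf.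
Qed.

(** With [x = a s^2 / 2] this is [x exp(- 2 x) <= exp(- x)], a consequence of [1 + x <= exp x]: half
    of the exponent is spent to absorb the polynomial factor. *)
Lemma gauss_sqr_le (a s : R) : 0 < a -> s ^+ 2 * gauss a s <= 2 / a * gauss (a / 2) s.
Proof.
move=> a0; rewrite /gauss; set x := a / 2 * s ^+ 2.
have -> : - a * s ^+ 2 = - x + - x by rewrite /x; field.
have -> : - (a / 2) * s ^+ 2 = - x by rewrite /x; ring.
have -> : s ^+ 2 = 2 / a * x by rewrite /x; field; rewrite gt_eqF.
rewrite expRD -[leLHS]mulrA ler_wpM2l ?divr_ge0// ?(ltW a0)// mulrA.
rewrite -[leRHS]mul1r ler_wpM2r ?expR_ge0// expRN ler_pdivrMr ?expR_gt0// mul1r.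
by have := expR_ge1Dx x; lra.
Qed.

Lemma abs_le_sqr (s : R) : `|s| <= 1 + s ^+ 2.
Proof. by rewrite -[s ^+ 2]real_normK ?num_real//; have := normr_ge0 s; nra. Qed.

Definition gaussdom a s := gauss a s + 2 / a * gauss (a / 2) s.

Lemma gaussdomP (a s : R) : 0 < a -> `|s| * gauss a s <= gaussdom a s.
Proof.
move=> a0; rewrite /gaussdom; have := ler_wpM2r (gauss_ge0 a s) (abs_le_sqr s).
by have := gauss_sqr_le s a0; lra.
Qed.

Lemma mint_gaussdom a : 0 < a -> mint1 (gaussdom a).
Proof.
move=> a0; apply: mintD; first exact: (gauss_int a0).1.
by apply: mintZ; apply: (gauss_int _).1; rewrite divr_gt0.
Qed.

Lemma Rint_derive_decay (F f : R -> R) :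
  (forall s : R, is_derive s (1 : R) F (f s)) -> continuous f -> mint1 f ->
  F n%:R @[n --> \oo] --> (0 : R) -> F (- n%:R) @[n --> \oo] --> (0 : R) ->
  \int[leb]_s f s = 0.
Proof.
move=> dF cf fi F1 F2.
pose A n := `[- n.+1%:R, n.+1%:R]%classic : set R.
have mf := mint_meas fi.
pose g n s := f s * \1_(A n) s.
have mg n : measurable_fun setT (g n).
  by apply: measurable_funM => //; exact: (mint_meas (mint_itv _ _)).
have gf s : g n s @[n --> \oo] --> f s.
  apply: cvg_near_cst; exists (Num.truncn `|s|) => // n /= sn; rewrite /g indicE mem_setE in_itv/= -ler_norml.
  by rewrite (le_trans (ltW (truncnS_gt _))) ?mulr1// ler_nat.
have gG n s : `|g n s| <= `|f s|.
  by rewrite /g normrM indicE ler_piMr//; case: (_ \in _); rewrite ?normr1 ?normr0.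
have [_ h] := @dominated_cvg _ _ (measurableTypeR R) leb g f _ mg mf (mint_norm fi) gG gf.
have eg n : (\int[leb]_s (g n s)%:E)%E = (F n.+1%:R - F (- n.+1%:R))%:E.
  rewrite -(@Rint_FTC _ F f) ?gtrN//; last by move=> s _; exact: cf.
  rewrite [RHS]integral_mkcond; apply: eq_integral => s _.
  by rewrite /g patchE indicE; case: ifPn => _; rewrite ?mulr1 ?mulr0.
have h2 : (F n.+1%:R - F (- n.+1%:R)) @[n --> \oo] --> (0 : R).
  rewrite -[0]subr0; apply: cvgB; first by rewrite (cvg_shiftS (fun n => F n%:R)).
  by rewrite (cvg_shiftS (fun n => F (- n%:R))).
have e : (fun n => \int[leb]_s g n s) = (fun n => F n.+1%:R - F (- n.+1%:R)).
  by apply/funext => n; rewrite /Rintegral eg.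
by move: h; rewrite e => h; exact: (cvg_unique _ h h2).
Qed.

Lemma gauss_cvg0 a : 0 < a -> gauss a n%:R @[n --> \oo] --> (0 : R).
Proof.
move=> a0; apply: (@squeeze_cvgr _ _ _ _ (fun=> 0) (fun n => (1 + a^-1) * harmonic n)).
- apply: nearW => n; rewrite gauss_ge0/= /harmonic /gauss mulNr expRN.
  rewrite -ler_pdivrMl ?addr_gt0 ?invr_gt0// -invfM lef_pV2 ?posrE ?mulr_gt0 ?addr_gt0 ?invr_gt0 ?expR_gt0//.
  rewrite -natr1; have h := expR_ge1Dx (a * n%:R ^+ 2).
  have h1 : (n%:R : R) <= n%:R ^+ 2 by rewrite -natrX ler_nat; case: n {h} => // n; rewrite leq_pmulr.
  have h2 : (1 + a^-1) * (1 + a * n%:R ^+ 2) = 1 + a * n%:R ^+ 2 + a^-1 + n%:R ^+ 2 by field; rewrite gt_eqF.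
  have h3 : 0 <= a * n%:R ^+ 2 by rewrite mulr_ge0 ?sqr_ge0 ?ltW.
  have h4 : 0 < a^-1 by rewrite invr_gt0.
  have h5 : (1 + a^-1) * (1 + a * n%:R ^+ 2) <= (1 + a^-1) * expR (a * n%:R ^+ 2).
    by rewrite ler_wpM2l// addr_ge0// ltW.
  lra.
- exact: cvg_cst.
- by rewrite -[X in _ --> X](mulr0 (1 + a^-1)); apply: cvgM; [exact: cvg_cst|exact: cvg_harmonic].
Qed.

Lemma mint_gauss_bounded a (h : R -> R) : 0 < a -> continuous h ->
  (forall s, `|h s| <= 1) -> mint1 (fun s => gauss a s * h s).
Proof.
move=> a0 ch h1; apply: (@mintM _ _ _ leb (gauss a) h 1 _ h1 (gauss_int a0).1).
exact: measurable_cont.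
Qed.

Lemma cont_trig (f : R -> R) b : continuous f -> continuous (fun s : R => f (b * s)).
Proof.
by move=> cf; apply: (@cont_comp _ _ _ (fun s : R => b * s) f) => //; apply: cont_mul; [exact: cont_cst|exact: cont_id].
Qed.

Lemma gauss_sin a b : 0 < a -> \int[leb]_s (gauss a s * sin (b * s)) = 0.
Proof.
move=> a0; have i : mint1 (fun s => gauss a s * sin (b * s)).
  by apply: mint_gauss_bounded => // [|s]; [apply: cont_trig; exact: continuous_sin|rewrite ler_norml sin_geN1 sin_le1].
have [_] := preserves_int (preserves_reflect (0 : R)) i.
rewrite (Rint_ext1 (g := fun s => - (gauss a s * sin (b * s)))).
  by rewrite RintN//; lra.
by move=> s; rewrite /gauss sub0r sqrrN mulrN sinN mulrN.
Qed.

(** The integral [g], seen as a function of the frequency, solves [g' = - c / (2 a) g]: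
    differentiation under the integral produces [s] times the sine, and an integration by parts
    returns [g]. So [g c] times [exp (c^2 / (4 a))] is constant, with the Gaussian integral as its
    value at 0. *)
Lemma gauss_cos a b : 0 < a ->
  \int[leb]_s (gauss a s * cos (b * s)) = Num.sqrt (pi / a) * gauss (4 * a)^-1 b.
Proof.
move=> a0; pose g b := \int[leb]_s (gauss a s * cos (b * s)).
have icos (c : R) : mint1 (fun s => gauss a s * cos (c * s)).
  by apply: mint_gauss_bounded => // [|s]; [apply: cont_trig; exact: continuous_cos|rewrite ler_norml cos_geN1 cos_le1].
have dgauss (s : R) : is_derive s 1 (gauss a) (- (2 * a) * s * gauss a s).
  have := dv_comp (g := fun t => - a * t ^+ 2) (is_derive_expR (- a * s ^+ 2)) (dv_mul (dv_cst (- a) s (1 : R)) (dv_sqr (dv_id s))).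
  by move/dv_eq; apply; rewrite /gauss; ring.
have dlin (c s : R) : is_derive s 1 (fun t : R => c * t) c.
  by apply: (dv_eq (dv_mul (dv_cst c s (1 : R)) (dv_id s))); ring.
have isin (c : R) : mint1 (fun s => s * gauss a s * sin (c * s)).
  apply: (mint_le _ _ (mint_gaussdom a0)).
    apply: measurable_cont; apply: cont_mul; last by apply: cont_trig; exact: continuous_sin.
    by apply: cont_mul; [exact: cont_id|exact: continuous_gauss].
  move=> s; rewrite !normrM (ger0_norm (gauss_ge0 _ _)).
  rewrite (le_trans _ (gaussdomP s a0))// ler_piMr ?mulr_ge0 ?gauss_ge0//.
  by rewrite ler_norml sin_geN1 sin_le1.
have parts (c : R) : 2 * a * \int[leb]_s (s * gauss a s * sin (c * s)) = c * g c.
  have bd (u : nat -> R) : (forall n, gauss a (u n) = gauss a n%:R) ->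
      gauss a (u n) * sin (c * u n) @[n --> \oo] --> (0 : R).
    move=> un; apply/cvgr0Pnorm_le => e e0.
    have /cvgr0Pnorm_le/(_ e e0) := gauss_cvg0 a0; apply: filterS => n; apply: le_trans.
    by rewrite normrM un ler_piMr// ler_norml sin_geN1 sin_le1.
  have := @Rint_derive_decay (fun s => gauss a s * sin (c * s))
    (fun s => c * (gauss a s * cos (c * s)) - 2 * a * (s * gauss a s * sin (c * s))).
  rewrite RintB; [|exact: mintZ|exact: mintZ].
  rewrite RintZ// RintZ// => h; apply/esym/subr0_eq; apply: h.
  - move=> s; apply: (dv_eq (dv_mul (dgauss s) (dv_comp (is_derive_sin (c * s)) (dlin c s)))).
    ring.
  - apply: cont_sub; (apply: cont_mul; first exact: cont_cst).
      by apply: cont_mul; [exact: continuous_gauss|apply: cont_trig; exact: continuous_cos].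
    apply: cont_mul; last by apply: cont_trig; exact: continuous_sin.
    by apply: cont_mul; [exact: cont_id|exact: continuous_gauss].
  - by apply: mintB; exact: mintZ.
  - exact: bd.
  - by apply: bd => n; rewrite /gauss sqrrN.
have dg (c : R) : is_derive c 1 g (- (c / (2 * a)) * g c).
  pose F (c s : R) := gauss a s * cos (c * s).
  have dF (u s : R) : is_derive u 1 (fun u => F u s) (- (s * gauss a s * sin (u * s))).
    have d1 : is_derive u 1 (fun u => u * s) s.
      by apply: (dv_eq (dv_mul (dv_id u) (dv_cst s u (1 : R)))); ring.
    apply: (dv_eq (dv_mul (dv_cst (gauss a s) u (1 : R)) (dv_comp (g := fun u => u * s) (is_derive_cos (u * s)) d1))).
    ring.
  have pF (u s : R) : partial1of2 F u s = - (s * gauss a s * sin (u * s)).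
    by rewrite partial1of2E; exact: (derive_val (is_derive := dF u s)).
  have c0 : `](c - 1), (c + 1)[%classic c by rewrite /= in_itv/=; lra.
  have G0 s : 0 <= gaussdom a s by rewrite addr_ge0 ?mulr_ge0 ?gauss_ge0 ?invr_ge0// ltW.
  have dF' (u s : R) : `](c - 1), (c + 1)[%classic u -> setT s -> derivable (F^~ s) u 1.
    by move=> _ _; exact: (ex_derive (is_derive := dF u s)).
  have GF (u s : R) : `](c - 1), (c + 1)[%classic u -> setT s -> `|partial1of2 F u s| <= gaussdom a s.
    move=> _ _; rewrite pF normrN !normrM (ger0_norm (gauss_ge0 _ _)).
    rewrite (le_trans _ (gaussdomP s a0))// ler_piMr ?mulr_ge0 ?gauss_ge0//.
    by rewrite ler_norml sin_geN1 sin_le1.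
  have iF (u : R) : `](c - 1), (c + 1)[%classic u -> mint1 (F u) by move=> _; exact: icos.
  apply: DeriveDef.
    exact: (derivable_under_integral measurableT c0 iF dF' G0 (mint_gaussdom a0) GF).
  rewrite -derive1E (differentiation_under_integral measurableT c0 iF dF' G0 (mint_gaussdom a0) GF).
  rewrite (Rint_ext1 (g := fun s => - (s * gauss a s * sin (c * s)))) => [|s]; last exact: pF.
  rewrite RintN//; have := parts c; set I := Rintegral _ _ _ => pI.
  have a20 : 2 * a != 0 by rewrite mulf_neq0// gt_eqF.
  by apply: (mulfI a20); rewrite mulrN pI; field; rewrite gt_eqF.
have dPhi (c : R) : is_derive c 1 (fun c => g c * expR ((4 * a)^-1 * c ^+ 2)) 0.
  have d1 : is_derive c 1 (fun c => (4 * a)^-1 * c ^+ 2) ((4 * a)^-1 * (2 * c)).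
    by apply: (dv_eq (dv_mul (dv_cst (4 * a)^-1 c (1 : R)) (dv_sqr (dv_id c)))); ring.
  apply: (dv_eq (dv_mul (dg c) (dv_comp (is_derive_expR _) d1))).
  by field; rewrite gt_eqF.
have := is_derive_0_is_cst b 0 dPhi.
rewrite expr0n/= mulr0 expR0 mulr1 /g.
have -> : \int[leb]_s (gauss a s * cos (0 * s)) = Num.sqrt (pi / a).
  by rewrite -(gauss_int a0).2; apply: Rint_ext1 => s; rewrite mul0r cos0 mulr1.
by move=> <-; rewrite /gauss -mulrA -expRD mulNr subrr expR0 mulr1.
Qed.

End GaussianLine.

(* The library registers no sigma-finite instance on products of measures. *)
Definition sfplane {R : realType} :=
  HB.pack_for {sigma_finite_measure set (measurableTypeR R * measurableTypeR R)%type -> \bar R}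
  (@lebesgue_measure R \x @lebesgue_measure R)%E
  (Measure.on (@lebesgue_measure R \x @lebesgue_measure R)%E)
  (lebesgue_integral_fubini.measure_function_Measure_isSigmaFinite__to__measure_function_isSFinite
    (@lebesgue_measure R) (@lebesgue_measure R))
  (lebesgue_integral_fubini.measure_function_Measure_isSigmaFinite__to__measure_function_isSigmaFinite
    (@lebesgue_measure R) (@lebesgue_measure R)).

(** * Fourier transform in the plane and Gaussian forms *)

Section FourierPlane.
Context {R : realType}.
Local Notation leb := (@lebesgue_measure R).
Local Notation mu2 := (leb \x leb)%E.
Local Notation plane := (R * R)%type.
Local Notation mint f := (mu2.-integrable setT (EFin \o f)).
Implicit Types (f g : plane -> R).

Lemma Rint_ext2 f g : (forall x, f x = g x) ->
  \int[mu2]_x f x = \int[mu2]_x g x.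
Proof. by move=> h; apply: eq_Rintegral. Qed.

Definition gauss2 (a : R) (z : plane) : R := gauss a z.1 * gauss a z.2.

Lemma gauss2_ge0 a z : 0 <= gauss2 a z.
Proof. by rewrite mulr_ge0 ?gauss_ge0. Qed.

Lemma gauss2E a (z : plane) : gauss2 a z = expR (- a * dot z z).
Proof. by rewrite /gauss2 /gauss -expRD /dot; congr expR; ring. Qed.

Lemma continuous_gauss2 a : continuous (gauss2 a).
Proof.
by apply: cont_mul; (apply: (cont_comp _ (@continuous_gauss R a)));
  [apply: cont_fst; exact: cont_id|apply: cont_snd; exact: cont_id].
Qed.

Lemma gauss2_int (a : R) : 0 < a -> mint (gauss2 a) /\ \int[mu2]_z gauss2 a z = pi / a.
Proof.
move=> a0; have [i e] := gauss_int a0; split; first exact: mint_tensor.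
by rewrite Rint_tensor// e -expr2 sqr_sqrtr// divr_ge0// ?pi_ge0 ?ltW.
Qed.

Lemma continuous_dot {T : topologicalType} (u v : T -> plane) : continuous u ->
  continuous v -> continuous (fun t => dot (u t) (v t)).
Proof.
move=> cu cv; apply: cont_add; apply: cont_mul;
  by [apply: cont_fst|apply: cont_snd].
Qed.

Lemma gauss2_cos (a : R) (z : plane) : 0 < a ->
  \int[mu2]_xi (gauss2 a xi * cos (dot xi z)) = pi / a * gauss2 (4 * a)^-1 z.
Proof.
move=> a0.
have ic (b : R) : leb.-integrable setT (EFin \o (fun s : R => gauss a s * cos (b * s))).
  by apply: mint_gauss_bounded => // [|s]; [apply: cont_trig; exact: continuous_cos|rewrite ler_norml cos_geN1 cos_le1].
have is_ (b : R) : leb.-integrable setT (EFin \o (fun s : R => gauss a s * sin (b * s))).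
  by apply: mint_gauss_bounded => // [|s]; [apply: cont_trig; exact: continuous_sin|rewrite ler_norml sin_geN1 sin_le1].
rewrite (Rint_ext2 (g := fun xi : plane => (gauss a xi.1 * cos (z.1 * xi.1)) * (gauss a xi.2 * cos (z.2 * xi.2))
   - (gauss a xi.1 * sin (z.1 * xi.1)) * (gauss a xi.2 * sin (z.2 * xi.2)))).
  rewrite RintB; [|exact: (mint_tensor (ic _) (ic _))|exact: (mint_tensor (is_ _) (is_ _))].
  rewrite (Rint_tensor (ic z.1) (ic z.2)) (Rint_tensor (is_ z.1) (is_ z.2)).
  rewrite !gauss_cos// gauss_sin//.
  rewrite mul0r subr0 /gauss2; set g1 := gauss _ z.1; set g2 := gauss _ z.2.
  by rewrite mulrACA -expr2 sqr_sqrtr// divr_ge0// ?pi_ge0 ?ltW.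
by move=> xi; rewrite /gauss2 /dot cosD [z.1 * _]mulrC [z.2 * _]mulrC; ring.
Qed.

Definition fcos f (xi : plane) : R := \int[mu2]_x (f x * cos (dot xi x)).
Definition fsin f (xi : plane) : R := \int[mu2]_x (f x * sin (dot xi x)).
(** Power spectrum of the unnormalized Fourier transform, kept in real arithmetic; it is [(2 pi)^2]
    times the squared modulus of [fourier f xi]. *)
Definition pspec f xi : R := fcos f xi ^+ 2 + fsin f xi ^+ 2.
Definition l1 f : R := \int[mu2]_x `|f x|.

Lemma l1_ge0 f : 0 <= l1 f. Proof. exact: Rintegral_ge0. Qed.

Lemma pspec_ge0 f xi : 0 <= pspec f xi.
Proof. by rewrite addr_ge0 ?sqr_ge0. Qed.

Lemma cc_cos f (xi : plane) : cc f -> cc (fun x => f x * cos (dot xi x)).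
Proof.
move=> cf; apply: cc_mulr => //; apply: (cont_comp _ (@continuous_cos R)).
by apply: continuous_dot; [exact: cont_cst|exact: cont_id].
Qed.

Lemma cc_sin f (xi : plane) : cc f -> cc (fun x => f x * sin (dot xi x)).
Proof.
move=> cf; apply: cc_mulr => //; apply: (cont_comp _ (@continuous_sin R)).
by apply: continuous_dot; [exact: cont_cst|exact: cont_id].
Qed.

Lemma norm_cos_le1 (t : R) : `|cos t| <= 1.
Proof. by rewrite ler_norml cos_geN1 cos_le1. Qed.

Lemma norm_sin_le1 (t : R) : `|sin t| <= 1.
Proof. by rewrite ler_norml sin_geN1 sin_le1. Qed.

Lemma ler_norm_mul1 (a b : R) : `|b| <= 1 -> `|a * b| <= `|a|.
Proof. by move=> b1; rewrite normrM ler_piMr. Qed.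

Lemma fcos_le f xi : cc f -> `|fcos f xi| <= l1 f.
Proof.
move=> cf; apply: Rint_norm_le; [exact/cc_mint/cc_cos|exact/mint_norm/cc_mint|].
by move=> x; apply: ler_norm_mul1; exact: norm_cos_le1.
Qed.

Lemma fsin_le f xi : cc f -> `|fsin f xi| <= l1 f.
Proof.
move=> cf; apply: Rint_norm_le; [exact/cc_mint/cc_sin|exact/mint_norm/cc_mint|].
by move=> x; apply: ler_norm_mul1; exact: norm_sin_le1.
Qed.

Lemma pspec_le f xi : cc f -> pspec f xi <= 2 * l1 f ^+ 2.
Proof.
move=> cf; rewrite mulr_natl mulr2n /pspec; apply: lerD.
- by rewrite -[leLHS]real_normK ?num_real// lerXn2r ?nnegrE ?l1_ge0// fcos_le.
- by rewrite -[leLHS]real_normK ?num_real// lerXn2r ?nnegrE ?l1_ge0// fsin_le.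
Qed.

Lemma cont_ft f (h : R -> R) : cc f -> continuous h -> (forall t, `|h t| <= 1) ->
  continuous (fun xi : plane => \int[mu2]_x (f x * h (dot xi x))).
Proof.
move=> cf ch h1 xi; apply: (@dominated_continuous_at _ _ _ _ mu2 _ xi (fun x => `|f x|) 1) => //.
- move=> v; apply: continuous_measurable_plane; apply: cont_mul; first exact: cf.1.
  by apply: (cont_comp _ ch); apply: continuous_dot; [exact: cont_cst|exact: cont_id].
- exact/mint_norm/cc_mint.
- by move=> v y _; exact: ler_norm_mul1.
- move=> y; apply: cont_mul; first exact: cont_cst.
  by apply: (cont_comp _ ch); apply: continuous_dot; [exact: cont_id|exact: cont_cst].
Qed.

Lemma fcos_continuous f : cc f -> continuous (fcos f).
Proof. by move=> cf; apply: cont_ft => //; [exact: continuous_cos|exact: norm_cos_le1]. Qed.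

Lemma fsin_continuous f : cc f -> continuous (fsin f).
Proof. by move=> cf; apply: cont_ft => //; [exact: continuous_sin|exact: norm_sin_le1]. Qed.

Lemma pspec_continuous f : cc f -> continuous (pspec f).
Proof.
by move=> cf; apply: cont_add; apply: cont_exp; [exact: fcos_continuous|exact: fsin_continuous].
Qed.

Lemma mint_slice f (k : plane * plane -> R) K (x : plane) : mint f -> continuous k ->
  (forall p, `|k p| <= K) ->
  mint (fun y => f y * k (x, y)) /\ mint (fun y => f y * k (y, x)).
Proof.
move=> fi ck kK.
have c1 : continuous (fun y => k (x, y)).
  by apply: (cont_comp _ ck); apply: cont_pair; [exact: cont_cst|exact: cont_id].
have c2 : continuous (fun y => k (y, x)).
  by apply: (cont_comp _ ck); apply: cont_pair; [exact: cont_id|exact: cont_cst].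
split; first exact: (mintM (continuous_measurable_plane c1) (fun y => kK (x, y)) fi).
exact: (mintM (continuous_measurable_plane c2) (fun y => kK (y, x)) fi).
Qed.

Lemma Rint_swap_bounded f g (k : plane * plane -> R) K : mint f -> mint g ->
  continuous k -> (forall p, `|k p| <= K) ->
  [/\ (sfplane \x sfplane)%E.-integrable setT
        (EFin \o (fun p : plane * plane => f p.1 * g p.2 * k p)),
     mint (fun x => f x * \int[mu2]_y (g y * k (x, y))) &
  \int[mu2]_x (f x * \int[mu2]_y (g y * k (x, y))) =
  \int[mu2]_y (g y * \int[mu2]_x (f x * k (x, y)))].
Proof.
move=> fi gi ck kK.
have i : (sfplane \x sfplane)%E.-integrable setT
    (EFin \o (fun p : plane * plane => f p.1 * g p.2 * k p)).
  have t := @mint_tensor R _ _ _ _ sfplane sfplane f g fi gi.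
  exact: mintM (continuous_measurable_plane2 ck) kK t.
have e1 (x : plane) : f x * \int[mu2]_y (g y * k (x, y)) = \int[mu2]_y (f x * g y * k (x, y)).
  by rewrite -RintZ; [apply: Rint_ext2 => y; rewrite mulrA|exact: (mint_slice x gi ck kK).1].
have e2 (y : plane) : g y * \int[mu2]_x (f x * k (x, y)) = \int[mu2]_x (f x * g y * k (x, y)).
  by rewrite -RintZ; [apply: Rint_ext2 => x; ring|exact: (mint_slice y fi ck kK).2].
split; first exact: i.
  by have [+ _] := mint_prodl i; under eq_fun do rewrite -e1.
have := Rint_swap i => /= e.
by rewrite (Rint_ext2 e1) (Rint_ext2 e2).
Qed.

Definition gform a f : R := \int[mu2]_x (f x * \int[mu2]_y (f y * gauss2 a (x - y))).

(** A Gaussian is the cosine transform of a Gaussian. Inserting this for [gauss2 (x - y)] and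
    expanding the cosine of a difference separates [x] from [y]; two applications of Fubini then
    produce the squares of [fcos] and [fsin]. *)
Lemma gform_pspec f (a : R) : 0 < a -> cc f ->
  gform (4 * a)^-1 f = a / pi * \int[mu2]_xi (gauss2 a xi * pspec f xi).
Proof.
move=> a0 cf; have fi := cc_mint cf; have [gi _] := gauss2_int a0.
have pi0 : pi != 0 :> R by rewrite gt_eqF// pi_gt0.
have ca : a / pi * (pi / a) = 1 by rewrite mulrA -(mulrA a) mulVf// mulr1 mulfV// gt_eqF.
have cdot1 (x : plane) : continuous (fun p : plane * plane => dot p.2 (x - p.1)).
  apply: continuous_dot; first by apply: cont_snd; exact: cont_id.
  by move=> p; apply: cvgB; [exact: cvg_cst|exact: cvg_fst].
have inner (x : plane) : \int[mu2]_y (f y * gauss2 (4 * a)^-1 (x - y)) =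
    a / pi * \int[mu2]_xi (gauss2 a xi * (cos (dot xi x) * fcos f xi + sin (dot xi x) * fsin f xi)).
  have [_ _ e] := @Rint_swap_bounded f (gauss2 a) (fun p => cos (dot p.2 (x - p.1))) 1 fi gi
    (cont_comp (cdot1 x) (@continuous_cos R)) (fun p => norm_cos_le1 _).
  rewrite (Rint_ext2 (g := fun y => a / pi * (f y * \int[mu2]_xi (gauss2 a xi * cos (dot xi (x - y)))))); last first.
    have h (u v : R) : u * v = a / pi * (u * (pi / a * v)) by rewrite mulrCA (mulrA (a / pi)) ca mul1r.
    by move=> y; rewrite gauss2_cos//; exact: h.
  rewrite RintZ; last first.
    rewrite (_ : (fun y => _) = (fun y => pi / a * (f y * gauss2 (4 * a)^-1 (x - y)))); last first.
      by apply/funext => y; rewrite (gauss2_cos (x - y) a0); exact: mulrCA.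
    apply: mintZ; apply: cc_mint; apply: (cc_mulr cf).
    exact: (cont_reflect (@continuous_gauss2 _)).
  congr (_ * _); rewrite e; apply: Rint_ext2 => xi; congr (_ * _).
  rewrite /fcos /fsin -RintZ; last exact/cc_mint/cc_cos.
  rewrite -RintZ; last exact/cc_mint/cc_sin.
  rewrite -RintD; [|exact/mintZ/cc_mint/cc_cos|exact/mintZ/cc_mint/cc_sin].
  apply: Rint_ext2 => y; have -> : dot xi (x - y) = dot xi x - dot xi y by rewrite /dot /=; ring.
  by rewrite cosB; ring.
pose k (p : plane * plane) := cos (dot p.2 p.1) * fcos f p.2 + sin (dot p.2 p.1) * fsin f p.2.
have ck : continuous k.
  have cd : continuous (fun p : plane * plane => dot p.2 p.1).
    by apply: continuous_dot; [apply: cont_snd; exact: cont_id|apply: cont_fst; exact: cont_id].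
  apply: cont_add; apply: cont_mul.
  - by apply: (cont_comp cd); exact: continuous_cos.
  - by apply: cont_comp (fcos_continuous cf); apply: cont_snd; exact: cont_id.
  - by apply: (cont_comp cd); exact: continuous_sin.
  - by apply: cont_comp (fsin_continuous cf); apply: cont_snd; exact: cont_id.
have kK p : `|k p| <= l1 f + l1 f.
  rewrite (le_trans (ler_normD _ _))// lerD// mulrC (le_trans (ler_norm_mul1 _ _))//.
  - exact: norm_cos_le1.
  - exact: fcos_le.
  - exact: norm_sin_le1.
  - exact: fsin_le.
have [_ ik e] := Rint_swap_bounded fi gi ck kK.
rewrite /gform (Rint_ext2 (g := fun x => a / pi * (f x * \int[mu2]_xi (gauss2 a xi * k (x, xi))))); last first.
  by move=> x; rewrite inner mulrCA.
rewrite (RintZ (a / pi) ik) e; apply: congr1; apply: Rint_ext2 => xi; apply: congr1.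
rewrite (Rint_ext2 (g := fun x => fcos f xi * (f x * cos (dot xi x)) + fsin f xi * (f x * sin (dot xi x)))).
  rewrite RintD; [|exact/mintZ/cc_mint/cc_cos|exact/mintZ/cc_mint/cc_sin].
  by rewrite (RintZ _ (cc_mint (cc_cos xi cf))) (RintZ _ (cc_mint (cc_sin xi cf))) -!expr2.
by move=> x; rewrite /k /=; ring.
Qed.

End FourierPlane.

(** * Plancherel's identity *)

Section Plancherel.
Context {R : realType}.
Local Notation leb := (@lebesgue_measure R).
Local Notation mu2 := (leb \x leb)%E.
Local Notation plane := (R * R)%type.
Local Notation mint f := (mu2.-integrable setT (EFin \o f)).
Implicit Types (f g h : plane -> R).

Lemma derive_lipschitz (F dF : R -> R) K (a b : R) :
  (forall s : R, is_derive s (1 : R) F (dF s)) -> (forall s, `|dF s| <= K) ->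
  `|F b - F a| <= K * `|b - a|.
Proof.
move=> FdF dK; wlog ab : a b / a <= b => [h|].
  by have [/h//|/ltW/h] := leP a b; rewrite distrC [`|a - b|]distrC.
have cF : {within `[a, b], continuous F} by apply: continuous_subspaceT; exact: dv_continuous FdF.
have [c _ ->] := MVT_segment ab (fun s _ => FdF s) cF.
by rewrite normrM ler_wpM2r.
Qed.

Lemma C1_lipschitz f : C1 f -> cc f -> exists L, 0 < L /\
  forall x z : plane, `|f (x - z) - f x| <= L * (`|z.1| + `|z.2|).
Proof.
move=> Cf cf; have [K1 [K10 h1]] := cc_bounded (cc_pd true Cf cf).
have [K2 [K20 h2]] := cc_bounded (cc_pd false Cf cf).
exists (K1 + K2); split; first exact: addr_gt0.
move=> x z; have l1 : `|f (x.1 - z.1, x.2 - z.2) - f (x.1, x.2 - z.2)| <= K1 * `|z.1|.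
  have := @derive_lipschitz (fun s => f (s, x.2 - z.2)) (fun s => pd true f (s, x.2 - z.2)) K1 x.1 (x.1 - z.1).
  rewrite [x.1 - z.1 - x.1]addrAC subrr sub0r normrN; apply => // s.
  exact: (is_derive_fst f (s, x.2 - z.2) _).1 (C1_is_derive true _ Cf).
have l2 : `|f (x.1, x.2 - z.2) - f (x.1, x.2)| <= K2 * `|z.2|.
  have := @derive_lipschitz (fun s => f (x.1, s)) (fun s => pd false f (x.1, s)) K2 x.2 (x.2 - z.2).
  rewrite [x.2 - z.2 - x.2]addrAC subrr sub0r normrN; apply => // s.
  exact: (is_derive_snd f (x.1, s) _).1 (C1_is_derive false _ Cf).
have -> : f (x - z) - f x = (f (x.1 - z.1, x.2 - z.2) - f (x.1, x.2 - z.2))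
    + (f (x.1, x.2 - z.2) - f (x.1, x.2)) by rewrite addrA subrK; case: x {l1 l2}; case: z.
apply: (le_trans (ler_normD _ _)); have := normr_ge0 z.1; have := normr_ge0 z.2; nra.
Qed.

Lemma dot_ge0 (z : plane) : 0 <= dot z z.
Proof. by rewrite /dot -!expr2 addr_ge0 ?sqr_ge0. Qed.

(** The inequality [|s| <= e + s^2 / e] trades the first moment for a second one, absorbed by half
    of the exponent. The free parameter [e] is later set to the width [b^(-1/2)] of the Gaussian,
    which balances the two terms. *)
Lemma gauss2_moment (b e : R) (z : plane) : 0 < b -> 0 < e ->
  (`|z.1| + `|z.2|) * gauss2 b z <= 2 * e * gauss2 b z + (e^-1 * (2 / b)) * gauss2 (b / 2) z.
Proof.
move=> b0 e0.
have amgm (s : R) : `|s| <= e + e^-1 * s ^+ 2.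
  rewrite -[s ^+ 2]real_normK ?num_real//; have := normr_ge0 s; set t := `|s| => t0.
  rewrite -subr_ge0 (_ : _ - t = e^-1 * ((t - e / 2) ^+ 2 + 3 / 4 * e ^+ 2)); last by field; rewrite gt_eqF.
  by rewrite mulr_ge0 ?invr_ge0 ?(ltW e0)// addr_ge0 ?sqr_ge0// mulr_ge0 ?sqr_ge0.
have g0 := gauss2_ge0 b z.
have h1 : (`|z.1| + `|z.2|) * gauss2 b z <= (2 * e + e^-1 * dot z z) * gauss2 b z.
  rewrite ler_wpM2r// /dot -!expr2; have := amgm z.1; have := amgm z.2; lra.
apply: (le_trans h1); rewrite mulrDl lerD2l -!mulrA ler_wpM2l ?invr_ge0 ?(ltW e0)//.
have [x [E1 E2 E3]] : exists x, [/\ gauss2 b z = expR (- x) * expR (- x),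
    gauss2 (b / 2) z = expR (- x) & dot z z = 2 / b * x].
  exists (b / 2 * dot z z); rewrite !gauss2E -expRD.
  by split; [congr expR; field|congr expR; ring|field; rewrite gt_eqF].
have -> : 2 * (b^-1 * gauss2 (b / 2) z) = 2 / b * gauss2 (b / 2) z by rewrite mulrA.
rewrite E1 E2 E3 -[leLHS]mulrA ler_wpM2l ?divr_ge0 ?(ltW b0)// mulrA.
rewrite -[leRHS]mul1r ler_wpM2r ?expR_ge0// expRN ler_pdivrMr ?expR_gt0// mul1r.
by have := expR_ge1Dx x; lra.
Qed.

(** The kernel [b / pi * gauss2 b] has mass 1 and width [b^(-1/2)], here [1 / (n + 1)], so
    convolving the Lipschitz function [f] with it moves [f] by at most a multiple of that width. *)
Lemma gform_approx f : C1 f -> cc f -> exists C, forall n : nat,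
  `|n.+1%:R ^+ 2 / pi * gform (n.+1%:R ^+ 2) f - \int[mu2]_x (f x ^+ 2)| <= C * harmonic n.
Proof.
move=> Cf cf; have [L [L0 fL]] := C1_lipschitz Cf cf.
(* With these choices both coefficients in [gauss2_moment] equal [2 e]. The normalized Gaussians of
   parameters [b] and [b / 2] have masses 1 and 2, so the errors add up to [6 e]. *)
exists (l1 f * (L * 6)) => n; set b := n.+1%:R ^+ 2 : R; set e := n.+1%:R^-1 : R.
have b0 : 0 < b by rewrite exprn_gt0.
have e0 : 0 < e by rewrite invr_gt0.
have be : e^-1 * (2 / b) = 2 * e by rewrite /b /e; field; rewrite addrC natr1 pnatr_eq0.
have pi0 : 0 < pi :> R := pi_gt0 R.
have [ib eb] := gauss2_int b0.
have [ib2 eb2] := gauss2_int (divr_gt0 b0 (ltr0Sn R 1)).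
have cg x : cc (fun y => f y * gauss2 b (x - y)).
  by apply: (cc_mulr cf); exact: (cont_reflect (@continuous_gauss2 _ _)).
pose d x := \int[mu2]_z ((f (x - z) - f x) * gauss2 b z).
have i1 (x : plane) : mint (fun z => f (x - z) * gauss2 b z).
  have [K [K0 fK]] := cc_bounded cf.
  under eq_fun do rewrite mulrC; apply: (@mintM _ _ _ mu2 (gauss2 b) _ K _ _ ib) => //.
  by apply: continuous_measurable_plane; exact: cont_reflect cf.1.
have inner (x : plane) : b / pi * \int[mu2]_y (f y * gauss2 b (x - y)) = f x + b / pi * d x.
  have [_ <-] := Rint_reflect x (cc_mint (cg x)).
  rewrite (Rint_ext2 (g := fun z => f (x - z) * gauss2 b z)); last by move=> z; rewrite subKr.
  rewrite /d (Rint_ext2 (f := fun z => (f (x - z) - f x) * gauss2 b z)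
    (g := fun z => f (x - z) * gauss2 b z - f x * gauss2 b z)); last by move=> z; rewrite mulrBl.
  rewrite (RintB (i1 x) (mintZ (f x) ib)) (RintZ (f x) ib) eb.
  have e3 (I c p : R) : 0 < p -> b / p * I = c + b / p * (I - c * (p / b)).
    by move=> p0; field; rewrite !gt_eqF.
  exact: e3.
have db (x : plane) : `|b / pi * d x| <= L * 6 * e.
  rewrite normrM ger0_norm ?divr_ge0 ?(ltW b0) ?(ltW pi0)//.
  pose G z := L * (2 * e * gauss2 b z + (e^-1 * (2 / b)) * gauss2 (b / 2) z).
  have iG : mint G by apply: mintZ; apply: mintD; exact: mintZ.
  have id : mint (fun z => (f (x - z) - f x) * gauss2 b z).
    by under eq_fun do rewrite mulrBl; apply: mintB => //; exact: mintZ.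
  apply: (@le_trans _ _ (b / pi * \int[mu2]_z G z)).
    rewrite ler_wpM2l ?divr_ge0 ?(ltW b0) ?(ltW pi0)//; apply: Rint_norm_le => // z.
    rewrite normrM (ger0_norm (gauss2_ge0 _ _)) (le_trans (ler_wpM2r (gauss2_ge0 _ _) (fL x z)))//.
    by rewrite -mulrA ler_wpM2l ?(ltW L0)//; exact: gauss2_moment.
  rewrite /G RintZ; last by apply: mintD; exact: mintZ.
  rewrite (RintD (mintZ _ ib) (mintZ _ ib2)) !RintZ// eb eb2 be.
  have e3 (p : R) : 0 < p -> b / p * (L * (2 * e * (p / b) + 2 * e * (p / (b / 2)))) = L * 6 * e.
    by move=> p0; field; rewrite !gt_eqF.
  by rewrite (e3 _ pi0).
have igf : mint (fun x => f x * \int[mu2]_y (f y * gauss2 b (x - y))).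
  have ck : continuous (fun p : plane * plane => gauss2 b (p.1 - p.2)).
    apply: (@cont_comp _ _ _ (fun p : plane * plane => p.1 - p.2) (gauss2 b)); last exact: continuous_gauss2.
    by move=> p; apply: cvgB; [exact: cvg_fst|exact: cvg_snd].
  have kK (p : plane * plane) : `|gauss2 b (p.1 - p.2)| <= 1.
    by rewrite ger0_norm ?gauss2_ge0// gauss2E expR_le1 mulNr oppr_le0 mulr_ge0 ?dot_ge0 ?ltW.
  by have [_ + _] := Rint_swap_bounded (cc_mint cf) (cc_mint cf) ck kK.
have if2 : mint (fun x => f x ^+ 2) by apply: cc_mint; exact: cc_mulr cf cf.1.
rewrite /gform -(RintZ _ igf) -(RintB (mintZ _ igf) if2).
have -> : l1 f * (L * 6) * harmonic n = \int[mu2]_x (L * 6 * e * `|f x|).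
  have -> : harmonic n = e by [].
  by rewrite RintZ; [rewrite -/(l1 f) -mulrA [RHS]mulrC|exact/mint_norm/cc_mint].
apply: Rint_norm_le.
- by apply: mintB => //; exact: mintZ.
- exact/mintZ/mint_norm/cc_mint.
- move=> x; rewrite mulrCA inner mulrDr -expr2 [f x ^+ 2 + _]addrC addrK normrM mulrC.
  by rewrite ler_wpM2r.
Qed.

(** The Gaussian form is computed twice, as an approximation of the squared L^2 norm and as a damped
    integral of [pspec f]. The damping factor increases to 1, so monotone convergence gives the
    identity in the extended reals and with it the integrability of [pspec f]. *)
Theorem plancherel f : C1 f -> cc f ->
  (\int[mu2]_xi (pspec f xi)%:E = ((2 * pi) ^+ 2 * \int[mu2]_x (f x ^+ 2))%:E)%E.
Proof.
move=> Cf cf; have [C hC] := gform_approx Cf cf.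
have pi0 : 0 < pi :> R := pi_gt0 R.
(* The frequency parameter dual to the spatial exponent [(n + 1)^2] under [gform_pspec]. *)
pose a n : R := (4 * n.+1%:R ^+ 2)^-1.
have a0 n : 0 < a n by rewrite invr_gt0 mulr_gt0// exprn_gt0.
have mp := continuous_measurable_plane (pspec_continuous cf).
have ia n : mint (fun xi => gauss2 (a n) xi * pspec f xi).
  apply: (mintM mp _ (gauss2_int (a0 n)).1) => xi; rewrite ger0_norm ?pspec_ge0//.
  exact: pspec_le.
have ea n : \int[mu2]_xi (gauss2 (a n) xi * pspec f xi) =
    (2 * pi) ^+ 2 * (n.+1%:R ^+ 2 / pi * gform (n.+1%:R ^+ 2) f).
  have := gform_pspec (a0 n) cf; rewrite {1}/a.
  have -> : (4 * (4 * n.+1%:R ^+ 2)^-1)^-1 = n.+1%:R ^+ 2 :> R by field; rewrite addrC natr1 pnatr_eq0.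
  have e3 (I p m : R) : p != 0 -> m != 0 ->
      I = (2 * p) ^+ 2 * (m ^+ 2 / p * ((4 * m ^+ 2)^-1 / p * I)).
    by move=> p0 m0; field; rewrite p0 m0.
  by move=> ->; apply: e3; rewrite ?pnatr_eq0 ?gt_eqF.
have lim1 : (\int[mu2]_xi (gauss2 (a n) xi * pspec f xi)) @[n --> \oo] -->
    ((2 * pi) ^+ 2 * \int[mu2]_x (f x ^+ 2)).
  under eq_fun do rewrite ea.
  apply: cvgM; first exact: cvg_cst.
  apply/subr_cvg0; apply: (@squeeze_cvgr _ _ _ _ (fun n => - (C * harmonic n)) (fun n => C * harmonic n)).
  - by apply: nearW => n; rewrite -ler_norml.
  - rewrite -oppr0; apply: cvgN; rewrite -(mulr0 C); apply: cvgM; [exact: cvg_cst|exact: cvg_harmonic].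
  - by rewrite -(mulr0 C); apply: cvgM; [exact: cvg_cst|exact: cvg_harmonic].
pose g n xi := (gauss2 (a n) xi * pspec f xi)%:E.
have ag xi : gauss2 (a n) xi * pspec f xi @[n --> \oo] --> pspec f xi.
  rewrite -[X in _ --> X]mul1r; apply: cvgM; last exact: cvg_cst.
  rewrite (_ : (fun n => gauss2 (a n) xi) = (fun n => expR (- a n * dot xi xi))); last by apply/funext => n; rewrite gauss2E.
  suff h : - a n * dot xi xi @[n --> \oo] --> (0 : R).
    by rewrite -expR0; exact: (cvg_comp _ _ h (@continuous_expR R 0)).
  rewrite -(mul0r (dot xi xi)); apply: cvgM; last exact: cvg_cst.
  rewrite -oppr0; apply: cvgN.
  have -> : a = (fun n => 4^-1 * (harmonic n * harmonic n)).
    by apply/funext => n; rewrite /a /harmonic/= expr2 !invfM.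
  rewrite -(mulr0 4^-1); apply: cvgM; first exact: cvg_cst.
  by rewrite -(mulr0 (0 : R)); apply: cvgM; exact: cvg_harmonic.
have := @monotone_convergence _ _ _ mu2 setT measurableT g.
have -> : (fun xi => limn (g^~ xi)) = (fun xi => (pspec f xi)%:E).
  by apply/funext => xi; apply/cvg_lim => //; apply: cvg_EFin; [exact: nearW|exact: ag].
move=> ->.
- apply/cvg_lim => //.
  rewrite (_ : (fun n => \int[mu2]_xi g n xi)%E = (fun n => (\int[mu2]_xi (gauss2 (a n) xi * pspec f xi))%:E)); last first.
    by apply/funext => n; rewrite -Rint_EFin.
  by apply: cvg_EFin; [exact: nearW|exact: lim1].
- by move=> n; apply/measurable_EFinP; exact: mint_meas (ia n).
- by move=> n xi _; rewrite lee_fin mulr_ge0 ?pspec_ge0 ?gauss2_ge0.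
- move=> xi _ n m nm; rewrite lee_fin ler_wpM2r ?pspec_ge0// !gauss2E ler_expR.
  rewrite ler_wpM2r ?dot_ge0// lerN2 lef_pV2 ?posrE ?mulr_gt0 ?exprn_gt0// ler_pM2l//.
  by rewrite lerXn2r ?nnegrE// ler_nat.
Qed.

End Plancherel.

(** * Frullani's formula *)

Section Frullani.
Context {R : realType}.
Local Notation leb := (@lebesgue_measure R).
Local Notation mint1 f := (leb.-integrable setT (EFin \o f)).

Definition pos : set R := `]0%R, +oo[%classic.

(* Agrees with [t^-1] on [pos] and is visibly measurable. *)
Definition pinv (t : R) : R := expR (- ln t) * \1_pos t.

Lemma pinvE (t : R) : 0 < t -> pinv t = t^-1.
Proof.
move=> t0; rewrite /pinv indicE mem_setE in_itv/= t0/= mulr1 expRN lnK//.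
Qed.

Lemma pinv_ge0 t : 0 <= pinv t.
Proof. by rewrite mulr_ge0 ?expR_ge0. Qed.

Lemma pinv0 t : t <= 0 -> pinv t = 0.
Proof. by move=> t0; rewrite /pinv indicE mem_setE in_itv/= andbT ltNge t0 mulr0. Qed.

Lemma measurable_pos : @measurable_fun _ _ (measurableTypeR R) (measurableTypeR R) setT (\1_pos : R -> R).
Proof. by apply: measurable_indic; exact: measurable_itv. Qed.

Lemma measurable_pinv : @measurable_fun _ _ (measurableTypeR R) (measurableTypeR R) setT pinv.
Proof.
apply: measurable_funM; last exact: measurable_pos.
apply: measurableT_comp; first exact: measurable_cont (@continuous_expR R).
by apply: measurable_funN; exact: measurable_ln.
Qed.

(** Frullani's integrand, whose integral over [t > 0] is [- ln r]; it represents the logarithmic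
    kernel by Gaussians when [r] is a squared distance. *)
Definition frul (r t : R) : R := (expR (- (t * r)) - expR (- t)) * pinv t.

Lemma integral_expR_decay (s : R) : 0 < s ->
  mint1 (fun t => expR (- (t * s)) * \1_pos t) /\
  \int[leb]_t (expR (- (t * s)) * \1_pos t) = s^-1.
Proof.
move=> s0.
have dF (t : R) : is_derive t 1 (fun t => - s^-1 * expR (- (t * s))) (expR (- (t * s))).
  have d1 : is_derive t 1 (fun t => - (t * s)) (- s).
    by apply: (dv_eq (dv_opp (dv_mul (dv_id t) (dv_cst s t (1 : R))))); ring.
  apply: (dv_eq (dv_mul (dv_cst (- s^-1) t (1 : R)) (dv_comp (g := fun t => - (t * s)) (is_derive_expR _) d1))).
  by field; rewrite gt_eqF.
have cf : continuous (fun t : R => expR (- (t * s))).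
  apply: (@cont_comp _ _ _ (fun t : R => - (t * s)) expR); last exact: continuous_expR.
  by apply: cont_opp; apply: cont_mul; [exact: cont_id|exact: cont_cst].
have e : (\int[leb]_t (expR (- (t * s)) * \1_pos t)%:E = (s^-1)%:E)%E.
  transitivity (\int[leb]_(t in `]0%R, +oo[) (expR (- (t * s)))%:E)%E.
    rewrite [RHS]integral_mkcond; apply: eq_integral => t _.
    by rewrite patchE indicE; case: ifPn => _; rewrite ?mulr1 ?mulr0.
  rewrite integral_itv_obnd_cbnd; last by apply/measurable_EFinP; apply: measurable_funTS; exact: measurable_cont.
  rewrite (@ge0_continuous_FTC2y _ _ (fun t => - s^-1 * expR (- (t * s))) 0 0).
  - by rewrite mul0r oppr0 expR0 mulr1 -EFinB sub0r opprK.
  - by move=> t _; exact: expR_ge0.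
  - exact: continuous_subspaceT.
  - rewrite -(mulr0 (- s^-1)); apply: cvgM; first exact: cvg_cst.
    apply: (@cvg_comp _ _ _ (fun t : R => t * s) (fun t => expR (- t)) _ (pinfty_nbhs R)); last exact: cvgr_expR.
    by apply: gt0_cvgMly.
  - by move=> t _; exact: (ex_derive (is_derive := dF t)).
  - by apply: cvg_at_right_filter; exact: dv_continuous dF _.
  - by move=> t _; rewrite derive1E; exact: (derive_val (is_derive := dF t)).
have mt : mint1 (fun t => expR (- (t * s)) * \1_pos t).
  apply/integrableP; split.
    apply/measurable_EFinP; apply: measurable_funM; [exact: measurable_cont|exact: measurable_pos].
  rewrite (_ : (\int[leb]_t `|_| = s^-1%:E)%E) ?ltry// -e; apply: eq_integral => t _.
  by rewrite /= ger0_norm// mulr_ge0 ?expR_ge0.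
by split=> //; rewrite /Rintegral e.
Qed.

(** The function [exp (- t s)] is integrated over [a <= s <= b] and [t > 0] in both orders: [t]
    first leaves [1 / s], [s] first leaves Frullani's integrand. *)
Lemma frullani_lt (a b : R) : 0 < a -> a < b ->
  mint1 (fun t => (expR (- (t * a)) - expR (- (t * b))) * pinv t) /\
  \int[leb]_t ((expR (- (t * a)) - expR (- (t * b))) * pinv t) = ln b - ln a.
Proof.
move=> a0 ab.
pose F (p : R * R) : R := expR (- (p.2 * p.1)) * \1_pos p.2 * \1_(`[a, b]%classic) p.1.
have mF : @measurable_fun _ _ (measurableTypeR R * measurableTypeR R)%type (measurableTypeR R) setT F.
  apply: measurable_funM; last first.
    by apply: (measurableT_comp (mint_meas (mint_itv a b))); exact: measurable_fst.
  apply: measurable_funM; last first.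
    by apply: (measurableT_comp measurable_pos); exact: measurable_snd.
  apply: continuous_measurable_plane.
  apply: (@cont_comp _ _ _ (fun p : R * R => - (p.2 * p.1)) expR); last exact: continuous_expR.
  by apply: cont_opp; apply: cont_mul; [apply: cont_snd; exact: cont_id|apply: cont_fst; exact: cont_id].
have inner (s : R) : mint1 (fun t => F (s, t)) /\
    \int[leb]_t F (s, t) = s^-1 * \1_(`[a, b]%classic) s.
  have [/set_mem|sab] := boolP (s \in (`[a, b]%classic : set R)).
    rewrite /= in_itv/= => /andP[as_ sb].
    have [i e] := integral_expR_decay (lt_le_trans a0 as_).
    rewrite /F /= indicE mem_setE in_itv/= as_ sb/= mulr1.
    by under eq_fun do rewrite mulr1; rewrite -e.
  rewrite /F /= indicE (negbTE sab) mulr0; under eq_fun do rewrite mulr0.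
  split; first exact: integrable0.
  by rewrite Rintegral_cst// mul0r.
have F0 p : 0 <= F p by rewrite /F !mulr_ge0 ?expR_ge0.
have iF : (leb \x leb)%E.-integrable setT (EFin \o F).
  apply: (@mint_prod _ _ _ (measurableTypeR R) (measurableTypeR R) leb leb F (fun s : R => a^-1 * \1_(`[a, b]%classic : set R) s) mF).
  - by move=> s; exact: (inner s).1.
  - move=> s; under eq_Rintegral do rewrite ger0_norm//.
    rewrite (inner s).2 indicE mem_setE in_itv/=; case: (boolP (a <= s <= b)) => [/andP[as_ _]|_]; last by rewrite !mulr0.
    by rewrite !mulr1 lef_pV2 ?posrE// (lt_le_trans a0).
  - exact/mintZ/mint_itv.
have eb (t : R) : \int[leb]_s F (s, t) = (expR (- (t * a)) - expR (- (t * b))) * pinv t.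
  have [t0|t0] := leP t 0.
    rewrite pinv0// mulr0 (Rint_ext1 (g := fun=> 0)) ?Rintegral_cst ?mul0r// => s.
    by rewrite /F /= indicE mem_setE in_itv/= andbT ltNge t0 mulr0 mul0r.
  rewrite pinvE// (Rint_ext1 (g := fun s => expR (- (t * s)) * \1_(`[a, b]%classic) s)); last first.
    by move=> s; rewrite /F /= [\1_pos t]indicE mem_setE in_itv/= t0 mulr1.
  have -> : \int[leb]_s (expR (- (t * s)) * \1_(`[a, b]%classic) s) = \int[leb]_(s in `[a, b]) expR (- (t * s)).
    rewrite [RHS]Rintegral_mkcond; apply: Rint_ext1 => s.
    by rewrite patchE indicE; case: ifPn => _; rewrite ?mulr1 ?mulr0.
  have dG (s : R) : is_derive s 1 (fun s => - t^-1 * expR (- (t * s))) (expR (- (t * s))).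
    have d1 : is_derive s 1 (fun s => - (t * s)) (- t).
      by apply: (dv_eq (dv_opp (dv_mul (dv_cst t s (1 : R)) (dv_id s)))); ring.
    apply: (dv_eq (dv_mul (dv_cst (- t^-1) s (1 : R)) (dv_comp (g := fun s => - (t * s)) (is_derive_expR _) d1))).
    by field; rewrite gt_eqF.
  have cG (s : R) : {for s, continuous (fun s : R => expR (- (t * s)))}.
    apply: (@cont_comp _ _ _ (fun s : R => - (t * s)) expR); last exact: continuous_expR.
    by apply: cont_opp; apply: cont_mul; [exact: cont_cst|exact: cont_id].
  rewrite /Rintegral; have -> := Rint_FTC ab (fun s _ => dG s) (fun s _ => cG s).
  by rewrite /=; ring.
have [i1 e1] := mint_prodr iF; have [_ e2] := mint_prodl iF.
split; first by move: i1; under eq_fun do rewrite eb.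
rewrite -(Rint_ext1 eb) e1 -e2 (Rint_ext1 (fun s => (inner s).2)).
have -> : \int[leb]_s (s^-1 * \1_(`[a, b]%classic) s) = \int[leb]_(s in `[a, b]) s^-1.
  rewrite [RHS]Rintegral_mkcond; apply: Rint_ext1 => s.
  by rewrite patchE indicE; case: ifPn => _; rewrite ?mulr1 ?mulr0.
have dl (s : R) : a <= s <= b -> is_derive s 1 (@ln R) s^-1.
  by move=> /andP[as_ _]; apply: is_derive1_ln; exact: lt_le_trans as_.
have cl (s : R) : a <= s <= b -> {for s, continuous (fun s : R => s^-1)}.
  move=> /andP[as_ _]; apply: cvgV; last exact: cvg_id.
  by rewrite gt_eqF// (lt_le_trans a0).
by rewrite /Rintegral; have -> := Rint_FTC ab dl cl.
Qed.

(** For fixed [r] the integrand has a constant sign, so its L^1 norm is exactly [|ln r|]. This is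
    what later allows exchanging the integral in [t] with the double integral against the
    logarithm. *)
Lemma frullani (r : R) : 0 < r ->
  [/\ mint1 (frul r), \int[leb]_t frul r t = - ln r &
      \int[leb]_t `|frul r t| = `|ln r|].
Proof.
move=> r0.
have e1 : frul r = (fun t => - ((expR (- (t * 1)) - expR (- (t * r))) * pinv t)).
  by apply/funext => t; rewrite /frul mulr1; ring.
have [r1|r1|r1] := ltgtP r 1; last first.
- have -> : frul r = fun=> 0 by apply/funext => t; rewrite /frul r1 mulr1 subrr mul0r.
  rewrite r1 ln1 oppr0 normr0; split; first exact: integrable0.
    by rewrite Rintegral_cst// mul0r.
  by rewrite Rintegral_cst// mul0r.
- have [i e] := frullani_lt ltr01 r1; rewrite e1.
  have nn t : 0 <= (expR (- (t * 1)) - expR (- (t * r))) * pinv t.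
    have [t0|t0] := leP t 0; first by rewrite pinv0// mulr0.
    have h := ler_wpM2l (ltW t0) (ltW r1).
    by apply: mulr_ge0; [rewrite subr_ge0 ler_expR lerN2|exact: pinv_ge0].
  split; [exact: mintN|by rewrite RintN// e ln1 subr0|].
  under eq_Rintegral do rewrite normrN ger0_norm//.
  by rewrite e ln1 subr0 ger0_norm// ln_ge0// ltW.
- have [i e] := frullani_lt r0 r1.
  have e2 : frul r = (fun t => (expR (- (t * r)) - expR (- (t * 1))) * pinv t).
    by apply/funext => t; rewrite /frul mulr1.
  rewrite e2.
  have nn t : 0 <= (expR (- (t * r)) - expR (- (t * 1))) * pinv t.
    have [t0|t0] := leP t 0; first by rewrite pinv0// mulr0.
    have h := ler_wpM2l (ltW t0) (ltW r1).
    by apply: mulr_ge0; [rewrite subr_ge0 ler_expR lerN2|exact: pinv_ge0].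
  split; [by []|by rewrite e ln1 sub0r|].
  under eq_Rintegral do rewrite ger0_norm//.
  by rewrite e ln1 sub0r ler0_norm// ln_le0// ltW.
Qed.

(** The antiderivative [exp (- c / t) / c] rises from 0 to [1 / c]. Used with [c = |xi|^2 / 4], this
    integral in the Gaussian parameter produces the multiplier [|xi|^-2]. *)
Lemma integral_inv_sqr_expR (c : R) : 0 < c ->
  (\int[leb]_t (pinv t ^+ 2 * expR (- (c * pinv t)))%:E = (c^-1)%:E)%E.
Proof.
move=> c0; pose h (t : R) := t^-1 ^+ 2 * expR (- (c * t^-1)).
have cV (t : R) : 0 < t -> {for t, continuous (fun t : R => t^-1)}.
  by move=> t0; apply: cvgV; [rewrite gt_eqF|exact: cvg_id].
have hc (t : R) : 0 < t -> {for t, continuous h}.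
  move=> t0; have e1 : - (c * u^-1) @[u --> t] --> - (c * t^-1).
    by apply: cvgN; apply: cvgM; [exact: cvg_cst|exact: cV].
  apply: cvgM; first by apply: cvgM; exact: cV.
  exact: (cvg_comp _ _ e1 (@continuous_expR R _)).
have dF (t : R) : 0 < t -> is_derive t 1 (fun t => c^-1 * expR (- (c * t^-1))) (h t).
  move=> t0; have t1 : t != 0 by rewrite gt_eqF.
  have d1 : is_derive t 1 (fun t => - (c * t^-1)) (c * t^-1 ^+ 2).
    apply: (dv_eq (dv_opp (dv_mul (dv_cst c t (1 : R)) (dv_inv (f := fun t => t) t1 (dv_id t))))).
    by field.
  apply: (dv_eq (dv_mul (dv_cst c^-1 t (1 : R)) (dv_comp (g := fun t => - (c * t^-1)) (is_derive_expR _) d1))).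
  by rewrite /h; field; rewrite t1 gt_eqF.
pose A n := `[(n.+1%:R : R)^-1, n.+1%:R]%classic : set R.
have A0 n t : A n t -> 0 < t.
  by rewrite /A /= in_itv/= => /andP[h1 _]; rewrite (lt_le_trans _ h1)// invr_gt0.
have UA : pos = \bigcup_n A n.
  apply/seteqP; split=> [t|t [n _ /A0]]; rewrite /pos /= in_itv/= andbT// => t0.
  exists (Num.truncn (t + t^-1)) => //; have := truncnS_gt (t + t^-1).
  set N := _%:R => tN; rewrite /A /= in_itv/=; have ti : 0 < t^-1 by rewrite invr_gt0.
  apply/andP; split; last by apply/ltW/(lt_trans _ tN); rewrite ltrDl.
  rewrite invf_ple ?posrE ?(lt_trans _ tN) ?addr_gt0//.
  by apply/ltW/(lt_trans _ tN); rewrite ltrDr.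
have mph : measurable_fun setT (fun t => pinv t ^+ 2 * expR (- (c * pinv t)) : measurableTypeR R).
  apply: (measurableT_comp (f := fun u : R => u ^+ 2 * expR (- (c * u)))); last exact: measurable_pinv.
  apply: measurable_cont; apply: cont_mul; first by apply: cont_exp; exact: cont_id.
  apply: (@cont_comp _ _ _ (fun u : R => - (c * u)) expR); last exact: continuous_expR.
  by apply: cont_opp; apply: cont_mul; [exact: cont_cst|exact: cont_id].
have nn t : 0 <= pinv t ^+ 2 * expR (- (c * pinv t)) by rewrite mulr_ge0 ?sqr_ge0 ?expR_ge0.
have -> : (\int[leb]_t (pinv t ^+ 2 * expR (- (c * pinv t)))%:E =
    \int[leb]_(t in pos) (pinv t ^+ 2 * expR (- (c * pinv t)))%:E)%E.
  rewrite [RHS]integral_mkcond; apply: eq_integral => t _.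
  rewrite patchE mem_setE in_itv/= andbT; case: ltP => // t0.
  by rewrite pinv0// expr0n/= mul0r.
have A_cvg := @ge0_nondecreasing_set_cvg_integral _ (measurableTypeR R) R A
  (fun t => (pinv t ^+ 2 * expR (- (c * pinv t)))%:E) leb.
rewrite UA -(cvg_lim _ (A_cvg _ _ _ _))//.
- apply/cvg_lim => //.
  have e n : (\int[leb]_(t in A n) (pinv t ^+ 2 * expR (- (c * pinv t)))%:E =
      (c^-1 * expR (- (c * n.+1%:R^-1)) - c^-1 * expR (- (c * n.+1%:R)))%:E)%E.
    transitivity (\int[leb]_(t in A n) (h t)%:E)%E.
      by apply: eq_integral => t; rewrite inE => /A0 t0; rewrite pinvE.
    case: n => [|n].
      by rewrite /A invr1 set_itv1 integral_set1// subrr.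
    have lt1 : (n.+2%:R : R)^-1 < n.+2%:R by rewrite (lt_trans (_ : _ < 1))// ?invf_lt1// ltr1n.
    have hA t : (n.+2%:R : R)^-1 <= t <= n.+2%:R -> 0 < t.
      by move=> ht; apply: (A0 n.+1); rewrite /A /= in_itv.
    have := Rint_FTC lt1 (fun t ht => dF t (hA t ht)) (fun t ht => hc t (hA t ht)).
    by rewrite invrK.
  under eq_fun do rewrite e.
  apply: cvg_EFin; first exact: nearW.
  rewrite -[c^-1 in X in _ --> X]subr0; apply: cvgB.
    rewrite -[X in _ --> X]mulr1; apply: cvgM; first exact: cvg_cst.
    have e1 : - (c * n.+1%:R^-1) @[n --> \oo] --> (0 : R).
      rewrite -oppr0 -(mulr0 c); apply: cvgN; apply: cvgM; [exact: cvg_cst|exact: cvg_harmonic].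
    by have := cvg_comp _ _ e1 (@continuous_expR R 0); rewrite expR0.
  rewrite -(mulr0 c^-1); apply: cvgM; first exact: cvg_cst.
  apply: (@squeeze_cvgr _ _ _ _ (fun=> 0) (fun n => c^-1 * harmonic n)).
  + apply: nearW => n; rewrite expR_ge0/= /harmonic/= expRN -invfM lef_pV2 ?posrE ?mulr_gt0 ?expR_gt0//.
    by have := expR_ge1Dx (c * n.+1%:R); lra.
  + exact: cvg_cst.
  + by rewrite -(mulr0 c^-1); apply: cvgM; [exact: cvg_cst|exact: cvg_harmonic].
- move=> n m nm; apply/subsetPset => t; rewrite /A /= !in_itv/= => /andP[t1 t2]; apply/andP; split.
    by rewrite (le_trans _ t1)// lef_pV2 ?posrE// ler_nat.
  by rewrite (le_trans t2)// ler_nat.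
- by move=> n; exact: measurable_itv.
- by move=> n; apply/measurable_EFinP; exact: measurable_funTS.
- by move=> n t _; rewrite lee_fin.
Qed.

End Frullani.

(** * The logarithmic energy and the L^2 bound on the velocity *)

Section Energy.
Context {R : realType}.
Local Notation leb := (@lebesgue_measure R).
Local Notation mu2 := (leb \x leb)%E.
Local Notation plane := (R * R)%type.
Local Notation mint f := (mu2.-integrable setT (EFin \o f)).
Implicit Types (f g : plane -> R) (x xi : plane).

Definition sfplane2 :=
  HB.pack_for {sigma_finite_measure set ((measurableTypeR R * measurableTypeR R) *
    (measurableTypeR R * measurableTypeR R))%type -> \bar R}
  (@sfplane R \x @sfplane R)%E
  (Measure.on (@sfplane R \x @sfplane R)%E)
  (lebesgue_integral_fubini.measure_function_Measure_isSigmaFinite__to__measure_function_isSFinite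
    (@sfplane R) (@sfplane R))
  (lebesgue_integral_fubini.measure_function_Measure_isSigmaFinite__to__measure_function_isSigmaFinite
    (@sfplane R) (@sfplane R)).

(** The quadratic form of [2 pi (- Delta)^-1]. *)
Definition energy f : R := \int[mu2]_x (f x * - kconv f x).

(* [frul], with the value at [r = 0] changed to match [ln 0 = 0]. *)
Definition frul0 (r t : R) : R := frul r t * (0 < r)%R%:R.

Lemma frul0P (r : R) : 0 <= r ->
  [/\ leb.-integrable setT (EFin \o frul0 r), \int[leb]_t frul0 r t = - ln r &
      \int[leb]_t `|frul0 r t| = `|ln r|].
Proof.
rewrite le_eqVlt => /orP[/eqP<-|r0].
  rewrite (_ : frul0 0 = fun=> 0); last by apply/funext => t; rewrite /frul0 ltxx mulr0.
  rewrite ln0// oppr0 normr0; split; first exact: integrable0.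
    by rewrite Rintegral_cst// mul0r.
  by rewrite Rintegral_cst// mul0r.
rewrite (_ : frul0 r = frul r); first exact: frullani.
by apply/funext => t; rewrite /frul0 r0 mulr1.
Qed.

Lemma ln_dot (z : plane) : ln (dot z z) = 2 * kern z.
Proof.
rewrite /kern /enorm; have [d0|d0] := ltP 0 (dot z z).
  by rewrite -{1}(sqr_sqrtr (ltW d0)) lnXn ?sqrtr_gt0// mulr_natl.
by rewrite ln0// ler0_sqrtr// ln0// mulr0.
Qed.

Lemma negligible1 x : mu2.-negligible [set x].
Proof.
have mx : measurable ([set x] : set (measurableTypeR R * measurableTypeR R)).
  rewrite (_ : [set x] = [set x.1] `*` [set x.2]); first exact: measurableX.
  by apply/seteqP; split=> y /=; [move=> ->|case: y x => [a b] [c d] /= [-> ->]].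
exists [set x]; split => //; rewrite (_ : [set x] = [set x.1] `*` [set x.2]); last first.
  by apply/seteqP; split=> y /=; [move=> ->|case: y x {mx} => [a b] [c d] /= [-> ->]].
by rewrite product_measure1E// [X in (X * _)%E](lebesgue_measure_set1 x.1) mul0e.
Qed.

Lemma Rint_off1 x f g : @measurable_fun _ _ (measurableTypeR R * measurableTypeR R)%type (measurableTypeR R) setT f ->
  @measurable_fun _ _ (measurableTypeR R * measurableTypeR R)%type (measurableTypeR R) setT g ->
  (forall y, y != x -> f y = g y) -> \int[mu2]_y f y = \int[mu2]_y g y.
Proof.
move=> mf mg fg; rewrite /Rintegral; congr fine; apply: ae_eq_integral => //.
- exact/measurable_EFinP.
- exact/measurable_EFinP.
- apply: negligibleS (negligible1 x) => y /= h; apply/eqP/negP => yx; apply: h => _.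
  by rewrite fg//; exact/negP.
Qed.

Lemma measurable_sub2 : @measurable_fun _ _ ((measurableTypeR R * measurableTypeR R) * (measurableTypeR R * measurableTypeR R))%type
  (measurableTypeR R) setT (fun p : plane * plane => dot (p.1 - p.2) (p.1 - p.2)).
Proof.
have h : continuous (fun p : plane * plane => p.1 - p.2).
  by move=> p; apply: cvgB; [exact: cvg_fst|exact: cvg_snd].
by apply: continuous_measurable_plane2; exact: (continuous_dot h h).
Qed.

Lemma measurable_gt0 : @measurable_fun _ _ (measurableTypeR R) (measurableTypeR R) setT
  (fun r : R => (0 < r)%R%:R).
Proof.
rewrite (_ : (fun r => _) = \1_(`]0%R, +oo[%classic : set R)).
  by apply: measurable_indic; exact: measurable_itv.
by apply/funext => r; rewrite indicE mem_setE in_itv/= andbT.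
Qed.

Lemma frul0_bound (r t : R) : 0 <= r -> `|frul0 r t| <= pinv t.
Proof.
move=> r0; rewrite /frul0 /frul normrM [`|_ * pinv t|]normrM (ger0_norm (pinv_ge0 t)).
have [t0|t0] := leP t 0; first by rewrite pinv0// !(mulr0, mul0r).
have h : `|expR (- (t * r)) - expR (- t)| <= 1.
  have e1 : expR (- (t * r)) <= 1 by rewrite expR_le1 oppr_le0 mulr_ge0// ltW.
  have e2 : expR (- t) <= 1 by rewrite expR_le1 oppr_le0 ltW.
  by rewrite ler_norml; have := expR_ge0 (- (t * r)); have := expR_ge0 (- t); lra.
case: (0 < r); rewrite ?normr0 ?normr1 ?mulr0 ?pinv_ge0 ?mulr1//.
by rewrite ler_piMl ?pinv_ge0.
Qed.

Definition fruldiff f (q : (plane * plane) * R) : R :=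
  f q.1.1 * f q.1.2 * frul0 (dot (q.1.1 - q.1.2) (q.1.1 - q.1.2)) q.2.

Lemma measurable_frul0 : @measurable_fun _ _ (measurableTypeR R * measurableTypeR R)%type
  (measurableTypeR R) setT (fun p : plane => frul0 p.1 p.2).
Proof.
rewrite /frul0 /frul; apply: measurable_funM; last first.
  by apply: (measurableT_comp measurable_gt0); exact: measurable_fst.
apply: measurable_funM; last by apply: (measurableT_comp measurable_pinv); exact: measurable_snd.
apply: continuous_measurable_plane; apply: cont_sub.
  apply: (@cont_comp _ _ _ (fun p : R * R => - (p.2 * p.1)) expR); last exact: continuous_expR.
  by apply: cont_opp; apply: cont_mul; [apply: cont_snd; exact: cont_id|apply: cont_fst; exact: cont_id].
apply: (@cont_comp _ _ _ (fun p : R * R => - p.2) expR); last exact: continuous_expR.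
by apply: cont_opp; apply: cont_snd; exact: cont_id.
Qed.

Lemma cc_tensor_meas f g : cc f -> cc g -> @measurable_fun _ _ ((measurableTypeR R * measurableTypeR R) * (measurableTypeR R * measurableTypeR R))%type
  (measurableTypeR R) setT (fun p : plane * plane => f p.1 * g p.2).
Proof.
move=> [cf _] [cg _]; apply: continuous_measurable_plane2; apply: cont_mul.
  by apply: (cont_comp (f := fst) (g := f)) => //; apply: cont_fst; exact: cont_id.
by apply: (cont_comp (f := snd) (g := g)) => //; apply: cont_snd; exact: cont_id.
Qed.

Lemma measurable_fruldiff f : cc f -> @measurable_fun _ _ (((measurableTypeR R * measurableTypeR R) * (measurableTypeR R * measurableTypeR R)) * measurableTypeR R)%type
  (measurableTypeR R) setT (fruldiff f).
Proof.
move=> cf; apply: measurable_funM.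
  by apply: (measurableT_comp (cc_tensor_meas cf cf)); exact: measurable_fst.
apply: (measurableT_comp (f := fun p : plane => frul0 p.1 p.2)
  (g := fun q : (plane * plane) * R => (dot (q.1.1 - q.1.2) (q.1.1 - q.1.2), q.2))).
  exact: measurable_frul0.
apply/measurable_fun_pairP; split => /=; last exact: measurable_snd.
by apply: (measurableT_comp measurable_sub2); exact: measurable_fst.
Qed.

Lemma mint_kern_tensor f g : cc f -> cc g ->
  (sfplane \x sfplane)%E.-integrable setT (EFin \o (fun p : plane * plane => f p.1 * g p.2 * kern (p.1 - p.2))) /\
  \int[(sfplane \x sfplane)%E]_p (f p.1 * g p.2 * kern (p.1 - p.2)) = \int[mu2]_x (f x * kconv g x).
Proof.
move=> cf cg; have [K [K0 gK]] := cc_bounded cg; have [_ [M1 fM1]] := cf; have [_ [M2 gM2]] := cg.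
have i : (sfplane \x sfplane)%E.-integrable setT (EFin \o (fun p : plane * plane => f p.1 * g p.2 * kern (p.1 - p.2))).
  apply: (@mint_prod R _ _ _ _ sfplane sfplane _ (fun x => (K * kmass (M2 + `|M1|)) * `|f x|)).
  - apply: measurable_funM; first exact: cc_tensor_meas.
    apply: (measurableT_comp (f := kern) (g := fun p : plane * plane => p.1 - p.2)); first exact: measurable_kern.
    apply/measurable_fun_pairP; split; apply: continuous_measurable_plane2 => /=; apply: cont_sub;
      by [apply: cont_fst; apply: cont_fst; exact: cont_id|apply: cont_fst; apply: cont_snd; exact: cont_id
         |apply: cont_snd; apply: cont_fst; exact: cont_id|apply: cont_snd; apply: cont_snd; exact: cont_id].
  - move=> x; have [_ h] := kconv_mint x cg; have := mintZ (f x) h.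
    by congr (_.-integrable _ _); apply/funext => y /=; congr EFin; ring.
  - move=> x; have [_ h] := kconv_mint x cg.
    rewrite (Rint_ext2 (g := fun y => `|f x| * `|kern (x - y) * g y|)); last first.
      by move=> y; rewrite -normrM; congr `|_|; rewrite /=; ring.
    rewrite RintZ; last exact: mint_norm.
    have [fx|/fM1 ->] := leP `|x| M1; last by rewrite normr0 mul0r mulr0.
    rewrite mulrC ler_wpM2r//; have := (kconv_le cg gK gM2 (le_trans fx (ler_norm M1))).2; exact.
  - by apply: mintZ; apply: mint_norm; exact: cc_mint.
split=> //; have [_ <-] := mint_prodl i.
apply: Rint_ext2 => x /=; rewrite /kconv -RintZ; last exact: (kconv_mint x cg).2.
by apply: Rint_ext2 => y; ring.
Qed.

(** The subtracted [exp (- t)] contributes a multiple of the integral of [f], which is 0, so only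
    the Gaussian form is left. The value of [frul0] on the diagonal [y = x] differs from [frul], but
    for fixed [x] this is a null set. *)
Lemma gform_frul f (t : R) : cc f -> \int[mu2]_x f x = 0 ->
  \int[(sfplane \x sfplane)%E]_p fruldiff f (p, t) = pinv t * gform t f.
Proof.
move=> cf f0; have [t0|t0] := leP t 0.
  rewrite pinv0// mul0r (@Rint_ext _ _ _ _ _ (fun=> 0)) ?Rintegral_cst ?mul0r// => p.
  by rewrite /fruldiff /frul0 /frul /= pinv0// mulr0 mul0r mulr0.
have i : sfplane2.-integrable setT (EFin \o (fun p : plane * plane => fruldiff f (p, t))).
  apply: (@mint_le R _ _ sfplane2 _ (fun p : plane * plane => pinv t * (`|f p.1| * `|f p.2|))).
  - apply: measurableT_comp; first exact: measurable_fruldiff.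
    exact: measurable_pair2.
  - move=> p; rewrite /fruldiff normrM [`|f _ * f _|]normrM mulrC ler_wpM2r ?mulr_ge0//.
    by apply: frul0_bound; exact: dot_ge0.
  - apply: (@mintZ R _ _ sfplane2); apply: (@mint_tensor R _ _ _ _ sfplane sfplane (fun x => `|f x|) (fun x => `|f x|)).
      by apply: mint_norm; exact: cc_mint.
    by apply: mint_norm; exact: cc_mint.
have [_ <-] := mint_prodl i.
have ig x : mint (fun y => f y * gauss2 t (x - y)).
  apply: cc_mint; apply: cc_mulr => //.
  apply: (@cont_comp _ _ _ (fun y : plane => x - y) (gauss2 t)); last exact: continuous_gauss2.
  by move=> y; apply: cvgB; [exact: cvg_cst|exact: cvg_id].
have ii : mint (fun x => f x * \int[mu2]_y (f y * gauss2 t (x - y))).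
  have h := cc_mint cf.
  have ck : continuous (fun p : plane * plane => gauss2 t (p.1 - p.2)).
    apply: (@cont_comp _ _ _ (fun p : plane * plane => p.1 - p.2) (gauss2 t)); last exact: continuous_gauss2.
    by move=> p; apply: cvgB; [exact: cvg_fst|exact: cvg_snd].
  have bk (p : plane * plane) : `|gauss2 t (p.1 - p.2)| <= 1.
    rewrite gauss2E ger0_norm ?expR_ge0// expR_le1 mulNr oppr_le0.
    by rewrite mulr_ge0 ?dot_ge0// ltW.
  by have [_ + _] := Rint_swap_bounded h h ck bk.
transitivity (\int[mu2]_x (pinv t * (f x * \int[mu2]_y (f y * gauss2 t (x - y))))); last first.
  by rewrite RintZ.
apply: Rint_ext2 => x.
have mF : @measurable_fun _ _ (measurableTypeR R * measurableTypeR R)%type (measurableTypeR R) setT (fun y => fruldiff f ((x, y), t)).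
  apply: (measurableT_comp (f := fun p : plane * plane => fruldiff f (p, t)) (g := fun y => (x, y))).
    exact: mint_meas i.
  exact: measurable_pair1.
transitivity (\int[mu2]_y (pinv t * f x * (f y * gauss2 t (x - y)) - pinv t * f x * expR (- t) * f y)).
  apply: (@Rint_off1 x) => //.
  - apply: mint_meas; apply: mintB; apply: mintZ; [exact: ig|exact: cc_mint].
  - move=> y yx; rewrite /fruldiff /frul0 /frul /= gauss2E.
    have -> : 0 < dot (x - y) (x - y).
      rewrite lt_neqAle dot_ge0 andbT eq_sym /dot -!expr2 paddr_eq0 ?sqr_ge0// !sqrf_eq0 /=.
      apply: contraNN yx; rewrite !subr_eq0 => /andP[/eqP h1 /eqP h2].
      by apply/eqP; move: h1 h2; case: (x) (y) => [? ?] [? ?] /= -> ->.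
    by rewrite mulNr (_ : true%:R = 1 :> R)//; ring.
rewrite RintB; [|by apply: mintZ|by apply: mintZ; exact: cc_mint].
  by rewrite RintZ// RintZ ?f0; [ring|exact: cc_mint].
Qed.

Lemma mint_kconv f g : cc f -> cc g -> mint (fun x => f x * kconv g x) /\
  mint (fun x => f x * - kconv g x).
Proof.
move=> cf cg; have cK := kconv_continuous cg.
by split; apply: cc_mint; apply: cc_mulr => //; exact: cont_opp.
Qed.

Lemma measurable_over_dot g : continuous g ->
  @measurable_fun _ _ (measurableTypeR R * measurableTypeR R)%type (measurableTypeR R) setT
    (fun xi => g xi / (2 * pi * dot xi xi)).
Proof.
move=> cg; apply: measurable_funM; first exact: continuous_measurable_plane.
rewrite (_ : (fun _ => _) = (fun xi => (2 * pi)^-1 * pinv (dot xi xi))).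
  apply: measurable_funM; first exact: measurable_cst.
  apply: (measurableT_comp measurable_pinv).
  by apply: continuous_measurable_plane; apply: continuous_dot; exact: cont_id.
apply/funext => xi; rewrite invfM; congr (_ * _).
have := dot_ge0 xi; rewrite le_eqVlt => /orP[/eqP<-|d0]; first by rewrite pinv0// invr0.
by rewrite pinvE.
Qed.

(** Frullani's formula for the squared distance turns twice the energy into an integral over [t] of
    Gaussian forms. Each of them has a nonnegative spectral density, so Tonelli allows integrating
    in [t] first, at fixed frequency. *)
Lemma energy_spectral f : cc f -> \int[mu2]_x f x = 0 ->
  ((energy f)%:E = \int[mu2]_xi (pspec f xi / (2 * pi * dot xi xi))%:E)%E.
Proof.
move=> cf f0.
have [ik ek] := mint_kern_tensor cf cf.
have fr (p : plane * plane) := frul0P (dot_ge0 (p.1 - p.2)).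
(* Integrating the absolute value in [t] returns the absolute logarithm of the squared distance, so
   joint integrability reduces to that of [f x * f y * kern (x - y)]. *)
have iF : (sfplane2 \x leb)%E.-integrable setT (EFin \o fruldiff f).
  apply: (@mint_prod R _ _ _ _ sfplane2 leb _ (fun p : plane * plane => 2 * `|f p.1 * f p.2 * kern (p.1 - p.2)|)).
  - exact: measurable_fruldiff.
  - by move=> p; have [h _ _] := fr p; have := mintZ (f p.1 * f p.2) h.
  - move=> p; rewrite (Rint_ext1 (g := fun t => `|f p.1 * f p.2| * `|frul0 (dot (p.1 - p.2) (p.1 - p.2)) t|)); last first.
      by move=> t; rewrite /fruldiff /= normrM.
    have [h1 _ h2] := fr p.
    rewrite RintZ; last exact: mint_norm.
    by rewrite h2 ln_dot !normrM (ger0_norm (ler0n _ 2)); lra.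
  - apply: mintZ; exact: mint_norm.
have [_ e1] := mint_prodl iF; have [i2 e2] := mint_prodr iF.
have E1 : \int[leb]_t (pinv t * gform t f) = 2 * energy f.
  rewrite (Rint_ext1 (g := fun t => \int[sfplane2]_p fruldiff f (p, t))); last first.
    by move=> t; rewrite -gform_frul.
  transitivity (\int[sfplane2]_p (- 2 * (f p.1 * f p.2 * kern (p.1 - p.2)))).
    rewrite e2 -e1; apply: Rint_ext => p; have [h1 h3 h2] := fr p; rewrite /fruldiff /=.
    by rewrite RintZ// h3 ln_dot; ring.
  rewrite RintZ// ek /energy mulNr -mulrN -RintN; last exact: (mint_kconv cf cf).1.
  by congr (_ * _); apply: Rint_ext2 => x; rewrite mulrN.
have i3 : leb.-integrable setT (EFin \o (fun t => pinv t * gform t f)).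
  by move: i2; congr (_.-integrable _ _); apply/funext => t /=; rewrite -gform_frul.
(* The density given by [gform_pspec] for [a = 1 / (4 t)]: its prefactor [a / pi] and the factor
   [1 / t] combine into [1 / (4 pi t^2)]. *)
pose G (q : R * plane) : \bar R := ((4 * pi)^-1 * (pinv q.1 ^+ 2 * expR (- (dot q.2 q.2 / 4 * pinv q.1)) * pspec f q.2))%:E.
have mG : measurable_fun setT (G : measurableTypeR R * (measurableTypeR R * measurableTypeR R) -> _).
  apply/measurable_EFinP; apply: measurable_funM; first exact: measurable_cst.
  apply: measurable_funM; last first.
    apply: (measurableT_comp (f := pspec f)); last exact: measurable_snd.
    by apply: continuous_measurable_plane; exact: pspec_continuous.
  have mp : measurable_fun setT (fun q : measurableTypeR R * (measurableTypeR R * measurableTypeR R) => pinv q.1 : measurableTypeR R).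
    by apply: (measurableT_comp measurable_pinv); exact: measurable_fst.
  apply: measurable_funM; first exact: measurable_funX.
  apply: (measurableT_comp (f := expR)); first exact: measurable_cont (@continuous_expR R).
  apply: measurable_funN; apply: measurable_funM => //; apply: measurable_funM; last exact: measurable_cst.
  apply: (measurableT_comp (f := fun z : plane => dot z z)); last exact: measurable_snd.
  by apply: continuous_measurable_plane; apply: continuous_dot; exact: cont_id.
have G0 q : (0 <= G q)%E.
  by rewrite lee_fin !mulr_ge0 ?expR_ge0 ?pspec_ge0 ?sqr_ge0// invr_ge0 mulr_ge0 ?pi_ge0.
have Et (t : R) : ((pinv t * gform t f)%:E = \int[mu2]_xi G (t, xi))%E.
  have [t0|t0] := leP t 0.
    rewrite pinv0// mul0r integral0_eq// => xi _.
    by rewrite /G /= pinv0// expr0n/= !mul0r mulr0.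
  have a0 : 0 < (4 * t)^-1 by rewrite invr_gt0 mulr_gt0.
  have ei : (4 * (4 * t)^-1)^-1 = t by field; rewrite gt_eqF.
  have ip : mint (fun xi => gauss2 (4 * t)^-1 xi * pspec f xi).
    apply: (mintM (K := 2 * l1 f ^+ 2)); last exact: (gauss2_int a0).1.
      by apply: continuous_measurable_plane; exact: pspec_continuous.
    by move=> xi; rewrite ger0_norm ?pspec_ge0// pspec_le.
  have := gform_pspec a0 cf; rewrite ei => ->.
  rewrite mulrA -RintZ// -Rint_EFin; last exact: mintZ.
  apply: eq_integral => xi _; rewrite /G /= gauss2E pinvE//; congr EFin.
  have -> : - (dot xi xi / 4 * t^-1) = - (4 * t)^-1 * dot xi xi by field; rewrite gt_eqF.
  set X := expR _; set Y := pspec _ _.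
  have e3 (p : R) : 0 < p -> t^-1 * ((4 * t)^-1 / p) * (X * Y) = (4 * p)^-1 * (t^-1 ^+ 2 * X * Y).
    by move=> p0; field; rewrite !gt_eqF.
  by rewrite e3// pi_gt0.
have Ef : ((2 * energy f)%:E = \int[mu2]_xi (2 * (pspec f xi / (2 * pi * dot xi xi)))%:E)%E.
  rewrite -E1 -Rint_EFin//.
  transitivity (\int[leb]_t \int[sfplane]_xi G (t, xi))%E.
    by apply: eq_integral => t _; rewrite Et.
  rewrite (@fubini_tonelli _ _ _ _ R leb sfplane G mG G0).
  apply: eq_integral => xi _.
  (* At the zero frequency the quotient on the right is 0 by convention; the left side vanishes too,
     because [pspec f 0] is the square of the integral of [f]. *)
  have [d0|d0] := eqVneq (dot xi xi) 0.
    have x0 : xi = 0.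
      move/eqP: d0; rewrite /dot -!expr2 paddr_eq0 ?sqr_ge0// !sqrf_eq0 => /andP[/eqP h1 /eqP h2].
      by move: h1 h2; case: (xi) => [? ?] /= -> ->.
    have p0 : pspec f xi = 0.
      have d1 (y : plane) : dot xi y = 0 by rewrite x0 /dot !mul0r addr0.
      rewrite /pspec /fcos /fsin (Rint_ext2 (g := f)); last by move=> y; rewrite d1 cos0 mulr1.
      rewrite f0 (Rint_ext2 (g := fun=> 0)); last by move=> y; rewrite d1 sin0 mulr0.
      by rewrite Rintegral_cst// mul0r expr0n addr0.
    by rewrite p0 mul0r mulr0 integral0_eq// => t _; rewrite /G /= p0 !mulr0.
  have c0 : 0 < dot xi xi / 4 by rewrite divr_gt0// lt_neqAle eq_sym d0 dot_ge0.
  have K0 : 0 <= (4 * pi)^-1 * pspec f xi by rewrite mulr_ge0 ?pspec_ge0// invr_ge0 mulr_ge0 ?pi_ge0.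
  transitivity (((4 * pi)^-1 * pspec f xi)%:E * \int[leb]_t (pinv t ^+ 2 * expR (- (dot xi xi / 4 * pinv t)))%:E)%E.
    rewrite -ge0_integralZl//.
    - by apply: eq_integral => t _; rewrite /G /= -EFinM; congr EFin; ring.
    - apply/measurable_EFinP; apply: measurable_funM; first by apply: measurable_funX; exact: measurable_pinv.
      apply: (measurableT_comp (f := expR)); first exact: measurable_cont (@continuous_expR R).
      by apply: measurable_funN; apply: measurable_funM; [exact: measurable_cst|exact: measurable_pinv].
    - by move=> t _; rewrite lee_fin mulr_ge0 ?expR_ge0 ?sqr_ge0.
  rewrite integral_inv_sqr_expR// -EFinM; congr EFin.
  have e3 (p D Y : R) : 0 < p -> D != 0 -> (4 * p)^-1 * Y * (D / 4)^-1 = 2 * (Y / (2 * p * D)).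
    by move=> p0 D0; field; rewrite D0 gt_eqF.
  by apply: e3 => //; exact: pi_gt0.
have m2 : measurable_fun setT (fun xi : measurableTypeR R * measurableTypeR R => (pspec f xi / (2 * pi * dot xi xi))%:E).
  by apply/measurable_EFinP; apply: measurable_over_dot; exact: pspec_continuous.
have n2 xi : (0 <= (pspec f xi / (2 * pi * dot xi xi))%:E)%E.
  by rewrite lee_fin divr_ge0 ?pspec_ge0// !mulr_ge0 ?pi_ge0 ?dot_ge0.
have : ((2%:E * (energy f)%:E) = 2%:E * \int[mu2]_xi (pspec f xi / (2 * pi * dot xi xi))%:E)%E.
  by rewrite -EFinM Ef -ge0_integralZl.
have half (z : \bar R) : ((2^-1 : R)%:E * (2%:E * z) = z)%E by rewrite muleA -EFinM mulVf// mul1e.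
by move=> /(congr1 (fun z => (2^-1)%:E * z)%E); rewrite !half.
Qed.

Lemma energy_ge0 f : cc f -> \int[mu2]_x f x = 0 -> 0 <= energy f.
Proof.
move=> cf f0; rewrite -lee_fin (energy_spectral cf f0); apply: integral_ge0 => xi _.
by rewrite lee_fin divr_ge0 ?pspec_ge0// !mulr_ge0 ?pi_ge0 ?dot_ge0.
Qed.

Definition cj (j : bool) xi : R := if j then xi.1 else xi.2.

Lemma is_derive_dot j xi x : is_derive x (ej j) (fun y => dot xi y) (cj j xi).
Proof.
apply/is_derive_line; case: j; rewrite /dot /=.
  have -> : (fun s : R => xi.1 * (s *: (1 : R) + x.1) + xi.2 * (s *: (0 : R) + x.2)) = (fun s => xi.1 * s + (xi.1 * x.1 + xi.2 * x.2)).
    by apply/funext => s; rewrite /GRing.scale/=; ring.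
  by apply: (dv_eq (dv_add (dv_mul (dv_cst xi.1 (0 : R) (1 : R)) (dv_id (0 : R))) (dv_cst _ (0 : R) (1 : R)))); ring.
have -> : (fun s : R => xi.1 * (s *: (0 : R) + x.1) + xi.2 * (s *: (1 : R) + x.2)) = (fun s => xi.2 * s + (xi.1 * x.1 + xi.2 * x.2)).
  by apply/funext => s; rewrite /GRing.scale/=; ring.
by apply: (dv_eq (dv_add (dv_mul (dv_cst xi.2 (0 : R) (1 : R)) (dv_id (0 : R))) (dv_cst _ (0 : R) (1 : R)))); ring.
Qed.

Lemma C1_trig xi (phi dphi : R -> R) : continuous phi -> continuous dphi ->
  (forall s, is_derive s (1 : R) phi (dphi s)) ->
  C1 (fun x => phi (dot xi x)) /\
  forall j, pd j (fun x => phi (dot xi x)) = (fun x => dphi (dot xi x) * cj j xi).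
Proof.
move=> cphi cdphi dphiE.
have cd : continuous (fun x => dot xi x) by apply: continuous_dot; [exact: cont_cst|exact: cont_id].
have [h1 h2] := @C1_intro R (fun x => dot xi x) (fun j _ => cj j xi) cd (fun j => @cont_cst _ _ (cj j xi)) (fun j x => is_derive_dot j xi x).
have [h3 h4] := C1_comp h1 cphi cdphi dphiE.
by split=> // j; rewrite h4 h2.
Qed.

Lemma pspec_pd j f xi : C1 f -> cc f -> pspec (pd j f) xi = cj j xi ^+ 2 * pspec f xi.
Proof.
move=> f1 cf; have cs := @continuous_cos R; have sn := @continuous_sin R.
have [c1 c2] := C1_trig xi cs (cont_opp sn) (@is_derive_cos R).
have [s1 s2] := C1_trig xi sn cs (@is_derive_sin R).
rewrite /pspec /fcos /fsin.
have e1 : \int[mu2]_x (pd j f x * cos (dot xi x)) = cj j xi * fsin f xi.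
  rewrite (Rint_ext2 (g := fun x => cos (dot xi x) * pd j f x)); last by move=> x; rewrite mulrC.
  have := Rint_parts j f1 c1 cf; rewrite c2 => /eqP; rewrite eq_sym eqr_oppLR => /eqP ->.
  rewrite /fsin -RintZ; last exact/cc_mint/cc_sin.
  rewrite -RintN; first by apply: Rint_ext2 => x; ring.
  have := mintZ (- cj j xi) (cc_mint (cc_sin xi cf)).
  by congr (_.-integrable _ _); apply/funext => x /=; congr EFin; ring.
have e2 : \int[mu2]_x (pd j f x * sin (dot xi x)) = - (cj j xi * fcos f xi).
  rewrite (Rint_ext2 (g := fun x => sin (dot xi x) * pd j f x)); last by move=> x; rewrite mulrC.
  have := Rint_parts j f1 s1 cf; rewrite s2 => /eqP; rewrite eq_sym eqr_oppLR => /eqP ->.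
  rewrite /fcos -RintZ; last exact/cc_mint/cc_cos.
  by congr (- _); apply: Rint_ext2 => x; ring.
by rewrite e1 e2 /fcos /fsin; ring.
Qed.

Lemma energy_pd_spectral j f : C1 f -> cc f ->
  ((energy (pd j f))%:E = \int[mu2]_xi (cj j xi ^+ 2 * pspec f xi / (2 * pi * dot xi xi))%:E)%E.
Proof.
move=> f1 cf; rewrite energy_spectral; [|exact: cc_pd|exact: Rint_pd].
by apply: eq_integral => xi _; rewrite pspec_pd.
Qed.

(** In frequency the derivative contributes [xi_j^2], and [xi_j^2 / |xi|^2 <= 1] leaves Plancherel's
    integral. *)
Lemma energy_pd_le j f : C1 f -> cc f -> energy (pd j f) <= 2 * pi * \int[mu2]_x (f x ^+ 2).
Proof.
move=> f1 cf; rewrite -lee_fin energy_pd_spectral//.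
have pi0 := @pi_gt0 R.
apply: (@le_trans _ _ (\int[mu2]_xi ((2 * pi)^-1%:E * (pspec f xi)%:E))%E).
  apply: ge0_le_integral => //.
  - move=> xi _; rewrite lee_fin; apply: divr_ge0.
      by apply: mulr_ge0; [exact: sqr_ge0|exact: pspec_ge0].
    by rewrite !mulr_ge0 ?pi_ge0 ?dot_ge0.
  - apply/measurable_EFinP; apply: measurable_over_dot; apply: cont_mul; last exact: pspec_continuous.
    by apply: cont_exp; rewrite /cj; case: (j); [apply: cont_fst|apply: cont_snd]; exact: cont_id.
  - apply/measurable_EFinP; apply: measurable_funM; first exact: measurable_cst.
    by apply: continuous_measurable_plane; exact: pspec_continuous.
  - move=> xi _; rewrite -EFinM lee_fin.
    have [d0|d0] := eqVneq (dot xi xi) 0.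
      by rewrite d0 mulr0 invr0 mulr0 mulr_ge0 ?pspec_ge0// invr_ge0 mulr_ge0// ltW.
    have dp : 0 < dot xi xi by rewrite lt_neqAle eq_sym d0 dot_ge0.
    rewrite ler_pdivrMr ?mulr_gt0//.
    have e3 (p D Y : R) : 0 < p -> (2 * p)^-1 * Y * (2 * p * D) = D * Y.
      by move=> p0; field; rewrite gt_eqF.
    rewrite e3// ler_wpM2r ?pspec_ge0// /cj /dot -!expr2.
    by case: j; rewrite ?lerDl ?lerDr sqr_ge0.
rewrite ge0_integralZl//.
- rewrite plancherel// -EFinM lee_fin le_eqVlt; apply/orP; left; apply/eqP.
  set I := Rintegral _ _ _.
  have e3 (p : R) : 0 < p -> (2 * p)^-1 * ((2 * p) ^+ 2 * I) = 2 * p * I.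
    by move=> p0; field; rewrite gt_eqF.
  exact: e3.
- by apply/measurable_EFinP; apply: continuous_measurable_plane; exact: pspec_continuous.
- by move=> xi _; rewrite lee_fin pspec_ge0.
- by rewrite lee_fin invr_ge0 mulr_ge0// ltW.
Qed.

Lemma kconv_sym f g : cc f -> cc g ->
  \int[mu2]_x (f x * kconv g x) = \int[mu2]_x (g x * kconv f x).
Proof.
move=> cf cg; have [i e1] := mint_kern_tensor cf cg; have [_ e2] := mint_prodr i.
rewrite -e1 -e2; apply: Rint_ext2 => y /=; rewrite /kconv -RintZ; last exact: (kconv_mint y cf).2.
apply: Rint_ext2 => x; rewrite (_ : kern (x - y) = kern (y - x)); first by ring.
by rewrite /kern /enorm /dot /=; congr (ln (Num.sqrt _)); ring.
Qed.

(** Polarization: the energy of [f + s g] is nonnegative for [s = 1] and [s = -1], and the kernel is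
    symmetric. *)
Lemma kconv_pairing f g : cc f -> cc g -> \int[mu2]_x f x = 0 -> \int[mu2]_x g x = 0 ->
  `|\int[mu2]_x (f x * kconv g x)| <= (energy f + energy g) / 2.
Proof.
move=> cf cg f0 g0.
have key (s : R) : s ^+ 2 = 1 -> 2 * s * \int[mu2]_x (f x * kconv g x) <= energy f + energy g.
  move=> s1; have csg := cc_scale s cg; have c := cc_add cf csg.
  have z : \int[mu2]_x (f x + s * g x) = 0.
    by rewrite RintD ?RintZ ?f0 ?g0 ?mulr0 ?addr0//; exact: cc_mint.
  have := energy_ge0 c z; rewrite /energy.
  have [i1 i1'] := mint_kconv cf cf; have [i2 i2'] := mint_kconv cf cg.
  have [i3 i3'] := mint_kconv cg cf; have [i4 i4'] := mint_kconv cg cg.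
  have j2 := mintZ (- s) i2; have j3 := mintZ (- s) i3.
  rewrite (Rint_ext2 (g := fun x => (f x * - kconv f x + g x * - kconv g x) +
      (- s * (f x * kconv g x) + - s * (g x * kconv f x)))); last first.
    move=> x; rewrite kconv_add// kconv_scale//.
    have alg (a b u d : R) : (a + s * b) * - (u + s * d) =
      a * - u + s ^+ 2 * (b * - d) + (- s * (a * d) + - s * (b * u)) by ring.
    by rewrite alg s1 mul1r.
  have j4 := mintD i1' i4'; have j5 := mintD j2 j3.
  rewrite RintD// RintD// RintD// RintZ// RintZ//.
  rewrite (kconv_sym cg cf).
  have alg (A B I : R) : 0 <= A + B + (- s * I + - s * I) -> 2 * s * I <= A + B by lra.
  exact: alg.
have h1 := key 1 (expr1n _ _); have h2 := key (-1) (sqrr_sign _ 1).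
rewrite ler_norml; move: (Rintegral _ _ _) (energy f) (energy g) h1 h2 => I A B h1 h2.
by apply/andP; split; lra.
Qed.

(** The L^2 boundedness of the double Riesz transforms in bilinear form. Moving [pd i] onto [h]
    leaves two first derivatives, which have zero mean, so the energy inequality applies and no
    singular kernel appears. *)
Lemma riesz_pairing i j (h w : plane -> R) : C1 h -> cc h -> C1 w -> cc w -> C1 (pd j w) ->
  `|\int[mu2]_x (h x * kconv (pd i (pd j w)) x)| <=
    pi * (\int[mu2]_x (h x ^+ 2) + \int[mu2]_x (w x ^+ 2)).
Proof.
move=> h1 ch w1 cw ww1; have cpw := cc_pd j w1 cw; have [k1 k2] := kconv_C1 ww1 cpw.
rewrite -k2 Rint_parts// normrN.
rewrite (Rint_ext2 (g := fun x => pd i h x * kconv (pd j w) x)); last by move=> x; rewrite mulrC.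
apply: (le_trans (kconv_pairing _ _ _ _)); [exact: cc_pd|by []|exact: Rint_pd|exact: Rint_pd|].
have := energy_pd_le i h1 ch; have := energy_pd_le j w1 cw.
have alg (A B p H W : R) : B <= 2 * p * W -> A <= 2 * p * H -> (A + B) / 2 <= p * (H + W).
  by move=> h2 h3; rewrite ler_pdivrMr//; lra.
exact: alg.
Qed.

End Energy.

(** * From a smooth solution to a flow on the whole time line *)

Section Within.
Context {R : realType} {V : normedModType R}.
Implicit Types (D : set V) (f g : V -> R) (z v : V).

Lemma within_near {T : Type} (F : set_system T) {FF : Filter F} (P : set T) :
  F P -> within P F = F.
Proof.
move=> FP; apply/seteqP; split=> A; rewrite /within/= => h; last by apply: filterS h.
by apply: filterS2 FP h => x Px; apply.
Qed.

Lemma quotient_within_near D f z v : (\forall h \near (0 : R), D (h *: v + z)) ->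
  quotient_within D f z v = (fun h : R => h^-1 * (f (h *: v + z) - f z)) @ 0^'.
Proof.
move=> near_D; rewrite /quotient_within within_near//; exact: nbhs_dnbhs.
Qed.

Lemma derive_within_near D f z v : (\forall h \near (0 : R), D (h *: v + z)) ->
  derive_within D f z v = 'D_v f z.
Proof. by move=> h; rewrite /derive_within quotient_within_near. Qed.

Lemma derivable_within_near D f z v : (\forall h \near (0 : R), D (h *: v + z)) ->
  derivable_within D f z v -> derivable f z v.
Proof. by move=> h; rewrite /derivable_within quotient_within_near. Qed.

Lemma eq_derive_within D f g z v : D z -> (forall y, D y -> f y = g y) ->
  derive_within D f z v = derive_within D g z v.
Proof.
move=> Dz fg; rewrite /derive_within /quotient_within; congr (lim _).
have key (f' g' : V -> R) (A : set R) : (forall y, D y -> f' y = g' y) ->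
    (\forall h \near 0^', D (h *: v + z) -> A (h^-1 * (f' (h *: v + z) - f' z))) ->
    \forall h \near 0^', D (h *: v + z) -> A (h^-1 * (g' (h *: v + z) - g' z)).
  move=> fg' hA; apply: filterS hA => h hA hD.
  by have := hA hD; rewrite (fg' z Dz) (fg' _ hD).
apply/seteqP; split=> A hA; first exact: key fg hA.
by apply: (key g f A _ hA) => y /fg ->.
Qed.

Lemma smooth_on_derive D f v : smooth_on D f ->
  smooth_on D (fun z => derive_within D f z v).
Proof.
move=> fs l; have := fs (rcons l v).
by rewrite /iter_derive foldr_rcons.
Qed.

Lemma within_continuous_comp {T : topologicalType} D f (phi : T -> V) :
  {within D, continuous f} -> continuous phi -> (forall t, D (phi t)) ->
  continuous (fun t => f (phi t)).
Proof.
move=> /subspace_continuousP cf cphi Dphi t.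
have h : phi @ nbhs t --> within D (nbhs (phi t)).
  move=> A hA; change (nbhs t (fun s => A (phi s))).
  apply: (filterS _ (cphi t _ hA : nbhs t (fun s => D (phi s) -> A (phi s)))) => s hs.
  exact: (hs (Dphi s)).
exact: cvg_trans (cvg_app f h) (cf _ (Dphi t)).
Qed.

End Within.

Section PlaneSmooth.
Context {R : realType}.
Local Notation plane := (R * R)%type.
Implicit Types (f : plane -> R).

Lemma smooth_C1 f : smooth_on setT f -> C1 f /\ forall j, smooth_on setT (pd j f).
Proof.
move=> fs; have nT (z v : plane) : \forall h \near (0 : R), setT (h *: v + z) by apply: filterE.
have pdE j : pd j f = fun z => derive_within setT f z (ej j).
  by apply/funext => z; rewrite derive_within_near.
have sj j : smooth_on setT (pd j f) by rewrite pdE; exact: smooth_on_derive.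
have sc (g : plane -> R) : smooth_on setT g -> continuous g.
  by move=> /(_ [::])[cg _]; apply: (within_continuous_comp (phi := fun x : plane => x) cg) => //; exact: cont_id.
split=> //; split; first exact: sc.
move=> j; split; last exact: sc.
move=> x; have [_ /(_ x (ej j) I)] := fs [::]; exact: derivable_within_near.
Qed.

Lemma Cc_smooth_cc f : Cc_smooth f -> cc f.
Proof.
move=> [/smooth_C1[[cf _] _] /compact_bounded[M [_ hM]]]; split=> //.
exists (M + 1) => x Mx; apply/eqP/negP => /negP fx.
have := hM (M + 1) (ltr_pwDr ltr01 (lexx _)) x (@subset_closure _ _ x fx).
by rewrite /= leNgt Mx.
Qed.

End PlaneSmooth.

(* Locked, since unification otherwise unfolds the convolution. *)
HB.lock Definition vel {R : realType} (b : bool) (f : R * R -> R) (x : R * R) : R :=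
  if b then (2 * pi)^-1 * kconv (pd false (pd true f)) x
  else - (2 * pi)^-1 * kconv (pd true (pd true f)) x.

Section Flow.
Context {R : realType}.
Local Notation leb := (@lebesgue_measure R).
Local Notation mu2 := (leb \x leb)%E.
Local Notation plane := (R * R)%type.

Lemma derive_slice (g : R * plane -> R) (t : R) (x v : plane) :
  'D_(0, v) g (t, x) = 'D_v (fun y => g (t, y)) x.
Proof.
rewrite /derive (_ : (fun h : R => _) =
  (fun h : R => h^-1 *: (((fun y => g (t, y)) \o shift x) (h *: v) - g (t, x))))//.
apply/funext => h; congr (_ *: (_ - _)).
by congr g; rewrite /shift/=; congr pair; rewrite /= scaler0 add0r.
Qed.

Lemma is_derive_time (g : R * plane -> R) (t : R) (x : plane) a :
  is_derive (t, x) (1, 0) g a -> is_derive t (1 : R) (fun s => g (s, x)) a.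
Proof.
have e : (fun h : R => h^-1 *: ((g \o shift (t, x)) (h *: ((1 : R), (0 : plane))) - g (t, x))) =
  (fun h : R => h^-1 *: (((fun s => g (s, x)) \o shift t) (h *: (1 : R)) - g (t, x))).
  apply/funext => h; congr (_ *: (_ - _)).
  by congr g; rewrite /shift/=; congr pair; rewrite /= scaler0 add0r.
by move=> -[dd dv]; split; move: dd dv; rewrite /derivable /derive e.
Qed.

Lemma velE b (f : plane -> R) x : vel b f x =
  if b then (2 * pi)^-1 * kconv (pd false (pd true f)) x
  else - (2 * pi)^-1 * kconv (pd true (pd true f)) x.
Proof. by rewrite unlock. Qed.

(* A solution whose time variable is extended to negative times by [rho t = rho 0]. *)
Record flow (r rt : R -> plane -> R) : Prop := Flow {
  flow_smooth : forall t, smooth_on setT (r t) ;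
  flow_cc : forall t, cc (r t) ;
  flow_cont : continuous (fun z : R * plane => r z.1 z.2) ;
  flow_cont1 : forall j, continuous (fun z : R * plane => pd j (r z.1) z.2) ;
  flow_cont2 : forall j k, continuous (fun z : R * plane => pd k (pd j (r z.1)) z.2) ;
  flow_cont_t : continuous (fun z : R * plane => rt z.1 z.2) ;
  flow_derive : forall (t : R) (x : plane), 0 < t -> is_derive t (1 : R) (fun s => r s x) (rt t x) ;
  flow_eq : forall t x, rt t x = - (vel true (r t) x * pd true (r t) x + vel false (r t) x * pd false (r t) x) ;
  flow_div : forall t x, pd true (vel true (r t)) x + pd false (vel false (r t)) x = 0
}.

(** The outer derivative of the potential is moved onto the density, so [vel] convolves second
    derivatives of the density with the undifferentiated kernel. *)
Lemma biot_savartE (f : plane -> R) x : smooth_on setT f -> cc f ->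
  biot_savart f x = (vel true f x, vel false f x).
Proof.
move=> fs cf; have [f1 fs1] := smooth_C1 fs; have [f11 _] := smooth_C1 (fs1 true).
have [k1 k2] := kconv_C1 f11 (cc_pd true f1 cf).
have [k3 k4] := C1_scale (- (2 * pi)^-1) k1.
rewrite /biot_savart !velE; congr pair; last first.
  by have := congr1 (fun g => g x) (k4 true); rewrite k2.
have := congr1 (fun g => g x) (k4 false); rewrite k2 /pd /= => e.
transitivity (- ('D_(ej false) (fun x0 : plane => - (2 * pi)^-1 * kconv (pd true f) x0) x)) => //.
by rewrite /pd /= e mulNr opprK.
Qed.

(** Clamping the time at 0 turns continuity up to the boundary into continuity on the whole line.
    Space directions never leave the half-space, so derivatives within it are ordinary ones along
    them; in time the derivative is two-sided only for [t > 0]. *)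
Lemma solution_flow (rho0 : plane -> R) (rho : R -> plane -> R) :
  global_smooth_solution rho0 rho -> exists rt, flow (fun t => rho (Num.max 0 t)) rt.
Proof.
move=> [smooth Cc _ [p ipm]].
pose F (z : R * plane) := rho z.1 z.2.
have c0 (t : R) : 0 <= Num.max 0 t by rewrite le_max lexx.
have near0 (z : R * plane) (v : plane) : 0 <= z.1 ->
    \forall h \near (0 : R), spacetime (h *: ((0 : R), v) + z).
  by move=> z0; apply: filterE => h; rewrite /spacetime /= scaler0 add0r.
have D0 (g : R * plane -> R) (t : R) x v : 0 <= t ->
    derive_within spacetime g (t, x) (0, v) = 'D_v (fun y => g (t, y)) x.
  move=> t0; rewrite derive_within_near; last exact: near0.
  exact: derive_slice.
have clampc : continuous (fun z : R * plane => (Num.max 0 z.1, z.2)).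
  apply: cont_pair; last by apply: cont_snd; exact: cont_id.
  by move=> z; apply: continuous_max; [exact: cvg_cst|exact: cvg_fst].
have cc_ (g : R * plane -> R) : smooth_on spacetime g ->
    continuous (fun z : R * plane => g (Num.max 0 z.1, z.2)).
  by move=> /(_ [::])[/within_continuous_comp h _]; apply: h clampc _ => t; exact: c0.
have s1 j := smooth_on_derive (0, ej j) smooth.
have e1 j (z : R * plane) : 0 <= z.1 -> derive_within spacetime F z (0, ej j) = pd j (rho z.1) z.2.
  by case: z => t x /= t0; rewrite D0.
exists (fun t x => derive_within spacetime F (Num.max 0 t, x) (1, 0)).
have fl t : smooth_on setT (rho (Num.max 0 t)) := (Cc _ (c0 t)).1.
have fc t : cc (rho (Num.max 0 t)) := Cc_smooth_cc (Cc _ (c0 t)).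
split=> //.
- exact: cc_ smooth.
- move=> j; rewrite (_ : (fun z => _) = (fun z : R * plane => derive_within spacetime F (Num.max 0 z.1, z.2) (0, ej j))).
    exact: (cc_ _ (s1 j)).
  by apply/funext => z; rewrite (e1 j (Num.max 0 z.1, z.2) (c0 _)).
- move=> j k; rewrite (_ : (fun z => _) = (fun z : R * plane =>
    derive_within spacetime (fun z => derive_within spacetime F z (0, ej j)) (Num.max 0 z.1, z.2) (0, ej k))).
    exact: (cc_ _ (smooth_on_derive (0, ej k) (s1 j))).
  apply/funext => z.
  have -> := @eq_derive_within R _ spacetime _ (fun z : R * plane => pd j (rho z.1) z.2)
    (Num.max 0 z.1, z.2) (0, ej k) (c0 _) (fun y hy => e1 j y hy).
  by rewrite D0//; exact: c0.
- have h := @smooth_on_derive R (R * plane)%type spacetime F ((1 : R), (0 : plane)) smooth.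
  exact: (cc_ _ h).
- move=> t x t0; have et : Num.max 0 t = t by apply/max_idPr/ltW.
  have nr : \forall h \near (0 : R), spacetime (h *: ((1 : R), (0 : plane)) + (t, x)).
    apply/nbhs_ballP; exists t => //= h; rewrite /ball/= sub0r normrN => /ltW.
    by rewrite /spacetime /= /GRing.scale/= mulr1 ler_norml => /andP[+ _]; rewrite -subr_ge0 opprK.
  have := derivable_within_near nr ((smooth [::]).2 (t, x) (1, 0) (ltW t0)).
  rewrite et derive_within_near// => dF.
  apply: (@near_eq_is_derive _ _ _ (fun s => rho s x)) (is_derive_time (derivableP dF)).
  apply/nbhs_ballP; exists t => //= s; rewrite /ball/= => /ltW; rewrite ler_distl => /andP[_ h].
  by congr (rho _ x); apply/esym/max_idPr; move: h; rewrite lerDr.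
- move=> t x; have [e _ _ _ _] := ipm _ x (c0 t).
  by rewrite biot_savartE// in e; move: e => /= e; apply/eqP; rewrite -addr_eq0 addrA; apply/eqP.
- move=> t x; have [_ e _ _ _] := ipm _ x (c0 t).
  rewrite /= in e; have h1 : (fun y => vel true (rho (Num.max 0 t)) y) = (fun y => (biot_savart (rho (Num.max 0 t)) y).1).
    by apply/funext => y; rewrite biot_savartE.
  have h2 : (fun y => vel false (rho (Num.max 0 t)) y) = (fun y => (biot_savart (rho (Num.max 0 t)) y).2).
    by apply/funext => y; rewrite biot_savartE.
  by move: e; rewrite -h1 -h2.
Qed.

End Flow.

(** * Truncations of the positive part and radial cutoffs *)

Section PositivePart.
Context {R : realType}.
Implicit Types s r : R.

(** Settles differentiability at the points where a function defined by cases is glued. *)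
Lemma is_derive_quadratic (F : R -> R) (s a K : R) :
  (forall h, `|F (h + s) - F s - a * h| <= K * h ^+ 2) -> is_derive s (1 : R) F a.
Proof.
move=> FK.
have h : (fun h : R => h^-1 *: ((F \o shift s) (h *: (1 : R)) - F s)) @ 0^' --> a.
  apply/cvgrPdist_le => /= e e0; have K0 : 0 < `|K| + 1 by rewrite ltr_wpDl.
  near=> h; have h0 : h != 0 by near: h; exact: nbhs_dnbhs_neq.
  rewrite /shift/= /GRing.scale/= mulr1.
  have -> : a - h^-1 * (F (h + s) - F s) = - (h^-1 * (F (h + s) - F s - a * h)) by field.
  rewrite normrN normrM normfV ler_pdivrMl ?normr_gt0//.
  apply: (le_trans (FK h)).
  rewrite (_ : K * h ^+ 2 = `|h| * (K * `|h|)); last first.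
    by have -> : h ^+ 2 = `|h| ^+ 2 by [rewrite real_normK ?num_real]; ring.
  rewrite ler_wpM2l//.
  have he : `|h| <= e / (`|K| + 1).
    near: h; apply: nbhs_dnbhs; apply/nbhs_ballP; exists (e / (`|K| + 1)); first exact: divr_gt0.
    by move=> h; rewrite /ball/= sub0r normrN => /ltW.
  apply: (le_trans (y := (`|K| + 1) * `|h|)).
    by rewrite ler_wpM2r// (le_trans (ler_norm K))// lerDl.
  by rewrite mulrC -ler_pdivlMr.
by apply: DeriveDef; [apply/cvg_ex; exists a|exact: cvg_lim h].
Unshelve. all: by end_near. Qed.

Definition pos1 s : R := Num.max 0 s.
Definition sq0 s : R := pos1 s ^+ 2.
(** The cube of the positive part, of class C^2, written so that the product rule applies. *)
Definition pos3 s : R := s * sq0 s.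

Lemma pos1_ge0 s : 0 <= pos1 s. Proof. by rewrite le_max lexx. Qed.
Lemma pos1E s : 0 <= s -> pos1 s = s. Proof. by move/max_idPr. Qed.
Lemma pos1_le0 s : s <= 0 -> pos1 s = 0. Proof. by move/max_idPl. Qed.

Lemma continuous_pos1 : continuous pos1.
Proof. by move=> s; apply: continuous_max; [exact: cvg_cst|exact: cvg_id]. Qed.

Lemma continuous_sq0 : continuous sq0.
Proof. by apply: cont_exp; exact: continuous_pos1. Qed.

Lemma sq0_ge0 s : 0 <= sq0 s. Proof. exact: sqr_ge0. Qed.
Lemma sq0_le0 s : s <= 0 -> sq0 s = 0.
Proof. by move=> s0; rewrite /sq0 pos1_le0// expr0n. Qed.
Lemma sq0_le1 s : s <= 1 -> sq0 s <= 1.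
Proof. by move=> s1; rewrite expr_le1 ?pos1_ge0// /pos1 ge_max ler01. Qed.

Lemma is_derive_sq0 s : is_derive s (1 : R) sq0 (2 * pos1 s).
Proof.
apply: (@is_derive_quadratic _ _ _ 1) => h; rewrite mul1r /sq0 ler_norml.
have [s0|s0] := leP 0 s; have [t0|t0] := leP 0 (h + s);
  rewrite ?(pos1E s0) ?(pos1E t0) ?(pos1_le0 (ltW s0)) ?(pos1_le0 (ltW t0)); nra.
Qed.

Lemma is_derive_pos3 s : is_derive s (1 : R) pos3 (3 * sq0 s).
Proof.
apply: (dv_eq (dv_mul (dv_id s) (is_derive_sq0 s))).
have [s0|/ltW s0] := leP 0 s; rewrite /sq0 ?(pos1E s0) ?(pos1_le0 s0); ring.
Qed.

Lemma continuous_pos3 : continuous pos3.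
Proof. by apply: cont_mul; [exact: cont_id|exact: continuous_sq0]. Qed.

Lemma pos3_ge0 s : 0 <= pos3 s.
Proof.
have [s0|/ltW s0] := leP 0 s; first by rewrite mulr_ge0 ?sq0_ge0.
by rewrite /pos3 sq0_le0// mulr0.
Qed.

Lemma pos3_le0 s : s <= 0 -> pos3 s = 0.
Proof. by move=> s0; rewrite /pos3 sq0_le0// mulr0. Qed.

Lemma pos3_ge1 s : 1 <= s -> 1 <= pos3 s.
Proof.
move=> s1; rewrite /pos3 /sq0 pos1E; last exact: le_trans s1.
by rewrite -exprS exprn_ege1.
Qed.

Lemma pos3_le1 s : s <= 1 -> pos3 s <= 1.
Proof.
move=> s1; have [s0|/ltW/pos3_le0->//] := leP 0 s.
by rewrite /pos3 mulr_ile1 ?sq0_ge0 ?sq0_le1.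
Qed.

(* A C^2 step from 1 on [s <= 0] to 0 on [s >= 1]. *)
Definition step s : R := pos3 (1 - pos3 s).
Definition dstep s : R := - (9 * (sq0 (1 - pos3 s) * sq0 s)).
Definition ddstep s : R := - (9 * (sq0 (1 - pos3 s) * (2 * pos1 s) +
  sq0 s * (2 * pos1 (1 - pos3 s) * - (3 * sq0 s)))).

Lemma step_ge0 s : 0 <= step s. Proof. exact: pos3_ge0. Qed.

Lemma step_le1 s : step s <= 1.
Proof. by rewrite pos3_le1// lerBlDr lerDl pos3_ge0. Qed.

Lemma step_eq1 s : s <= 0 -> step s = 1.
Proof.
by move=> s0; rewrite /step [pos3 s]pos3_le0// subr0 /pos3 /sq0 pos1E// expr1n mulr1.
Qed.

Lemma step_eq0 s : 1 <= s -> step s = 0.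
Proof. by move=> s1; rewrite /step pos3_le0// subr_le0 pos3_ge1. Qed.

Lemma dstep_eq0 s : 1 <= s -> dstep s = 0.
Proof.
by move=> s1; rewrite /dstep [sq0 (_ - _)]sq0_le0 ?subr_le0 ?pos3_ge1// mul0r mulr0 oppr0.
Qed.

Lemma dstep_le0 s : dstep s <= 0.
Proof. by rewrite /dstep oppr_le0; apply: mulr_ge0 => //; apply: mulr_ge0; exact: sq0_ge0. Qed.

Lemma dstep_le s : `|dstep s| <= 9.
Proof.
have [/dstep_eq0->|/ltW s1] := leP 1 s; first by rewrite normr0.
have p1 : sq0 (1 - pos3 s) <= 1 by rewrite sq0_le1// lerBlDr lerDl pos3_ge0.
have p0 := mulr_ge0 (sq0_ge0 (1 - pos3 s)) (sq0_ge0 s).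
have p2 := mulr_ile1 (sq0_ge0 (1 - pos3 s)) (sq0_ge0 s) p1 (sq0_le1 s1).
by rewrite /dstep normrN ger0_norm; lra.
Qed.

Lemma is_derive_step_arg s : is_derive s (1 : R) (fun t => 1 - pos3 t) (- (3 * sq0 s)).
Proof. by apply: (dv_eq (dv_sub (dv_cst 1 s (1 : R)) (is_derive_pos3 s))); ring. Qed.

Lemma is_derive_step s : is_derive s (1 : R) step (dstep s).
Proof.
apply: (dv_eq (dv_comp (g := fun t => 1 - pos3 t) (is_derive_pos3 _) (is_derive_step_arg s))).
by rewrite /dstep; ring.
Qed.

Lemma is_derive_dstep s : is_derive s (1 : R) dstep (ddstep s).
Proof.
have d := dv_comp (g := fun t => 1 - pos3 t) (is_derive_sq0 _) (is_derive_step_arg s).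
have d2 := dv_mul d (is_derive_sq0 s).
by apply: (dv_eq (dv_opp (dv_mul (dv_cst 9 s (1 : R)) d2))); rewrite /ddstep; ring.
Qed.

Lemma continuous_step_arg (g : R -> R) : continuous g -> continuous (fun s => g (1 - pos3 s)).
Proof.
move=> cg; apply: (@cont_comp _ _ _ (fun s : R => 1 - pos3 s) g) => //.
by apply: cont_sub; [exact: cont_cst|exact: continuous_pos3].
Qed.

Lemma continuous_step : continuous step.
Proof. exact: continuous_step_arg continuous_pos3. Qed.

Lemma continuous_dstep : continuous dstep.
Proof.
apply: cont_opp; apply: cont_mul; first exact: cont_cst.
by apply: cont_mul; [exact: continuous_step_arg continuous_sq0|exact: continuous_sq0].
Qed.

Lemma continuous_ddstep : continuous ddstep.
Proof.
have c2 := cont_mul (@cont_cst _ _ (2 : R)) continuous_pos1.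
have c3 := cont_mul (@cont_cst _ _ (3 : R)) continuous_sq0.
apply: cont_opp; apply: cont_mul; first exact: cont_cst.
apply: cont_add; first by apply: cont_mul => //; exact: continuous_step_arg continuous_sq0.
apply: cont_mul; first exact: continuous_sq0.
by apply: cont_mul; [exact: continuous_step_arg c2|exact: cont_opp].
Qed.

End PositivePart.

Section Cutoff.
Context {R : realType}.
Local Notation plane := (R * R)%type.
Implicit Types (x : plane) (c b : R).

Lemma continuous_cj j : continuous (@cj R j).
Proof. by case: j; [apply: cont_fst|apply: cont_snd]; exact: cont_id. Qed.

Lemma C1_cj j : C1 (@cj R j) /\ forall k, pd k (@cj R j) = fun=> (j == k)%:R.
Proof.
apply: (@C1_intro R (@cj R j) (fun k _ => (j == k)%:R)).
- exact: continuous_cj.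
- by move=> k; exact: cont_cst.
- move=> k x; have := is_derive_dot k (ej j) x.
  have -> : (fun y => dot (ej j) y) = @cj R j.
    by apply/funext => y; rewrite /dot /cj; case: j; rewrite /= ?(mul0r, mul1r, addr0, add0r).
  by move=> d; apply: (dv_eq d); rewrite /cj; case: (k); case: (j).
Qed.

Lemma C1_dot c b : C1 (fun x : plane => c * dot x x - b) /\
  forall j, pd j (fun x : plane => c * dot x x - b) = fun x => 2 * c * cj j x.
Proof.
apply: (@C1_intro R _ (fun j x => 2 * c * cj j x)).
- apply: cont_sub; last exact: cont_cst.
  by apply: cont_mul; [exact: cont_cst|apply: continuous_dot; exact: cont_id].
- by move=> j; apply: cont_mul; [exact: cont_cst|exact: continuous_cj].
- move=> j x.
  have [h1 h2] := C1_cj true; have [h3 h4] := C1_cj false.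
  have d1 := C1_is_derive j x h1; have d2 := C1_is_derive j x h3.
  apply: (dv_eq (dv_sub (dv_mul (dv_cst c x (ej j)) (dv_add (dv_mul d1 d1) (dv_mul d2 d2))) (dv_cst b x (ej j)))).
  by rewrite h2 h4 /cj; case: j {d1 d2} => /=; ring.
Qed.

(** Radial cutoff, equal to 1 for [c |x|^2 <= b] and to 0 for [c |x|^2 >= b + 1]. The parameters
    [q^-2] and 1 give a fixed profile at scale [q]; [c = 1] with [b] growing in time gives an
    expanding ball. *)
Definition cut c b x : R := step (c * dot x x - b).
Definition dcut c b j x : R := dstep (c * dot x x - b) * (2 * c * cj j x).

Lemma C1_cut c b : C1 (cut c b) /\ forall j, pd j (cut c b) = dcut c b j.
Proof.
have [h1 h2] := C1_dot c b.
have [h3 h4] := C1_comp h1 (@continuous_step R) (@continuous_dstep R) (@is_derive_step R).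
by split=> // j; rewrite h4 h2.
Qed.

Lemma C1_dcut c b j : C1 (dcut c b j).
Proof.
have [h1 h2] := C1_dot c b.
have [h3 _] := C1_comp h1 (@continuous_dstep R) (@continuous_ddstep R) (@is_derive_dstep R).
have [h4 _] := C1_cj j; have [h5 _] := C1_scale (2 * c) h4.
by have [] := C1_mul h3 h5.
Qed.

Lemma cut_ge0 c b x : 0 <= cut c b x. Proof. exact: step_ge0. Qed.
Lemma cut_le1 c b x : cut c b x <= 1. Proof. exact: step_le1. Qed.

Lemma cut_eq1 c b x : c * dot x x <= b -> cut c b x = 1.
Proof. by move=> h; rewrite /cut step_eq1// subr_le0. Qed.

Lemma norm_sqr_le_dot x : `|x| ^+ 2 <= dot x x.
Proof.
have h : `|x| <= Num.max `|x.1| `|x.2| by rewrite plane_norm_le !le_max !lexx orbT.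
have [e1 e2] : `|x.1| ^+ 2 = x.1 ^+ 2 /\ `|x.2| ^+ 2 = x.2 ^+ 2 by rewrite !real_normK ?num_real.
have := normr_ge0 x; move: h; rewrite /dot -!expr2 -e1 -e2.
have := normr_ge0 x.1; have := normr_ge0 x.2; have [_|_] := leP `|x.1| `|x.2|; nra.
Qed.

Lemma dot_le_norm_sqr x : dot x x <= 2 * `|x| ^+ 2.
Proof.
have := lexx `|x|; rewrite plane_norm_le => /andP[h1 h2].
rewrite /dot -!expr2 mulr_natl mulr2n; apply: lerD.
  by rewrite -[x.1 ^+ 2]real_normK ?num_real// lerXn2r ?nnegrE.
by rewrite -[x.2 ^+ 2]real_normK ?num_real// lerXn2r ?nnegrE.
Qed.

Lemma cut_eq0 c b x : b + 1 <= c * `|x| ^+ 2 -> 0 <= c -> cut c b x = 0 /\ forall j, dcut c b j x = 0.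
Proof.
move=> h c0; have h2 : 1 <= c * dot x x - b.
  by rewrite lerBrDr addrC (le_trans h)// ler_wpM2l// norm_sqr_le_dot.
by rewrite /cut /dcut step_eq0// dstep_eq0//; split=> // j; rewrite mul0r.
Qed.

Lemma cc_cut c b : 0 < c -> cc (cut c b).
Proof.
move=> c0; split; first by have [[]] := C1_cut c b.
exists (`|(b + 1) / c| + 1) => x Mx; have [|//] := @cut_eq0 c b x _ (ltW c0).
have h0 : 0 <= `|(b + 1) / c| + 1 by rewrite addr_ge0.
rewrite -ler_pdivrMl// mulrC (le_trans (ler_norm _))//.
apply: (le_trans _ (_ : (`|(b + 1) / c| + 1) ^+ 2 <= _)).
  by have := normr_ge0 ((b + 1) / c); nra.
by rewrite lerXn2r ?nnegrE ?ltW// (le_lt_trans h0).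
Qed.

Lemma cut_radius (r : R) x : 0 < r -> r ^+ 2 <= `|x| ^+ 2 / 2 -> forall j, dcut (r ^- 2) 1 j x = 0.
Proof.
move=> r0 h; apply: (@cut_eq0 (r ^- 2) 1 x _ _).2.
  by rewrite mulrC ler_pdivlMr ?exprn_gt0//; lra.
by rewrite invr_ge0 exprn_ge0// ltW.
Qed.

(** The derivative of [step] is at most 9, the inner one is [2 r^-2 x_j], and [|x| <= 2 r] on the
    support, whence 9 * 2 * 2. *)
Lemma dcut_le (r : R) j x : 0 < r -> `|dcut (r ^- 2) 1 j x| <= 36 / r.
Proof.
move=> r0; have [h|h] := leP (r ^+ 2) (`|x| ^+ 2 / 2).
  by rewrite (cut_radius r0 h) normr0 divr_ge0// ltW.
have xr : `|x| <= 2 * r.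
  rewrite -(@ler_pXn2r _ 2) ?nnegrE// ?mulr_ge0 ?(ltW r0)//.
  by rewrite exprMn; nra.
have cx : `|cj j x| <= 2 * r.
  by apply: le_trans xr; have := lexx `|x|; rewrite plane_norm_le /cj => /andP[]; case: j.
rewrite /dcut normrM (_ : 36 / r = 9 * (2 * r ^- 2 * (2 * r))); last by field; rewrite gt_eqF.
have c0 : 0 <= 2 * r ^- 2 by rewrite mulr_ge0// invr_ge0 exprn_ge0// ltW.
apply: ler_pM => //; first exact: dstep_le.
by rewrite normrM (ger0_norm c0) ler_wpM2l.
Qed.

End Cutoff.

(** * Integration in time *)

Section TimeIntegral.
Context {R : realType}.
Local Notation leb := (@lebesgue_measure R).
Local Notation mu2 := (leb \x leb)%E.
Local Notation plane := (R * R)%type.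
Local Notation mint1 f := (leb.-integrable setT (EFin \o f)).
Local Notation ind a b := (\1_(`[a, b]%classic : set R)).

Lemma Rint_FTC_oo (F f : R -> R) (a b : R) : a < b -> continuous F -> continuous f ->
  (forall s : R, a < s < b -> is_derive s (1 : R) F (f s)) ->
  \int[leb]_s (f s * ind a b s) = F b - F a.
Proof.
move=> ab cF cf dF.
transitivity (\int[leb]_(s in `[a, b]) f s).
  rewrite [RHS]Rintegral_mkcond; apply: Rint_ext1 => s.
  by rewrite patchE indicE; case: ifPn => _; rewrite ?mulr1 ?mulr0.
rewrite /Rintegral (@continuous_FTC2 _ _ F)//.
- exact: continuous_subspaceT.
- split; first by move=> s; rewrite in_itv/= => h; exact: (ex_derive (is_derive := dF s h)).
  + by apply: cvg_at_right_filter; exact: cF.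
  + by apply: cvg_at_left_filter; exact: cF.
- by move=> s; rewrite in_itv/= => h; rewrite derive1E; exact: (derive_val (is_derive := dF s h)).
Qed.

Lemma slice_time (F : R -> plane -> R) (x : plane) :
  continuous (fun z : R * plane => F z.1 z.2) -> continuous (F ^~ x).
Proof.
move=> cF; apply: (@cont_comp _ _ _ (fun t : R => (t, x)) (fun z : R * plane => F z.1 z.2)) => //.
by apply: cont_pair; [exact: cont_id|exact: cont_cst].
Qed.

Lemma slice_space (F : R -> plane -> R) (t : R) :
  continuous (fun z : R * plane => F z.1 z.2) -> continuous (F t).
Proof.
move=> cF; apply: (@cont_comp _ _ _ (fun x : plane => (t, x)) (fun z : R * plane => F z.1 z.2)) => //.
by apply: cont_pair; [exact: cont_cst|exact: cont_id].
Qed.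

Lemma cylinder_bounded (F : R -> plane -> R) (a b M : R) :
  continuous (fun z : R * plane => F z.1 z.2) ->
  exists K, 0 < K /\ forall t x, a <= t <= b -> `|x| <= M -> `|F t x| <= K.
Proof.
move=> cF.
have K : compact (`[a, b]%classic `*` [set x : plane | `|x| <= M]).
  by apply: compact_setX; [exact: segment_compact|exact: compact_box].
have [C [C0 hC]] := compact_bounded_fun cF K.
exists C; split=> // t x tab xM; apply: (hC (t, x)); split=> //=; rewrite in_itv.
Qed.

Definition sfspacetime :=
  HB.pack_for {sigma_finite_measure set (measurableTypeR R * (measurableTypeR R * measurableTypeR R))%type -> \bar R}
  (leb \x @sfplane R)%E
  (Measure.on (leb \x @sfplane R)%E)
  (lebesgue_integral_fubini.measure_function_Measure_isSigmaFinite__to__measure_function_isSFinite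
    leb (@sfplane R))
  (lebesgue_integral_fubini.measure_function_Measure_isSigmaFinite__to__measure_function_isSigmaFinite
    leb (@sfplane R)).

Lemma mint_ind_time (G : R -> plane -> R) (a b M K : R) :
  continuous (fun z : R * plane => G z.1 z.2) ->
  (forall t x, a <= t <= b -> M < `|x| -> G t x = 0) ->
  (forall t x, a <= t <= b -> `|x| <= M -> `|G t x| <= K) -> 0 <= K ->
  (leb \x sfplane)%E.-integrable setT (EFin \o (fun z : R * plane => G z.1 z.2 * ind a b z.1)).
Proof.
move=> cG G0 GK K0.
apply: (@mint_le R _ _ sfspacetime _ (fun z : R * plane => K * (ind a b z.1 * ibox M z.2))).
- apply: measurable_funM; first exact: continuous_measurable_spacetime.
  by apply: (measurableT_comp (mint_meas (mint_itv a b))); exact: measurable_fst.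
- move=> [t x] /=; rewrite indicE mem_setE in_itv/= iboxE.
  have [tab|_] := boolP (a <= t <= b); last by rewrite !(mulr0, mul0r) normr0.
  rewrite mulr1 mul1r; have [xM|xM] := leP `|x| M; first by rewrite mulr1 GK.
  by rewrite G0// normr0 mulr0.
- apply: (@mintZ R _ _ sfspacetime); apply: (@mint_tensor R _ _ _ _ leb sfplane (ind a b) (ibox M)); [exact: mint_itv|exact: mint_ibox].
Qed.

(** Fubini and the fundamental theorem at each fixed point of space. The integrated form asks for
    the time derivative only inside []a, b[], so it applies from the initial time on. *)
Lemma Rint_time_derive (F Ft : R -> plane -> R) (a b M : R) : a < b ->
  continuous (fun z : R * plane => F z.1 z.2) ->
  continuous (fun z : R * plane => Ft z.1 z.2) ->
  (forall t x, a <= t <= b -> M < `|x| -> F t x = 0 /\ Ft t x = 0) ->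
  (forall (t : R) (x : plane), a < t < b -> is_derive t (1 : R) (F ^~ x) (Ft t x)) ->
  mint1 (fun t => (\int[mu2]_x Ft t x) * ind a b t) /\
  \int[leb]_t ((\int[mu2]_x Ft t x) * ind a b t) = \int[mu2]_x F b x - \int[mu2]_x F a x.
Proof.
move=> ab cF cFt F0 dF.
have [K [K0 FK]] := cylinder_bounded a b M cFt.
have ii := mint_ind_time cFt (fun t x h1 h2 => (F0 t x h1 h2).2) FK (ltW K0).
have cct t : a <= t <= b -> cc (F t) /\ cc (Ft t).
  by move=> tab; split; split; [exact: slice_space|exists M => x /(F0 t x tab)[]
    |exact: slice_space|exists M => x /(F0 t x tab)[]].
have e t : \int[sfplane]_x (Ft t x * ind a b t) = (\int[mu2]_x Ft t x) * ind a b t.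
  rewrite indicE mem_setE in_itv/=; have [tab|_] := boolP (a <= t <= b); last first.
    by rewrite mulr0 (Rint_ext2 (g := fun=> 0)) ?Rintegral_cst ?mul0r// => x; rewrite mulr0.
  by rewrite mulr1; apply: Rint_ext2 => x; rewrite mulr1.
have [i1 e1] := mint_prodl ii; have [_ e2] := mint_prodr ii.
have i1' : mint1 (fun t => (\int[mu2]_x Ft t x) * ind a b t).
  by move: i1; congr (_.-integrable _ _); apply/funext => t /=; rewrite -e.
split=> //; rewrite -(Rint_ext1 e) e1 -e2.
rewrite -RintB; [|by apply: cc_mint; apply: (cct b _).1; rewrite lexx ltW
  |by apply: cc_mint; apply: (cct a _).1; rewrite lexx ltW].
apply: Rint_ext2 => x.
have cs := slice_time (x := x) cF; have cst := slice_time (x := x) cFt.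
by have := Rint_FTC_oo ab cs cst (fun s => dF s x).
Qed.

Lemma Rint_ind_time (a b : R) : a < b -> \int[leb]_t ind a b t = b - a.
Proof.
move=> ab; have := Rint_FTC_oo ab (@cont_id R) (@cont_cst _ _ (1 : R)) (fun s _ => dv_id s).
by under eq_Rintegral do rewrite mul1r.
Qed.

Lemma Rint_time_le (f : R -> R) (a b C : R) : a < b -> mint1 (fun t => f t * ind a b t) ->
  (forall t, a <= t <= b -> f t <= C) -> \int[leb]_t (f t * ind a b t) <= C * (b - a).
Proof.
move=> ab fi fC; rewrite -(Rint_ind_time ab) -RintZ; last exact: mint_itv.
apply: Rint_le => //; first by apply: mintZ; exact: mint_itv.
move=> t; rewrite indicE mem_setE in_itv/=; case: (boolP (a <= t <= b)) => [/fC|_]; by rewrite ?mulr1 ?mulr0.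
Qed.

Lemma Rint_time_ge (f : R -> R) (a b C : R) : a < b -> mint1 (fun t => f t * ind a b t) ->
  (forall t, a <= t <= b -> C <= f t) -> C * (b - a) <= \int[leb]_t (f t * ind a b t).
Proof.
move=> ab fi fC; rewrite -(Rint_ind_time ab) -RintZ; last exact: mint_itv.
apply: Rint_le => //; first by apply: mintZ; exact: mint_itv.
move=> t; rewrite indicE mem_setE in_itv/=; case: (boolP (a <= t <= b)) => [/fC|_]; by rewrite ?mulr1 ?mulr0.
Qed.

End TimeIntegral.

Lemma adv_cut_const_le {R : realType} (c m B q : R) : 0 <= c -> 0 < q -> m <= B ->
  (1296 * c + 1) * m / q <= (1296 * c + 1) * B / q.
Proof.
move=> c0 q0 mB; apply: ler_wpM2r; first by rewrite invr_ge0 ltW.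
by apply: ler_wpM2l mB; apply: addr_ge0 ler01; apply: mulr_ge0 c0; exact: ler0n.
Qed.

(** * Transport by the velocity and conservation laws *)

Section Transport.
Context {R : realType}.
Local Notation leb := (@lebesgue_measure R).
Local Notation mu2 := (leb \x leb)%E.
Local Notation plane := (R * R)%type.
Local Notation mint f := (mu2.-integrable setT (EFin \o f)).

Variables (r rt : R -> plane -> R).
Hypothesis fl : flow r rt.

Definition adv (t : R) (f : plane -> R) (x : plane) : R :=
  vel true (r t) x * pd true f x + vel false (r t) x * pd false f x.

Lemma C1_vel b (f : plane -> R) : smooth_on setT f -> cc f -> C1 (vel b f).
Proof.
move=> fs cf; have [f1 fs1] := smooth_C1 fs; have cf1 := cc_pd true f1 cf.
have [f11 fs11] := smooth_C1 (fs1 true).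
have h j : C1 (kconv (pd j (pd true f))).
  by have [g1 _] := smooth_C1 (fs11 j); have [] := kconv_C1 g1 (cc_pd j f11 cf1).
case: b; [have [g _] := C1_scale (2 * pi)^-1 (h false)|have [g _] := C1_scale (- (2 * pi)^-1) (h true)];
  by move: g; congr C1; apply/funext => x; rewrite velE.
Qed.

Lemma flow_C1 t : C1 (r t). Proof. exact: (smooth_C1 (flow_smooth fl t)).1. Qed.
Lemma flow_C1_pd t j : C1 (pd j (r t)).
Proof. by have [_ h] := smooth_C1 (flow_smooth fl t); have [] := smooth_C1 (h j). Qed.
Lemma flow_C1_vel t b : C1 (vel b (r t)).
Proof. by apply: C1_vel; [exact: (flow_smooth fl)|exact: (flow_cc fl)]. Qed.

Lemma adv_continuous t (f : plane -> R) : C1 f -> continuous (adv t f).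
Proof.
move=> [_ hf]; have v b := (flow_C1_vel t b).1.
by apply: cont_add; apply: cont_mul; [exact: v|exact: (hf true).2|exact: v|exact: (hf false).2].
Qed.

Lemma adv_mul t (f g : plane -> R) x : C1 f -> C1 g -> adv t (fun y => f y * g y) x = f x * adv t g x + g x * adv t f x.
Proof. move=> f1 g1; have [_ h] := C1_mul f1 g1; rewrite /adv !h.
have alg (u v f0 g0 a b c d : R) : u * (f0 * a + g0 * b) + v * (f0 * c + g0 * d) =
  f0 * (u * a + v * c) + g0 * (u * b + v * d) by ring.
exact: alg. Qed.

Lemma Rint_adv t (f : plane -> R) : C1 f -> cc f -> \int[mu2]_x adv t f x = 0.
Proof.
move=> f1 cf; have v1 b := flow_C1_vel t b.
have i j b : mint (fun x => vel b (r t) x * pd j f x).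
  by apply: cc_mint; apply: cc_mull; [exact: cc_pd|exact: (v1 b).1].
have i2 j b : mint (fun x => f x * pd j (vel b (r t)) x).
  by apply: cc_mint; apply: cc_mulr => //; exact: ((v1 b).2 j).2.
rewrite RintD//.
have e j b : \int[mu2]_x (vel b (r t) x * pd j f x) = - \int[mu2]_x (f x * pd j (vel b (r t)) x).
  by rewrite (Rint_parts j f1 (v1 b) cf) opprK.
rewrite !e -opprD -RintD// (Rint_ext2 (g := fun=> 0)) ?Rintegral_cst ?mul0r ?oppr0// => x.
by rewrite -mulrDr (flow_div fl) mulr0.
Qed.

Definition mass2 (t : R) : R := \int[mu2]_x (r t x ^+ 2).

Lemma cc_sqr (f : plane -> R) : cc f -> cc (fun x => f x ^+ 2).
Proof. by move=> [cf [M fM]]; split; [exact: cont_exp|exists M => x /fM->; rewrite expr0n]. Qed.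

(** [riesz_pairing] for [l^-1 h], multiplied by [l]; its factor [pi] meets the [(2 pi)^-1] of the
    velocity and leaves 1/2. The free weight [l] plays the part of Young's inequality. *)
Lemma vel_pairing b (h w : plane -> R) (l : R) : 0 < l -> C1 h -> cc h -> C1 w -> cc w -> C1 (pd true w) ->
  `|\int[mu2]_x (h x * vel b w x)| <= (l^-1 * \int[mu2]_x (h x ^+ 2) + l * \int[mu2]_x (w x ^+ 2)) / 2.
Proof.
move=> l0 h1 ch w1 cw ww; have pi0 := @pi_gt0 R.
have [g1 _] := C1_scale l^-1 h1; have cg := cc_scale l^-1 ch.
have cK i : continuous (kconv (pd i (pd true w))).
  by apply: kconv_continuous; apply: cc_pd => //; exact: cc_pd.
have key i : `|\int[mu2]_x (h x * ((2 * pi)^-1 * kconv (pd i (pd true w)) x))| <=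
    (l^-1 * \int[mu2]_x (h x ^+ 2) + l * \int[mu2]_x (w x ^+ 2)) / 2.
  have := riesz_pairing i g1 cg w1 cw ww.
  have -> : \int[mu2]_x (l^-1 * h x * kconv (pd i (pd true w)) x) = l^-1 * \int[mu2]_x (h x * kconv (pd i (pd true w)) x).
    rewrite -RintZ; last by apply: cc_mint; exact: cc_mulr.
    by apply: Rint_ext2 => x; rewrite mulrA.
  have -> : \int[mu2]_x ((l^-1 * h x) ^+ 2) = l^-1 ^+ 2 * \int[mu2]_x (h x ^+ 2).
    rewrite -RintZ; last by apply: cc_mint; exact: cc_sqr.
    by apply: Rint_ext2 => x; rewrite exprMn.
  have -> : \int[mu2]_x (h x * ((2 * pi)^-1 * kconv (pd i (pd true w)) x)) = (2 * pi)^-1 * \int[mu2]_x (h x * kconv (pd i (pd true w)) x).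
    rewrite -RintZ; last by apply: cc_mint; exact: cc_mulr.
    by apply: Rint_ext2 => x; rewrite mulrCA.
  rewrite !normrM (ger0_norm (x := l^-1)) ?invr_ge0 ?(ltW l0)// (ger0_norm (x := (2 * pi)^-1)); last by rewrite invr_ge0 mulr_ge0// ltW.
  have alg (p I H W : R) : 0 < p -> l^-1 * I <= p * (l^-1 ^+ 2 * H + W) -> (2 * p)^-1 * I <= (l^-1 * H + l * W) / 2.
    move=> p0; rewrite mulrC ler_pdivrMr// => hI.
    rewrite mulrC ler_pdivrMr ?mulr_gt0//; apply: (le_trans hI); rewrite le_eqVlt; apply/orP; left; apply/eqP.
    by field; rewrite gt_eqF.
  exact: alg.
case: b.
  by rewrite (Rint_ext2 (g := fun x => h x * ((2 * pi)^-1 * kconv (pd false (pd true w)) x))) ?key// => x; rewrite velE.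
rewrite (Rint_ext2 (g := fun x => h x * - ((2 * pi)^-1 * kconv (pd true (pd true w)) x))); last first.
  by move=> x; rewrite velE mulNr.
rewrite (Rint_ext2 (g := fun x => - (h x * ((2 * pi)^-1 * kconv (pd true (pd true w)) x)))); last first.
  by move=> x; rewrite mulrN.
rewrite RintN ?normrN ?key//.
by apply: cc_mint; apply: cc_mulr => //; apply: cont_mul; [exact: cont_cst|exact: cK].
Qed.

Lemma cut_near_eq1 (M q : R) x : 2 * M ^+ 2 <= q ^+ 2 -> 0 < q -> 0 <= M -> `|x| <= M -> cut (q ^- 2) 1 x = 1.
Proof.
move=> Mq q0 M0 xM; apply: cut_eq1; rewrite mulrC ler_pdivrMr ?exprn_gt0// mul1r.
apply: le_trans Mq; apply: (le_trans (dot_le_norm_sqr x)).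
by rewrite ler_pM2l// lerXn2r ?nnegrE.
Qed.

(** Incompressibility makes the advection antisymmetric: the integral of the advection of the
    product [z f] is 0. *)
Lemma Rint_test_adv t (z f : plane -> R) : C1 z -> cc z -> C1 f ->
  \int[mu2]_x (z x * - adv t f x) = \int[mu2]_x (f x * adv t z x).
Proof.
move=> z1 cz f1; have [p1 _] := C1_mul z1 f1; have cp := cc_mulr cz f1.1.
have := Rint_adv t p1 cp; rewrite (Rint_ext2 (fun x => adv_mul t x z1 f1)).
have ca := cc_mulr cz (adv_continuous (t := t) f1).
have ca2 : cc (fun x => f x * adv t z x).
  apply: cc_mull; last exact: f1.1.
  split; first exact: adv_continuous.
  have h3 b := cc_pd b z1 cz; have [_ [M1 h4]] := h3 true; have [_ [M2 h5]] := h3 false.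
  exists (Num.max M1 M2) => x; rewrite gt_max => /andP[m1 m2].
  by rewrite /adv h4// h5// !mulr0 addr0.
rewrite RintD; [|exact: cc_mint|exact: cc_mint].
move=> /eqP; rewrite addr_eq0 => /eqP h.
rewrite (Rint_ext2 (g := fun x => - (z x * adv t f x))); last by move=> x; rewrite mulrN.
by rewrite RintN ?h ?opprK//; exact: cc_mint.
Qed.

Lemma Rint_cut_adv t c b (f : plane -> R) : 0 < c -> C1 f ->
  \int[mu2]_x (cut c b x * - adv t f x) = \int[mu2]_x (f x * adv t (cut c b) x).
Proof. by move=> c0; apply: Rint_test_adv; [exact: (C1_cut c b).1|exact: cc_cut]. Qed.

(* With weight [q^-1] in [vel_pairing] both terms are of order [q^-1], the
   gradient of the cutoff being of that order. *)
Lemma Rint_adv_cut_le t q c f : 0 < q -> 0 <= c -> C1 f -> cc f ->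
  (forall x, f x ^+ 2 <= c * r t x ^+ 2) ->
  `|\int[mu2]_x (f x * adv t (cut (q ^- 2) 1) x)| <= (1296 * c + 1) * mass2 t / q.
Proof.
move=> q0 c0 f1 cf fr; have [c1 dc] := C1_cut (q ^- 2) 1.
have cr := cc_sqr (flow_cc fl t).
pose h b x := f x * dcut (q ^- 2) 1 b x.
have h1 b : C1 (h b) by have [] := C1_mul f1 (C1_dcut (q ^- 2) 1 b).
have ch b : cc (h b) by apply: cc_mulr => //; exact: (C1_dcut (q ^- 2) 1 b).1.
have hv b := cc_mint (cc_mulr (ch b) (flow_C1_vel t b).1).
have h2 b : \int[mu2]_x (h b x ^+ 2) <= (36 / q) ^+ 2 * c * mass2 t.
  rewrite /mass2 -RintZ; last exact: cc_mint.
  apply: Rint_le; [exact/cc_mint/cc_sqr|by apply: mintZ; exact: cc_mint|move=> x].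
  have hb : dcut (q ^- 2) 1 b x ^+ 2 <= (36 / q) ^+ 2.
    rewrite -[leLHS]real_normK ?num_real// lerXn2r ?nnegrE//; last exact: dcut_le.
    by rewrite divr_ge0// ltW.
  have -> : h b x ^+ 2 = dcut (q ^- 2) 1 b x ^+ 2 * f x ^+ 2 by rewrite /h exprMn mulrC.
  apply: (le_trans (ler_wpM2r (sqr_ge0 (f x)) hb)).
  by rewrite -(mulrA ((36 / q) ^+ 2)); apply: ler_wpM2l; [exact: sqr_ge0|exact: fr].
have key b : `|\int[mu2]_x (h b x * vel b (r t) x)| <= (1296 * c + 1) * mass2 t / q / 2.
  apply: (le_trans (vel_pairing b (l := q^-1) _ (h1 b) (ch b) (flow_C1 t) (flow_cc fl t) (flow_C1_pd t true))).
    by rewrite invr_gt0.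
  rewrite ler_pM2r// invrK -/(mass2 t).
  (* Here 1296 is the square of the constant 36 in [dcut_le]. *)
  have -> : (1296 * c + 1) * mass2 t / q = q * ((36 / q) ^+ 2 * c * mass2 t) + q^-1 * mass2 t.
    by field; rewrite gt_eqF.
  by rewrite lerD2r ler_pM2l.
rewrite (Rint_ext2 (g := fun x => h true x * vel true (r t) x + h false x * vel false (r t) x)); last first.
  move=> x; rewrite /adv !dc /h.
  have alg (a b d u v : R) : a * (u * b + v * d) = a * b * u + a * d * v by ring.
  exact: alg.
rewrite RintD//; apply: (le_trans (ler_normD _ _)).
have := lerD (key true) (key false).
by rewrite -splitr.
Qed.

Lemma eq0_radius (d C q0 : R) : (forall q, q0 <= q -> 0 < q -> `|d| <= C / q) -> d = 0.
Proof.
move=> h; apply/eqP/negP => /negP d0; have dp : 0 < `|d| by rewrite normr_gt0.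
pose q := `|q0| + `|C| / `|d| + 1.
have qp : 0 < q by rewrite ltr_wpDl// addr_ge0// divr_ge0.
have := h q _ qp; rewrite ler_pdivlMr// => hq.
have : `|d| * q <= C by apply: hq; rewrite /q (le_trans (ler_norm q0))// -addrA lerDl addr_ge0// divr_ge0.
rewrite /q !mulrDr mulr1 (mulrC `|d| (`|C| / _)) divfK ?gt_eqF//.
by have := ler_norm C; have := mulr_ge0 (normr_ge0 d) (normr_ge0 q0); lra.
Qed.

(** Only the supports at the two end times are used: for a large radius the cutoff is 1 on both. In
    between, where the support is uncontrolled, the cutoff error is of order [1 / q], since
    [F^2 <= c r^2] and the L^2 mass is bounded by [B]. *)
Lemma transport_conserved (F Ft : R -> plane -> R) (a b c B : R) : 0 <= a -> a < b -> 0 <= c ->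
  (forall t, C1 (F t)) -> (forall t, cc (F t)) ->
  continuous (fun z : R * plane => F z.1 z.2) ->
  continuous (fun z : R * plane => Ft z.1 z.2) ->
  (forall (t : R) (x : plane), 0 < t -> is_derive t (1 : R) (F ^~ x) (Ft t x)) ->
  (forall t x, Ft t x = - adv t (F t) x) ->
  (forall t x, F t x ^+ 2 <= c * r t x ^+ 2) ->
  (forall t, a <= t <= b -> mass2 t <= B) ->
  \int[mu2]_x F b x = \int[mu2]_x F a x.
Proof.
move=> a0 ab c0 F1 cF cont contt dF eqF Fr mB.
apply/eqP; rewrite -subr_eq0; apply/eqP.
have [_ [Ma hMa]] := cF a; have [_ [Mb hMb]] := cF b.
pose M := Num.max `|Ma| `|Mb|.
have M0 : 0 <= M by rewrite le_max normr_ge0.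
(* The supports are measured in the max norm and the cutoff is Euclidean, so [2 M^2 <= q^2] is what
   makes it 1 on the box of radius [M]. *)
apply: (@eq0_radius _ ((1296 * c + 1) * B * (b - a)) (2 * M)) => q Mq q0.
have Mq2 : 2 * M ^+ 2 <= q ^+ 2.
  have h : (2 * M) ^+ 2 <= q ^+ 2 by rewrite lerXn2r ?nnegrE ?mulr_ge0// ltW.
  by apply: le_trans h; rewrite exprMn; have := sqr_ge0 M; lra.
have eM (t : R) : (forall x, M < `|x| -> F t x = 0) -> \int[mu2]_x (cut (q ^- 2) 1 x * F t x) = \int[mu2]_x F t x.
  move=> h; apply: Rint_ext2 => x; have [xM|/h->] := leP `|x| M; last by rewrite mulr0.
  by rewrite (cut_near_eq1 Mq2)// mul1r.
rewrite -(eM a); last by move=> x; rewrite gt_max => /andP[h _]; apply: hMa; exact: le_lt_trans (ler_norm _) h.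
rewrite -(eM b); last by move=> x; rewrite gt_max => /andP[_ h]; apply: hMb; exact: le_lt_trans (ler_norm _) h.
have ccut : continuous (fun z : R * plane => cut (q ^- 2) 1 z.2).
  by apply: (cont_comp (f := snd) (g := cut (q ^- 2) 1)); [apply: cont_snd; exact: cont_id|exact: (C1_cut _ _).1.1].
have [_ [M2 hM2]] : cc (cut (q ^- 2) 1) by apply: cc_cut; rewrite invr_gt0 exprn_gt0.
have [i e] := @Rint_time_derive R (fun t x => cut (q ^- 2) 1 x * F t x) (fun t x => cut (q ^- 2) 1 x * Ft t x) a b M2 ab
  (cont_mul ccut cont) (cont_mul ccut contt)
  (fun t x _ h => conj (eq_ind_r (fun y => y * F t x = 0) (mul0r _) (hM2 x h)) (eq_ind_r (fun y => y * Ft t x = 0) (mul0r _) (hM2 x h)))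
  (fun t x h => dv_eq (dv_mul (dv_cst (cut (q ^- 2) 1 x) t (1 : R)) (dF t x (le_lt_trans a0 (andP h).1))) (eq_ind_r (fun y => _ + y = _) (addr0 _) (mulr0 _))).
rewrite -e; have bd t : a <= t <= b -> `|\int[mu2]_x (cut (q ^- 2) 1 x * Ft t x)| <= (1296 * c + 1) * B / q.
  move=> tab; rewrite (Rint_ext2 (g := fun x => cut (q ^- 2) 1 x * - adv t (F t) x)); last by move=> x; rewrite eqF.
  rewrite Rint_cut_adv ?invr_gt0 ?exprn_gt0//; apply: (le_trans (Rint_adv_cut_le q0 c0 (F1 t) (cF t) (Fr t))).
  exact: (adv_cut_const_le c0 q0 (mB t tab)).
have e3 : (1296 * c + 1) * B * (b - a) / q = (1296 * c + 1) * B / q * (b - a) by rewrite mulrAC.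
have lo t : a <= t <= b -> - ((1296 * c + 1) * B / q) <= \int[mu2]_x (cut (q ^- 2) 1 x * Ft t x).
  by move=> /bd; rewrite ler_norml => /andP[].
have up t : a <= t <= b -> \int[mu2]_x (cut (q ^- 2) 1 x * Ft t x) <= (1296 * c + 1) * B / q.
  by move=> /bd; rewrite ler_norml => /andP[].
have h1 := Rint_time_ge ab i lo; have h2 := Rint_time_le ab i up.
by rewrite e3 ler_norml -mulNr; apply/andP; split.
Qed.

End Transport.

(** * Removing the boundedness proviso *)

Section LscConstant.
Context {R : realType}.
Implicit Types (N : R -> R) (a b t : R).

Definition lsc N := forall t n, n < N t ->
  exists d, 0 < d /\ forall s, `|s - t| < d -> n < N s.
Definition const_if_bounded N := forall a b B, a < b ->
  (forall t, a <= t <= b -> N t <= B) -> N b = N a.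
Definition unbounded N a b := forall B, exists t, a <= t <= b /\ B < N t.

(** Let [be] be the supremum of the times up to which [N] is bounded. Before it [N] is constant,
    semicontinuity prevents an upward jump at [be], and so [N be = N t0 > n]. By semicontinuity [N]
    stays above [n] shortly after [be], and it is unbounded there since otherwise [be] could be
    increased. *)
Lemma unbounded_right N t0 b n : lsc N -> const_if_bounded N -> t0 <= b -> n < N t0 ->
  unbounded N t0 b ->
  exists p : R * R, [/\ t0 <= p.1 < p.2, p.2 <= b, unbounded N p.1 p.2 &
    forall t, p.1 <= t <= p.2 -> n < N t].
Proof.
move=> lN cN t0b nN ub.
pose S := [set s | t0 <= s <= b /\ exists B, forall t, t0 <= t <= s -> N t <= B].
have St0 : S t0.
  by split; [rewrite lexx|exists (N t0) => t /le_anti <-].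
have Sb : has_sup S by split; [exists t0|exists b => s [/andP[_ ?] _]].
set be := sup S.
have t0be : t0 <= be by apply: (ub_le_sup Sb.2).
have beb : be <= b by apply: ge_sup; [exists t0|move=> s [/andP[_ ?] _]].
have Nlt s : t0 <= s -> s < be -> N s = N t0.
  move=> t0s /(sup_gt Sb.1)[s' [_ [B hB]] ss'].
  move: t0s; rewrite le_eqVlt => /orP[/eqP->//|t0s].
  apply: (cN t0 s B t0s) => t /andP[h1 h2]; apply: hB; rewrite h1 /=; exact: le_trans h2 (ltW ss').
have Nbe : N be <= N t0.
  rewrite leNgt; apply/negP => /lN[d [d0 hd]].
  move: (t0be); rewrite le_eqVlt => /orP[/eqP e|t0lt].
    by have := hd be; rewrite subrr normr0 => /(_ d0); rewrite -e ltxx.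
  pose s := Num.max t0 (be - d / 2).
  have s1 : t0 <= s by rewrite le_max lexx.
  have s2 : s < be by rewrite gt_max t0lt/= ltrBlDr ltrDl divr_gt0.
  have : N t0 < N s.
    apply: hd; rewrite ltr_norml; have : be - d / 2 <= s by rewrite le_max lexx orbT.
    by move=> h; apply/andP; split; lra.
  by rewrite (Nlt s s1 s2) ltxx.
have bnd t : t0 <= t <= be -> N t <= N t0.
  move=> /andP[h1]; rewrite le_eqVlt => /orP[/eqP->//|h2]; by rewrite (Nlt t h1 h2).
have Nb : n < N be.
  move: (t0be); rewrite le_eqVlt => /orP[/eqP <-//|h].
  by rewrite (cN _ _ _ h bnd).
have ltb : be < b.
  rewrite lt_neqAle beb andbT; apply/eqP => e.
  by have [t [ht]] := ub (N t0); rewrite ltNge bnd// e.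
have [d [d0 hd]] := lN _ _ Nb.
pose e := Num.min b (be + d / 2).
have bee : be < e by rewrite lt_min ltb/= ltrDl divr_gt0.
exists (be, e); split => //=; first by rewrite t0be.
- by rewrite ge_min lexx.
- apply: contrapT => nu.
  have [B hB] : exists B, forall t, be <= t <= e -> N t <= B.
    apply: contrapT => h; apply: nu => B; apply: contrapT => h2; apply: h; exists B => t ht.
    by rewrite leNgt; apply/negP => lt; apply: h2; exists t.
  have : S e.
    split; first by rewrite (le_trans t0be (ltW bee))/= ge_min lexx.
    exists (Num.max B (N t0)) => t /andP[h1 h2]; rewrite le_max.
    have [h3|h3] := leP be t; first by rewrite hB// h3.
    by rewrite (Nlt t h1 h3) lexx orbT.
  by move=> /(ub_le_sup Sb.2); rewrite leNgt bee.
- move=> t /andP[h1]; rewrite le_min => /andP[_ h2]; apply: hd.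
  by rewrite ger0_norm ?subr_ge0//; lra.
Qed.

(** A point where [N] exceeds [n] splits the interval, and [N] is unbounded on one of the halves.
    The left half is reduced to the right one by reversing the sign of the variable. *)
Lemma unbounded_shrink N a b n : lsc N -> const_if_bounded N ->
  unbounded N a b ->
  exists p : R * R, [/\ a <= p.1 < p.2, p.2 <= b, unbounded N p.1 p.2 &
    forall t, p.1 <= t <= p.2 -> n < N t].
Proof.
move=> lN cN ub; have [t0 [/andP[at0 t0b] nt0]] := ub n.
have [ur|nur] := pselect (unbounded N t0 b).
  have [p [/andP[h1 h2] h3 h4 h5]] := unbounded_right lN cN t0b nt0 ur.
  by exists p; split=> //; rewrite (le_trans at0 h1).
have ul : unbounded N a t0.
  move=> B; apply: contrapT => h; apply: nur => B'; have [t [/andP[h1 h2] h3]] := ub (Num.max B B').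
  move: h3; rewrite gt_max => /andP[hB hB']; exists t; split=> //; rewrite h2 andbT leNgt; apply/negP => tt0.
  by apply: h; exists t; rewrite h1 ltW.
pose N' s := N (- s).
have lN' : lsc N'.
  move=> t m /lN[d [d0 hd]]; exists d; split=> // s hs; apply: hd.
  by rewrite -opprD normrN.
have cN' : const_if_bounded N'.
  move=> c d B cd hB; apply/esym; apply: (cN (- d) (- c) B); first by rewrite ltrN2.
  by move=> t /andP[h1 h2]; have := hB (- t); rewrite /N' opprK; apply; rewrite lerNr h2 lerNl h1.
have ul' : unbounded N' (- t0) (- a).
  move=> B; have [t [/andP[h1 h2] h3]] := ul B; exists (- t); rewrite /N' opprK; split=> //.
  by rewrite !lerN2 h2.
have nt0' : n < N' (- t0) by rewrite /N' opprK.
have [p [/andP[h1 h2] h3 h4 h5]] := unbounded_right lN' cN' (etrans (lerN2 _ _) at0) nt0' ul'.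
exists (- p.2, - p.1); split=> /=.
- by rewrite lerNr h3 ltrN2.
- by rewrite (le_trans _ t0b)// lerNl.
- move=> B; have [t [/andP[g1 g2] g3]] := h4 B; exists (- t); split=> //.
  by rewrite !lerN2 g2.
- move=> t /andP[g1 g2]; have := h5 (- t); rewrite /N' opprK; apply.
  by rewrite lerNr g2 lerNl g1.
Qed.

(* On a nested sequence of intervals on which [N] is unbounded, lower
   semicontinuity makes [N] infinite at the common point. *)
Lemma lsc_constant N a b : lsc N -> const_if_bounded N -> a < b -> N b = N a.
Proof.
move=> lN cN ab; have [ub|nub] := pselect (unbounded N a b); last first.
  have [B hB] : exists B, forall t, a <= t <= b -> N t <= B.
    apply: contrapT => h; apply: nub => B; apply: contrapT => h2; apply: h; exists B => t ht.
    by rewrite leNgt; apply/negP => lt; apply: h2; exists t.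
  exact: cN ab hB.
exfalso.
have step (q : nat * (R * R)) : exists p : R * R, unbounded N q.2.1 q.2.2 ->
    [/\ q.2.1 <= p.1 < p.2, p.2 <= q.2.2, unbounded N p.1 p.2 &
    forall t, p.1 <= t <= p.2 -> q.1%:R < N t].
  have [u|nu] := pselect (unbounded N q.2.1 q.2.2); last by exists (a, b).
  by have [p hp] := unbounded_shrink q.1%:R lN cN u; exists p.
have [f hf] := choice step.
pose I k := iteri k (fun j p => f (j, p)) (a, b).
have uI k : unbounded N (I k).1 (I k).2.
  by elim: k => [//|k IH]; have [] := hf (k, I k) IH.
have mono k : (I k).1 <= (I k.+1).1 /\ (I k.+1).2 <= (I k).2.
  by have [/andP[h1 _] h2 _ _] := hf (k, I k) (uI k).
have incr k (l : nat) : (I k).1 <= (I (k + l)%N).1 /\ (I (k + l)%N).2 <= (I k).2.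
  elim: l => [|l [h1 h2]]; first by rewrite addn0.
  by rewrite addnS; have [h3 h4] := mono (k + l)%N; split; [exact: le_trans h3|exact: le_trans h2].
have ne k : (I k).1 <= (I k).2.
  by have [t [/andP[h1 h2] _]] := uI k 0; exact: le_trans h2.
have cross k l : (I k).1 <= (I l).2.
  have [h1 _] := incr k l; have [_ h2] := incr l k; apply: (le_trans h1); apply: le_trans h2.
  by rewrite addnC; exact: ne.
pose t := sup [set (I k).1 | k in setT].
have hs : has_sup [set (I k).1 | k in setT].
  by split; [exists (I 0%N).1; exists 0%N|exists (I 0%N).2 => _ [k _ <-]].
have tin k : (I k).1 <= t <= (I k).2.
  apply/andP; split; first by apply: (ub_le_sup hs.2); exists k.
  by apply: ge_sup; [exact: hs.1|move=> _ [l _ <-]].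
(* The interval of index [k.+1] carries the bound [k < N]; at the common point this is applied to a
   [k] above [N t]. *)
have := truncnS_gt (N t); rewrite ltNge; apply/negP; rewrite negbK ltW//.
have [_ _ _] := hf ((Num.truncn (N t)).+1, I (Num.truncn (N t)).+1) (uI _); apply.
exact: (tin (Num.truncn (N t)).+2).
Qed.

End LscConstant.

(** * Conservation of the L^2 norm *)

Section Mass.
Context {R : realType}.
Local Notation leb := (@lebesgue_measure R).
Local Notation mu2 := (leb \x leb)%E.
Local Notation plane := (R * R)%type.
Local Notation mint f := (mu2.-integrable setT (EFin \o f)).

Variables (r rt : R -> plane -> R).
Hypothesis fl : flow r rt.
Hypothesis clamped : forall t, t <= 0 -> r t = r 0.

(** By the chain rule [phi (r t)] solves the same transport equation; the growth condition lets the
    L^2 mass of the density control its cutoff errors. *)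
Lemma transport_comp (phi dphi : R -> R) (a b c B : R) : 0 <= a -> a < b -> 0 <= c ->
  continuous phi -> continuous dphi -> (forall s, is_derive s (1 : R) phi (dphi s)) ->
  phi 0 = 0 -> (forall s, phi s ^+ 2 <= c * s ^+ 2) ->
  (forall t, a <= t <= b -> mass2 r t <= B) ->
  \int[mu2]_x phi (r b x) = \int[mu2]_x phi (r a x).
Proof.
move=> a0 ab c0 cphi cdphi dphiP phi0 phile mB.
have C t := C1_comp (flow_C1 fl t) cphi cdphi dphiP.
apply: (@transport_conserved R r rt fl (fun t x => phi (r t x)) (fun t x => dphi (r t x) * rt t x) a b c B a0 ab c0) => //.
- by move=> t; have [] := C t.
- by move=> t; apply: cc_comp => //; exact: (flow_cc fl).
- by apply: (cont_comp (f := fun z : R * plane => r z.1 z.2)) => //; exact: (flow_cont fl).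
- apply: cont_mul; last exact: (flow_cont_t fl).
  by apply: (cont_comp (f := fun z : R * plane => r z.1 z.2)) => //; exact: (flow_cont fl).
- by move=> t x t0; exact: (dv_comp (g := fun s => r s x) (dphiP _) (flow_derive fl x t0)).
- move=> t x; have [_ e] := C t; rewrite /adv !e (flow_eq fl).
  have alg (d u v p q : R) : d * - (u * p + v * q) = - (u * (d * p) + v * (d * q)) by ring.
  exact: alg.
Qed.

(** The mass in a fixed box that contains the support at time [t] is continuous in time, never
    exceeds the total mass, and equals it at [t]. *)
Lemma mass2_lsc : lsc (mass2 r).
Proof.
move=> t n; have [_ [M rM]] := flow_cc fl t => nm.
pose G s := \int[mu2]_x (ibox M x * r s x ^+ 2).
have cr s : continuous (fun x => r s x ^+ 2) by apply: cont_exp; exact: (flow_cc fl s).1.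
have iG s : mint (fun x => ibox M x * r s x ^+ 2).
  have [K [K0 hK]] := cc_bounded (cc_sqr (flow_cc fl s)).
  have := mintM (continuous_measurable_plane (cr s)) hK (mint_ibox M); exact.
have Gt : G t = mass2 r t.
  apply: Rint_ext2 => x; rewrite iboxE; have [_|/rM->] := leP `|x| M; first by rewrite mul1r.
  by rewrite mul0r expr0n.
have Gle s : G s <= mass2 r s.
  apply: Rint_le; [exact: iG|exact/cc_mint/cc_sqr/(flow_cc fl)|move=> x].
  by rewrite iboxE; case: (`|x| <= M); rewrite ?mul1r ?mul0r ?lexx ?sqr_ge0.
have [K [K0 rK]] := cylinder_bounded (t - 1) (t + 1) M (flow_cont fl).
have cG : {for t, continuous G}.
  apply: (@dominated_continuous_at R R _ _ mu2 _ t (fun x => K ^+ 2 * ibox M x) 1) => //.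
  - by move=> s; exact: mint_meas (iG s).
  - by apply: mintZ; exact: mint_ibox.
  - move=> s x; rewrite ltr_norml => /andP[h1 h2]; rewrite iboxE.
    have [xM|_] := leP `|x| M; last by rewrite mul0r mulr0 normr0.
    rewrite mul1r mulr1 normrX lerXn2r ?nnegrE//; first exact: ltW.
    by apply: rK => //; apply/andP; split; lra.
  - move=> x; have h : continuous (fun s => ibox M x * r s x ^+ 2).
      by apply: cont_mul; [exact: cont_cst|apply: cont_exp; exact: (slice_time (x := x) (flow_cont fl))].
    exact: h.
have gap : 0 < G t - n by rewrite subr_gt0 Gt.
have /cvgrPdist_lt/(_ _ gap)/nbhs_ballP[d d0 hd] : G s @[s --> t] --> G t by exact: cG.
exists d; split=> // s hs; apply: lt_le_trans (Gle s).
have : `|G t - G s| < G t - n by apply: hd; rewrite /ball/= distrC.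
by rewrite ltr_norml => /andP[_]; lra.
Qed.

(** A damped square. Its own square is at most [e^-1 s^2], the growth that [transport_comp] demands
    and that [s^2] itself violates for large [s]; it tends to [s^2] as [e] goes to 0. *)
Definition sqd (e s : R) : R := s ^+ 2 / (1 + e * s ^+ 2).

Lemma sqd_den (e s : R) : 0 < e -> 0 < 1 + e * s ^+ 2.
Proof. by move=> e0; rewrite ltr_pwDl// mulr_ge0 ?sqr_ge0 ?ltW. Qed.

Lemma is_derive_sqd (e s : R) : 0 < e ->
  is_derive s (1 : R) (sqd e) (2 * s / (1 + e * s ^+ 2) ^+ 2).
Proof.
move=> e0; have d0 := lt0r_neq0 (sqd_den s e0).
have d1 : is_derive s (1 : R) (fun t => 1 + e * t ^+ 2) (e * (2 * s)).
  by apply: (dv_eq (dv_add (dv_cst 1 s (1 : R)) (dv_mul (dv_cst e s (1 : R)) (dv_sqr (dv_id s))))); ring.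
apply: (dv_eq (dv_mul (dv_sqr (dv_id s)) (dv_inv (f := fun t => 1 + e * t ^+ 2) d0 d1))).
by field.
Qed.

Lemma mass2_const_bounded (a b B : R) : 0 <= a -> a < b ->
  (forall t, a <= t <= b -> mass2 r t <= B) -> mass2 r b = mass2 r a.
Proof.
move=> a0 ab mB; apply/eqP; rewrite -subr_eq0; apply/eqP.
have [Ka [Ka0 hKa]] := cc_bounded (flow_cc fl a); have [Kb [Kb0 hKb]] := cc_bounded (flow_cc fl b).
pose K := Num.max Ka Kb; have K0 : 0 < K by rewrite lt_max Ka0.
apply: (@eq0_radius _ _ (K ^+ 2 * (mass2 r a + mass2 r b)) 0) => q _ q0.
pose e := q^-1; have e0 : 0 < e by rewrite invr_gt0.
have cden : continuous (fun s : R => 1 + e * s ^+ 2).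
  by apply: cont_add; [exact: cont_cst|apply: cont_mul; [exact: cont_cst|apply: cont_exp; exact: cont_id]].
have csq : continuous (sqd e).
  apply: cont_mul; first by apply: cont_exp; exact: cont_id.
  by apply: cont_inv => // s; rewrite gt_eqF// sqd_den.
have cdsq : continuous (fun s : R => 2 * s / (1 + e * s ^+ 2) ^+ 2).
  apply: cont_mul; first by apply: cont_mul; [exact: cont_cst|exact: cont_id].
  by apply: cont_inv; [move=> s; rewrite expf_neq0// gt_eqF// sqd_den|exact: cont_exp].
have s0 : sqd e 0 = 0 by rewrite /sqd expr0n/= mul0r.
have hle s : sqd e s ^+ 2 <= e^-1 * s ^+ 2.
  have h := sqd_den s e0; rewrite /sqd exprMn exprVn ler_pdivrMr ?exprn_gt0//.
  rewrite -mulrA mulrC ler_pdivlMr//.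
  have := mulr_ge0 (ltW e0) (sqr_ge0 s); have := sqr_ge0 s.
  by set x := s ^+ 2 => x0 ex0; have := mulr_ge0 x0 ex0; nra.
have eq := transport_comp a0 ab (ltW (_ : 0 < e^-1)) csq cdsq (fun s => is_derive_sqd s e0) s0 hle mB.
(* The defect [e s^4 / (1 + e s^2)] is at most [e K^2 s^2] for [|s| <= K]. A sup bound [K] is taken
   at the two end times only, and [e = 1 / q] goes to 0. *)
have near t : (forall x, `|r t x| <= K) -> `|\int[mu2]_x sqd e (r t x) - mass2 r t| <= e * K ^+ 2 * mass2 r t.
  move=> rK; have c1 := cc_mint (cc_comp csq s0 (flow_cc fl t)).
  have c2 := cc_mint (cc_sqr (flow_cc fl t)).
  rewrite /mass2 -RintB// -RintZ//; apply: Rint_norm_le; [exact: mintB|exact: mintZ|move=> x].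
  have h := sqd_den (r t x) e0.
  have -> : sqd e (r t x) - r t x ^+ 2 = - (e * (r t x ^+ 2 * r t x ^+ 2) / (1 + e * r t x ^+ 2)).
    by rewrite /sqd; field; rewrite gt_eqF.
  have x2 : r t x ^+ 2 <= K ^+ 2 by rewrite -[leLHS]real_normK ?num_real// lerXn2r ?nnegrE// ltW.
  have x0 := sqr_ge0 (r t x).
  rewrite normrN ger0_norm; last first.
    apply: divr_ge0; last exact: ltW.
    by apply: mulr_ge0; [exact: ltW|exact: mulr_ge0].
  rewrite ler_pdivrMr//; move: x2 x0 h; set y := r t x ^+ 2; move=> x2 x0 h.
  have h1 : 0 <= e * y * (K ^+ 2 - y) by apply: mulr_ge0; [apply: mulr_ge0 => //; exact: ltW|rewrite subr_ge0].
  have h2 : 0 <= e * e * K ^+ 2 * y * y.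
    by do 2![apply: mulr_ge0 => //]; apply: mulr_ge0; [apply: mulr_ge0; exact: ltW|exact: sqr_ge0].
  by move: h1 h2; rewrite expr2; lra.
have na := near a _; have nb := near b _.
have : `|\int[mu2]_x sqd e (r a x) - mass2 r a| <= e * K ^+ 2 * mass2 r a.
  by apply: na => x; rewrite (le_trans (hKa x))// le_max lexx.
have : `|\int[mu2]_x sqd e (r b x) - mass2 r b| <= e * K ^+ 2 * mass2 r b.
  by apply: nb => x; rewrite (le_trans (hKb x))// le_max lexx orbT.
rewrite eq; last by rewrite invr_gt0.
move: (Rintegral _ _ _) (mass2 r a) (mass2 r b) => I A B' h1 h2.
have -> : K ^+ 2 * (A + B') / q = e * K ^+ 2 * B' + e * K ^+ 2 * A by rewrite /e; ring.
have -> : B' - A = - (I - B') + (I - A) by ring.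
by apply: (le_trans (ler_normD _ _)); rewrite normrN lerD.
Qed.

Lemma mass2_const t : mass2 r t = mass2 r 0.
Proof.
have neg s : s <= 0 -> mass2 r s = mass2 r 0 by move=> s0; rewrite /mass2 clamped.
have [/neg//|t0] := leP t 0.
apply: (lsc_constant mass2_lsc _ t0) => a b B ab mB.
have [b0|b0] := leP b 0; first by rewrite !neg// (le_trans (ltW ab)).
have [a0|a0] := leP 0 a; first exact: mass2_const_bounded ab mB.
rewrite (neg a (ltW a0)); apply: (@mass2_const_bounded 0 b B) => // s /andP[h1 h2].
by apply: mB; rewrite h2 (le_trans (ltW a0) h1).
Qed.

End Mass.

Section IntegralFacts.
Context {R : realType}.
Local Notation leb := (@lebesgue_measure R).
Local Notation mu2 := (leb \x leb)%E.
Local Notation plane := (R * R)%type.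
Implicit Types (f : plane -> R) (x : plane).

Lemma Rint_ibox (d : R) : 0 < d -> \int[mu2]_x ibox d x = (2 * d) ^+ 2.
Proof.
move=> d0; have i := mint_itv (- d) d; have e := Rint_ind_time (gtrN d0).
rewrite /ibox (@Rint_tensor R _ _ _ _ leb leb _ _ i i) e; ring.
Qed.

Lemma cc_eq0 f : cc f -> (forall x, 0 <= f x) -> \int[mu2]_x f x <= 0 -> forall x, f x = 0.
Proof.
move=> cf f0 If x; apply/eqP; rewrite eq_le f0 andbT leNgt; apply/negP => fx.
have gap : 0 < f x / 2 by rewrite divr_gt0.
have /cvgrPdist_lt/(_ _ gap)/nbhs_ballP[d d0 hd] : f y @[y --> x] --> f x by exact: cf.1.
have d20 : 0 < d / 2 by rewrite divr_gt0.
have [i e] := Rint_reflect x (mint_ibox (d / 2)).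
have : \int[mu2]_y (f x / 2 * ibox (d / 2) (x - y)) <= \int[mu2]_y f y.
  apply: Rint_le; [exact: mintZ|exact: cc_mint|move=> y].
  rewrite iboxE; have [xy|_] := leP `|x - y| (d / 2); last by rewrite mulr0.
  rewrite mulr1; have : `|f x - f y| < f x / 2.
    by apply: hd; move: xy; rewrite plane_norm_le => /andP[? ?]; split; rewrite /ball/=; lra.
  by rewrite ltr_norml => /andP[_]; lra.
rewrite RintZ// e Rint_ibox//; apply/negP; rewrite -ltNge (le_lt_trans If)//.
by rewrite mulr_gt0// exprn_gt0// mulr_gt0.
Qed.

Lemma C1_reflect f x : C1 f -> C1 (fun y => f (x - y)) /\
  forall j, pd j (fun y => f (x - y)) = fun y => - pd j f (x - y).
Proof.
move=> f1; apply: (@C1_intro R _ (fun j y => - pd j f (x - y))).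
- exact: cont_reflect f1.1.
- by move=> j; apply: cont_opp; apply: (cont_reflect (f := pd j f)); exact: (f1.2 j).2.
- move=> j y; apply/is_derive_line.
  have := C1_is_derive j (x - y) f1 => /is_derive_line d.
  have d' : is_derive (- (0 : R)) (1 : R) (fun s => f (s *: ej j + (x - y))) (pd j f (x - y)) by rewrite oppr0.
  have := dv_comp (g := fun s : R => - s) d' (dv_opp (dv_id (0 : R))).
  rewrite mulrN1; congr (is_derive _ _ _ _); apply/funext => s.
  by congr f; apply: injective_projections; rewrite /= /GRing.scale/=; ring.
Qed.

End IntegralFacts.

(** * Near and far parts of the kernel *)

Section RegularizedKernel.
Context {R : realType}.
Local Notation leb := (@lebesgue_measure R).
Local Notation mu2 := (leb \x leb)%E.
Local Notation plane := (R * R)%type.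
Local Notation mint f := (mu2.-integrable setT (EFin \o f)).
Implicit Types (s : R) (z : plane).

(* A C^2 function that is the identity on [s >= 1] and bounded away from 0. *)
Definition qreg s : R := s + pos3 (1 - s).
Definition dqreg s : R := 1 - 3 * sq0 (1 - s).
Definition ddqreg s : R := 6 * pos1 (1 - s).

Lemma qreg_gt0 s : 0 < qreg s.
Proof.
rewrite /qreg; have [s0|s0] := ltP 0 s; first by rewrite ltr_pwDl// pos3_ge0.
by rewrite /pos3 /sq0 pos1E; nra.
Qed.

Lemma is_derive_1B s : is_derive s (1 : R) (fun t => 1 - t) (- 1).
Proof. by apply: (dv_eq (dv_sub (dv_cst 1 s (1 : R)) (dv_id s))); ring. Qed.

Lemma is_derive_qreg s : is_derive s (1 : R) qreg (dqreg s).
Proof.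
apply: (dv_eq (dv_add (dv_id s) (dv_comp (g := fun t => 1 - t) (is_derive_pos3 _) (is_derive_1B s)))).
by rewrite /dqreg; ring.
Qed.

Lemma is_derive_dqreg s : is_derive s (1 : R) dqreg (ddqreg s).
Proof.
apply: (dv_eq (dv_sub (dv_cst 1 s (1 : R)) (dv_mul (dv_cst 3 s (1 : R)) (dv_comp (g := fun t => 1 - t) (is_derive_sq0 _) (is_derive_1B s))))).
by rewrite /ddqreg; ring.
Qed.

Lemma cont_1B (g : R -> R) : continuous g -> continuous (fun s : R => g (1 - s)).
Proof.
move=> cg; apply: (@cont_comp _ _ _ (fun s : R => 1 - s) g) => //.
by apply: cont_sub; [exact: cont_cst|exact: cont_id].
Qed.

Lemma continuous_qreg : continuous qreg.
Proof. by apply: cont_add; [exact: cont_id|exact: cont_1B (@continuous_pos3 R)]. Qed.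

Lemma continuous_dqreg : continuous dqreg.
Proof.
apply: cont_sub; first exact: cont_cst.
by apply: cont_mul; [exact: cont_cst|exact: cont_1B (@continuous_sq0 R)].
Qed.

Lemma continuous_ddqreg : continuous ddqreg.
Proof. by apply: cont_mul; [exact: cont_cst|exact: cont_1B (@continuous_pos1 R)]. Qed.

(** Evaluated at [|z|^2], which explains the factor 1/2: it is [ln |z|] for [|z| >= 1] and has no
    singularity at the origin. *)
Definition lreg s : R := 2^-1 * ln (qreg s).
Definition dlreg s : R := 2^-1 * (dqreg s / qreg s).
Definition ddlreg s : R := 2^-1 * ((ddqreg s * qreg s - dqreg s ^+ 2) / qreg s ^+ 2).

Lemma is_derive_lreg s : is_derive s (1 : R) lreg (dlreg s).
Proof.
have d := dv_comp (g := qreg) (is_derive1_ln (qreg_gt0 s)) (is_derive_qreg s).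
by apply: (dv_eq (dv_mul (dv_cst 2^-1 s (1 : R)) d)); rewrite /dlreg; ring.
Qed.

Lemma is_derive_dlreg s : is_derive s (1 : R) dlreg (ddlreg s).
Proof.
have q0 := lt0r_neq0 (qreg_gt0 s).
have d := dv_mul (is_derive_dqreg s) (dv_inv q0 (is_derive_qreg s)).
by apply: (dv_eq (dv_mul (dv_cst 2^-1 s (1 : R)) d)); rewrite /ddlreg; field.
Qed.

Lemma continuous_lreg : continuous lreg.
Proof. exact: dv_continuous is_derive_lreg. Qed.

Lemma continuous_dlreg : continuous dlreg.
Proof. exact: dv_continuous is_derive_dlreg. Qed.

Lemma continuous_ddlreg : continuous ddlreg.
Proof.
apply: cont_mul; first exact: cont_cst.
apply: cont_mul.
  apply: cont_sub; first by apply: cont_mul; [exact: continuous_ddqreg|exact: continuous_qreg].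
  by apply: cont_exp; exact: continuous_dqreg.
apply: cont_inv; last by apply: cont_exp; exact: continuous_qreg.
by move=> s; rewrite expf_neq0// gt_eqF// qreg_gt0.
Qed.

(** Second derivatives of [kreg] contain [ddlreg (|z|^2) z_i z_j], hence the factor [s] in the
    second bound. On [[0, 1]] compactness suffices; beyond it [lreg] is half a logarithm and the
    derivatives are explicit. *)
Lemma lreg_bounds : exists C, 0 < C /\
  forall s, 0 <= s -> `|dlreg s| <= C /\ `|s * ddlreg s| <= C.
Proof.
have K := @segment_compact R 0 1.
have [C1 [C10 h1]] := compact_bounded_fun continuous_dlreg K.
have [C2 [C20 h2]] := compact_bounded_fun (cont_mul (@cont_id R) continuous_ddlreg) K.
exists (C1 + C2 + 1); split=> [|s s0]; first by rewrite !addr_gt0.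
have [s1|/ltW s1] := leP s 1.
  have i : (`[0, 1]%classic : set R) s by rewrite /= in_itv/= s0.
  by have := h1 s i; have := h2 s i; split; lra.
have q1 : qreg s = s by rewrite /qreg pos3_le0 ?addr0// subr_le0.
have q2 : dqreg s = 1 by rewrite /dqreg sq0_le0 ?mulr0 ?subr0// subr_le0.
have q3 : ddqreg s = 0 by rewrite /ddqreg pos1_le0 ?mulr0// subr_le0.
have sp : 0 < s by apply: lt_le_trans s1.
have si : s^-1 <= 1 by rewrite invf_le1.
have s0i : 0 <= s^-1 by rewrite invr_ge0.
rewrite /dlreg /ddlreg q1 q2 q3.
have -> : s * (2^-1 * ((0 * s - 1 ^+ 2) / s ^+ 2)) = - (2^-1 * (1 / s)) by field; rewrite gt_eqF.
by rewrite normrN ger0_norm ?mulr_ge0 ?mul1r//; split; lra.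
Qed.

Definition kreg z : R := lreg (1 * dot z z - 0).

Lemma kreg_eq z : 1 < `|z| -> kreg z = kern z.
Proof.
move=> z1; have d1 : 1 <= dot z z.
  apply: le_trans (norm_sqr_le_dot z); rewrite -[leLHS](expr1n _ 2) lerXn2r ?nnegrE// ltW//.
rewrite /kreg mul1r subr0 /lreg /qreg pos3_le0 ?subr_le0// addr0 ln_dot.
by field.
Qed.

Definition dkreg j z : R := dlreg (1 * dot z z - 0) * (2 * 1 * cj j z).
Definition ddkreg i j z : R := dlreg (1 * dot z z - 0) * (2 * 1 * (j == i)%:R) +
  2 * 1 * cj j z * (ddlreg (1 * dot z z - 0) * (2 * 1 * cj i z)).

Lemma C1_kreg : C1 kreg /\ forall j, pd j kreg = dkreg j.
Proof.
have [h1 h2] := @C1_dot R 1 0.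
have [h3 h4] := C1_comp h1 continuous_lreg continuous_dlreg is_derive_lreg.
by split=> // j; rewrite h4 h2.
Qed.

Lemma C1_dkreg j : C1 (dkreg j) /\ forall i, pd i (dkreg j) = ddkreg i j.
Proof.
have [h1 h2] := @C1_dot R 1 0.
have [h3 h4] := C1_comp h1 continuous_dlreg continuous_ddlreg is_derive_dlreg.
have [h5 h6] := @C1_cj R j; have [h7 h8] := C1_scale (2 * 1) h5.
have [h9 h10] := C1_mul h3 h7; split=> // i.
by rewrite h10 h4 h8 h2 h6.
Qed.

Lemma ddkreg_bounded : exists K, 0 < K /\ forall i j z, `|ddkreg i j z| <= K.
Proof.
have [C [C0 hC]] := lreg_bounds; exists (6 * C); split=> [|i j z]; first by rewrite mulr_gt0.
rewrite /ddkreg mul1r subr0 mulr1; have d0 := dot_ge0 z; have [h1 h2] := hC _ d0.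
apply: (le_trans (ler_normD _ _)).
have b1 : `|dlreg (dot z z) * (2 * (j == i)%:R)| <= 2 * C.
  rewrite normrM mulrC; apply: ler_pM => //.
  by case: (j == i); rewrite ?mulr1 ?mulr0 ?normr0 ?ger0_norm.
have b2 : `|2 * cj j z * (ddlreg (dot z z) * (2 * cj i z))| <= 4 * C.
  have -> : 2 * cj j z * (ddlreg (dot z z) * (2 * cj i z)) = 4 * (cj j z * cj i z * ddlreg (dot z z)) by ring.
  rewrite normrM ger0_norm// ler_pM2l// normrM.
  apply: le_trans h2; rewrite [in leRHS]normrM (ger0_norm d0) ler_wpM2r//.
  have := sqr_ge0 (z.1 - z.2); have := sqr_ge0 (z.1 + z.2); have := sqr_ge0 z.1; have := sqr_ge0 z.2.
  rewrite /dot /cj ler_norml; case: (j); case: (i); rewrite /= !expr2 => *; apply/andP; split; lra.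
lra.
Qed.

Definition near_mass : R := \int[mu2]_z `|(kern z - kreg z) * ibox 1 z|.

Lemma kern_near z : kern z - kreg z = (kern z - kreg z) * ibox 1 z.
Proof.
rewrite iboxE; have [_|z1] := leP `|z| 1; first by rewrite mulr1.
by rewrite kreg_eq// subrr mul0r.
Qed.

Lemma mint_near : mint (fun z => (kern z - kreg z) * ibox 1 z).
Proof.
have cK : continuous kreg := C1_kreg.1.1.
have [C [C0 hC]] := compact_bounded_fun cK (@compact_box R 1).
have i1 := mint_kern (1 : R).
have i2 : mint (fun z => kreg z * ibox 1 z).
  apply: (mint_le _ _ (mintZ C (mint_ibox 1))).
    apply: measurable_funM; first exact: continuous_measurable_plane.
    exact: mint_meas (mint_ibox 1).
  move=> z; rewrite iboxE; have [z1|_] := leP `|z| 1; last by rewrite !mulr0 normr0.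
  by rewrite !mulr1; exact: hC.
have := mintB i1 i2; congr (_.-integrable _ _).
by apply/funext => z /=; congr EFin; rewrite mulrBl.
Qed.

(** The singular part of the kernel lives in the unit box and sees only values of the second
    derivative near [x]. In the smooth part both derivatives are moved onto the kernel, where they
    are bounded, so distant values of [f] matter only through the L^1 norm. *)
Lemma kconv_pd2_bound i j f S M x : C1 f -> cc f -> C1 (pd j f) -> 0 <= S -> `|x| <= M ->
  (forall y, `|y| <= M + 1 -> `|pd i (pd j f) y| <= S) ->
  forall K, (forall i j z, `|ddkreg i j z| <= K) ->
  `|kconv (pd i (pd j f)) x| <= S * near_mass + K * l1 f.
Proof.
move=> f1 cf ff1 S0 xM hS K hK.
have cg := cc_pd i ff1 (cc_pd j f1 cf).
have [k1 dk1] := C1_kreg.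
have [r1 dr1] := C1_reflect x k1.
have [dk dd] := C1_dkreg i; have [r2 dr2] := C1_reflect x dk.
have ifar : mint (fun y => kreg (x - y) * pd i (pd j f) y).
  by apply: cc_mint; apply: cc_mull => //; exact: r1.1.
have inear : mint (fun y => (kern (x - y) - kreg (x - y)) * pd i (pd j f) y).
  have := mintB (kconv_mint x cg).2 ifar; congr (_.-integrable _ _).
  by apply/funext => y /=; congr EFin; ring.
have -> : kconv (pd i (pd j f)) x = \int[mu2]_y ((kern (x - y) - kreg (x - y)) * pd i (pd j f) y) +
    \int[mu2]_y (kreg (x - y) * pd i (pd j f) y).
  by rewrite -RintD//; apply: Rint_ext2 => y; ring.
apply: (le_trans (ler_normD _ _)); apply: lerD.
  have [in1 en1] := Rint_reflect x (mint_norm mint_near).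
  rewrite /near_mass -en1 -RintZ//; apply: Rint_norm_le => //; first exact: mintZ.
  move=> y; rewrite kern_near iboxE normrM normrM.
  have [h|_] := leP `|x - y| 1; last by rewrite !(normr0, mulr0, mul0r).
  rewrite normr1 !mulr1 mulrC ler_wpM2r//; apply: hS.
  have -> : y = x - (x - y) by rewrite opprB addrC subrK.
  by apply: (le_trans (ler_normB _ _)); rewrite lerD.
have e1 : \int[mu2]_y (kreg (x - y) * pd i (pd j f) y) = \int[mu2]_y (dkreg i (x - y) * pd j f y).
  rewrite -[LHS]opprK -(Rint_parts i ff1 r1 (cc_pd j f1 cf)) dr1 dk1.
  rewrite -RintN; last by apply: cc_mint; apply: cc_mulr; [exact: cc_pd|exact: cont_opp r2.1].
  by apply: Rint_ext2 => y; ring.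
have e2 : \int[mu2]_y (dkreg i (x - y) * pd j f y) = \int[mu2]_y (f y * ddkreg j i (x - y)).
  rewrite -[LHS]opprK -(Rint_parts j f1 r2 cf) dr2 dd.
  rewrite -RintN; first by apply: Rint_ext2 => y; ring.
  apply: cc_mint; apply: cc_mulr; [exact: cf|apply: cont_opp].
  by apply: (cont_reflect (f := ddkreg j i)); rewrite -dd; exact: (dk.2 j).2.
rewrite e1 e2 /l1 -RintZ; last exact/mint_norm/cc_mint.
apply: Rint_norm_le; last by move=> y; rewrite normrM mulrC ler_wpM2r.
  apply: cc_mint; apply: cc_mulr; first exact: cf.
  by apply: (cont_reflect (f := ddkreg j i)); rewrite -dd; exact: (dk.2 j).2.
by apply: mintZ; exact/mint_norm/cc_mint.
Qed.

End RegularizedKernel.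

(** * The L^1 norm, local velocity bounds and finite speed of the support *)

Section FlowBounds.
Context {R : realType}.
Local Notation leb := (@lebesgue_measure R).
Local Notation mu2 := (leb \x leb)%E.
Local Notation plane := (R * R)%type.
Local Notation mint f := (mu2.-integrable setT (EFin \o f)).

Variables (r rt : R -> plane -> R).
Hypothesis fl : flow r rt.
Hypothesis clamped : forall t, t <= 0 -> r t = r 0.

Definition smabs (e s : R) : R := Num.sqrt (s ^+ 2 + e ^+ 2) - e.

Lemma smabs_arg (e s : R) : 0 < e -> 0 < s ^+ 2 + e ^+ 2.
Proof. by move=> e0; rewrite ltr_wpDl ?sqr_ge0 ?exprn_gt0. Qed.

Lemma smabs_bounds (e s : R) : 0 < e -> `|s| - e <= smabs e s <= `|s| /\ 0 <= smabs e s.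
Proof.
move=> e0; have s2 : `|s| ^+ 2 = s ^+ 2 by rewrite real_normK ?num_real.
have a0 := normr_ge0 s; have q0 := sqrtr_ge0 (s ^+ 2 + e ^+ 2).
have qe := sqr_sqrtr (ltW (smabs_arg s e0)); rewrite /smabs.
set q := Num.sqrt _ in q0 qe *; rewrite -s2 in qe; move: `|s| q a0 q0 qe => a q a0 q0 qe.
by split; [apply/andP; split; nra|nra].
Qed.

Lemma is_derive_smabs (e s : R) : 0 < e ->
  is_derive s (1 : R) (smabs e) (s / Num.sqrt (s ^+ 2 + e ^+ 2)).
Proof.
move=> e0; have a0 := smabs_arg s e0.
have d1 : is_derive s (1 : R) (fun t => t ^+ 2 + e ^+ 2) (2 * s).
  by apply: (dv_eq (dv_add (dv_sqr (dv_id s)) (dv_cst (e ^+ 2) s (1 : R)))); ring.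
apply: (dv_eq (dv_sub (dv_comp (g := fun t => t ^+ 2 + e ^+ 2) (is_derive1_sqrt a0) d1) (dv_cst e s (1 : R)))).
by field; rewrite gt_eqF ?sqrtr_gt0.
Qed.

(** The integral of [smabs e] is conserved. At time 0 it is at most the L^1 norm; at time [t] it
    falls short of it by at most [e] times the area of a box around the support at that single
    time. *)
Lemma l1_le t : l1 (r t) <= l1 (r 0).
Proof.
have [t0|t0] := leP t 0; first by rewrite clamped.
have [_ [M rM]] := flow_cc fl t.
pose A := \int[mu2]_x ibox M x.
apply/ler_addgt0Pl => d d0; pose e := d / (`|A| + 1).
have A1 : 0 < `|A| + 1 by rewrite ltr_wpDl.
have e0 : 0 < e by rewrite divr_gt0.
have eA : e * A <= d.
  by rewrite /e mulrAC ler_pdivrMr// ler_pM2l//; apply: (le_trans (ler_norm A)); rewrite lerDl.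
have csq : continuous (fun s : R => Num.sqrt (s ^+ 2 + e ^+ 2)).
  apply: (@cont_comp _ _ _ (fun s : R => s ^+ 2 + e ^+ 2)); last exact: sqrt_continuous.
  by apply: cont_add; [apply: cont_exp; exact: cont_id|exact: cont_cst].
have cphi : continuous (smabs e) by apply: cont_sub; [exact: csq|exact: cont_cst].
have cdphi : continuous (fun s : R => s / Num.sqrt (s ^+ 2 + e ^+ 2)).
  apply: cont_mul; first exact: cont_id.
  by apply: cont_inv; [move=> s; rewrite gt_eqF ?sqrtr_gt0 ?smabs_arg|].
have phi0 : smabs e 0 = 0 by rewrite /smabs expr0n/= add0r sqrtr_sqr ger0_norm ?subrr ?ltW.
have hle s : smabs e s ^+ 2 <= 1 * s ^+ 2.
  have [/andP[_ h1] h2] := smabs_bounds s e0.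
  by rewrite mul1r -[leRHS]real_normK ?num_real// lerXn2r ?nnegrE.
have mB s : 0 <= s <= t -> mass2 r s <= mass2 r 0 by move=> _; rewrite (mass2_const fl clamped).
have e1 := transport_comp fl (lexx 0) t0 ler01 cphi cdphi (fun s => is_derive_smabs s e0) phi0 hle mB.
have ic s := cc_mint (cc_comp cphi phi0 (flow_cc fl s)).
have ia s := mint_norm (cc_mint (flow_cc fl s)).
have ib : mint (fun x => e * ibox M x) by apply: mintZ; exact: mint_ibox.
apply: (le_trans (y := \int[mu2]_x (smabs e (r t x) + e * ibox M x))).
  apply: Rint_le; [exact: ia|exact: mintD|move=> x].
  have [/andP[h1 _] h2] := smabs_bounds (r t x) e0.
  rewrite iboxE; have [_|/rM->] := leP `|x| M; first by rewrite mulr1; lra.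
  by rewrite phi0 normr0 mulr0 addr0.
rewrite RintD// e1 RintZ; last exact: mint_ibox.
rewrite addrC; apply: lerD.
  exact: eA.
by apply: Rint_le => // x; have [/andP[_]] := smabs_bounds (r 0 x) e0.
Qed.

(** Second derivatives are bounded on compact cylinders by continuity, here on a box larger by 1,
    the reach of the singular part of the kernel; the far field is controlled by the L^1 norm,
    whatever the support. *)
Lemma vel_bounded (a b M : R) : exists U, 0 < U /\
  forall j t x, a <= t <= b -> `|x| <= M -> `|vel j (r t) x| <= U.
Proof.
have [S1 [S10 h1]] := @cylinder_bounded R (fun t => pd true (pd true (r t))) a b (M + 1) (@flow_cont2 R r rt fl true true).
have [S2 [S20 h2]] := @cylinder_bounded R (fun t => pd false (pd true (r t))) a b (M + 1) (@flow_cont2 R r rt fl true false).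
have [K [K0 hK]] := @ddkreg_bounded R.
pose S := S1 + S2; have S0 : 0 < S by rewrite addr_gt0.
have n0 : 0 <= @near_mass R by apply: Rintegral_ge0.
pose U := (2 * pi)^-1 * (S * near_mass + K * l1 (r 0)) + 1.
have p0 : 0 < (2 * pi)^-1 :> R by rewrite invr_gt0 mulr_gt0// pi_gt0.
have U0 : 0 < U by rewrite ltr_wpDl// mulr_ge0 ?(ltW p0)// addr_ge0 ?mulr_ge0 ?l1_ge0 ?ltW.
exists U; split=> // j t x tab xM.
have key i : `|kconv (pd i (pd true (r t))) x| <= S * near_mass + K * l1 (r 0).
  apply: (le_trans (@kconv_pd2_bound _ i true (r t) S M x (flow_C1 fl t) (flow_cc fl t) (flow_C1_pd fl t true) (ltW S0) xM _ K hK)).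
    move=> y yM; case: i.
      by apply: (le_trans (h1 t y tab yM)); rewrite lerDl ltW.
    by apply: (le_trans (h2 t y tab yM)); rewrite lerDr ltW.
  by apply: lerD => //; rewrite ler_pM2l// l1_le.
rewrite velE; case: j; rewrite normrM ?normrN (ger0_norm (ltW p0)).
  by rewrite (le_trans (ler_wpM2l (ltW p0) (key false)))// /U lerDl.
by rewrite (le_trans (ler_wpM2l (ltW p0) (key true)))// /U lerDl.
Qed.

(* A ball containing the support and expanding faster than the velocity keeps
   all of the conserved L^2 mass. *)
Lemma local_support (tau : R) : 0 <= tau -> exists d M, 0 < d /\
  forall t x, tau <= t <= tau + d -> M < `|x| -> r t x = 0.
Proof.
move=> tau0; have [_ [M0 hM0]] := flow_cc fl tau.
pose b0 := 2 * M0 ^+ 2; have b00 : 0 <= b0 by rewrite mulr_ge0 ?sqr_ge0.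
(* The level [b] of the moving cutoff stays below [b0 + 1], so [b0 + 2 <= M1^2] keeps the cutoff
   inside the box of radius [M1], where the velocity bound is taken. *)
pose M1 := b0 + 3; have M10 : 0 < M1 by rewrite ltr_wpDl.
have M1b : b0 + 2 <= M1 ^+ 2 by rewrite /M1; nra.
have [U [U0 hU]] := vel_bounded tau (tau + 1) M1.
(* Inside that box [|y|^2] changes along the velocity at a rate [2 y . u] of at most [4 M1 U]; the
   level growing at this rate makes the cut-off mass nondecreasing. *)
pose V := 4 * M1 * U; have V0 : 0 < V by rewrite !mulr_gt0.
pose d := Num.min 1 V^-1; have d0 : 0 < d by rewrite lt_min ltr01 invr_gt0.
have d1 : d <= 1 by rewrite ge_min lexx.
have dV : V * d <= 1 by rewrite -ler_pdivlMl// mulr1 ge_min lexx orbT.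
exists d, (Num.max M1 M0); split=> // t x /andP[t1 t2]; rewrite gt_max => /andP[xM1 xM0].
move: t1; rewrite le_eqVlt => /orP[/eqP<-|t1]; first exact: hM0.
pose b s := b0 + V * (s - tau).
pose F s y := cut 1 (b s) y * r s y ^+ 2.
pose Ft s y := dstep (1 * dot y y - b s) * - V * r s y ^+ 2 + cut 1 (b s) y * (2 * r s y * rt s y).
have bs s : tau <= s <= t -> b0 <= b s /\ b s + 1 <= M1 ^+ 2.
  move=> /andP[s1 s2]; rewrite /b; have h : 0 <= V * (s - tau) by rewrite mulr_ge0 ?subr_ge0 ?(ltW V0).
  have : V * (s - tau) <= V * d by rewrite ler_pM2l//; lra.
  by split; lra.
have cb : continuous (fun z : R * plane => 1 * dot z.2 z.2 - b z.1).
  apply: cont_sub.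
    apply: cont_mul; first exact: cont_cst.
    by apply: continuous_dot; apply: cont_snd; exact: cont_id.
  apply: cont_add; first exact: cont_cst.
  apply: cont_mul; first exact: cont_cst.
  by apply: cont_sub; [apply: cont_fst; exact: cont_id|exact: cont_cst].
have ccut : continuous (fun z : R * plane => cut 1 (b z.1) z.2) := cont_comp cb (@continuous_step R).
have cF : continuous (fun z : R * plane => F z.1 z.2).
  by apply: cont_mul => //; apply: cont_exp; exact: (flow_cont fl).
have cFt : continuous (fun z : R * plane => Ft z.1 z.2).
  apply: cont_add.
    apply: cont_mul; last by apply: cont_exp; exact: (flow_cont fl).
    by apply: cont_mul; [exact: (cont_comp cb (@continuous_dstep R))|exact: cont_cst].
  apply: cont_mul => //; apply: cont_mul; last exact: (flow_cont_t fl).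
  by apply: cont_mul; [exact: cont_cst|exact: (flow_cont fl)].
have out s y : tau <= s <= t -> M1 < `|y| -> cut 1 (b s) y = 0 /\ dstep (1 * dot y y - b s) = 0.
  move=> hs yM; have [_ h] := bs s hs.
  have h2 : M1 ^+ 2 <= `|y| ^+ 2 by rewrite lerXn2r ?nnegrE// ltW.
  have h3 : 1 <= 1 * dot y y - b s by have := norm_sqr_le_dot y; lra.
  by rewrite /cut step_eq0// dstep_eq0.
have F0 s y : tau <= s <= t -> M1 < `|y| -> F s y = 0 /\ Ft s y = 0.
  by move=> hs yM; have [h1 h2] := out s y hs yM; rewrite /F /Ft h1 h2 !mul0r addr0.
have dF (s : R) (y : plane) : tau < s < t -> is_derive s (1 : R) (F ^~ y) (Ft s y).
  move=> /andP[s1 s2]; have s0 := le_lt_trans tau0 s1.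
  have db : is_derive s (1 : R) (fun s => 1 * dot y y - b s) (- V).
    apply: (dv_eq (dv_sub (dv_cst (1 * dot y y) s (1 : R)) (dv_add (dv_cst b0 s (1 : R)) (dv_mul (dv_cst V s (1 : R)) (dv_sub (dv_id s) (dv_cst tau s (1 : R))))))).
    by ring.
  have dc := dv_comp (g := fun s => 1 * dot y y - b s) (is_derive_step _) db.
  apply: (dv_eq (dv_mul dc (dv_sqr (flow_derive fl y s0)))).
  by rewrite /Ft /cut; ring.
have [i e] := Rint_time_derive t1 cF cFt F0 dF.
have nn s : tau <= s <= t -> 0 <= \int[mu2]_y Ft s y.
  move=> hs; have [c1 dc] := C1_cut 1 (b s).
  have ct : cc (cut 1 (b s)) := cc_cut _ ltr01.
  have [r1 dr] := C1_mul (flow_C1 fl s) (flow_C1 fl s).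
  have cr := cc_sqr (flow_cc fl s).
  have iadv : mint (fun y => r s y * r s y * adv r s (cut 1 (b s)) y).
    by apply: cc_mint; apply: cc_mulr; [exact: cr|exact: (adv_continuous fl c1)].
  have i1 : mint (fun y => dstep (1 * dot y y - b s) * - V * r s y ^+ 2).
    apply: cc_mint; apply: cc_mull => //; apply: cont_mul; last exact: cont_cst.
    by have [h _] := @C1_dot R 1 (b s); exact: (cont_comp h.1 (@continuous_dstep R)).
  have i2 : mint (fun y => cut 1 (b s) y * - adv r s (fun y => r s y * r s y) y).
    by apply: cc_mint; apply: cc_mulr => //; apply: cont_opp; exact: (adv_continuous fl r1).
  rewrite (Rint_ext2 (g := fun y => dstep (1 * dot y y - b s) * - V * r s y ^+ 2 +
      cut 1 (b s) y * - adv r s (fun y => r s y * r s y) y)); last first.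
    move=> y; rewrite /Ft (adv_mul r s y (flow_C1 fl s) (flow_C1 fl s)).
    have -> : rt s y = - adv r s (r s) y by rewrite (flow_eq fl).
    by move: (adv r s (r s) y) => A; ring.
  rewrite RintD// (Rint_cut_adv fl)// -RintD//; apply: Rintegral_ge0 => y _.
  have [yM|yM] := leP `|y| M1; last first.
    have [_ h] := out s y hs yM; rewrite h /adv !dc /dcut h !(mul0r, mulr0, addr0)//.
  have -> : adv r s (cut 1 (b s)) y = dstep (1 * dot y y - b s) * (2 * (y.1 * vel true (r s) y + y.2 * vel false (r s) y)).
    rewrite /adv !dc /dcut /cj; move: (vel _ _ _) (vel _ _ _) (dstep _) => A B D; ring.
  have s01 : tau <= s <= tau + 1 by move: hs => /andP[h1 h2]; rewrite h1/= (le_trans h2)// (le_trans t2)// lerD2l.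
  have := hU true s y s01 yM; have := hU false s y s01 yM.
  have := yM; rewrite plane_norm_le => /andP[y1 y2].
  move: (vel true (r s) y) (vel false (r s) y) => A B hB hA.
  have hAB : `|y.1 * A + y.2 * B| <= M1 * U + M1 * U.
    by apply: (le_trans (ler_normD _ _)); rewrite !normrM; apply: lerD; apply: ler_pM.
  have h1 : y.1 * A + y.2 * B <= 2 * (M1 * U).
    by apply: (le_trans (le_trans (ler_norm _) hAB)); rewrite mulr_natl mulr2n.
  have D0 := dstep_le0 (1 * dot y y - b s).
  move: (dstep _) D0 (y.1 * A + y.2 * B) h1 => D D0 W h1.
  have -> : D * - V * r s y ^+ 2 + r s y * r s y * (D * (2 * W)) = - D * (r s y ^+ 2) * (V - 2 * W) by ring.
  apply: mulr_ge0; first by apply: mulr_ge0; rewrite ?oppr_ge0 ?sqr_ge0.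
  rewrite subr_ge0; apply: (le_trans (ler_wpM2l (ler0n _ 2) h1)).
  by rewrite /V le_eqVlt; apply/orP; left; apply/eqP; ring.
have := Rint_time_ge t1 i nn; rewrite mul0r e subr_ge0 => mono.
have Ftau : \int[mu2]_y F tau y = mass2 r tau.
  apply: Rint_ext2 => y; rewrite /F; have [yM|/hM0->] := leP `|y| M0; last by rewrite expr0n/= mulr0.
  rewrite cut_eq1 ?mul1r// /b subrr mulr0 addr0; apply: (le_trans (dot_le_norm_sqr y)).
  by rewrite /b0 ler_pM2l// lerXn2r ?nnegrE// (le_trans _ yM).
have cr := cc_sqr (flow_cc fl t).
(* At time [tau] the cutoff holds the whole mass, which is conserved, and the cut-off mass has not
   decreased. So this nonnegative remainder has integral at most 0 and vanishes. *)
have cG : cc (fun y => (1 - cut 1 (b t) y) * r t y ^+ 2).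
  apply: cc_mull => //; apply: cont_sub; first exact: cont_cst.
  by have [[]] := C1_cut 1 (b t).
have G0 y : (1 - cut 1 (b t) y) * r t y ^+ 2 = 0.
  apply: (cc_eq0 cG) => [z|]; first by rewrite mulr_ge0 ?sqr_ge0// subr_ge0 cut_le1.
  rewrite (Rint_ext2 (g := fun y => r t y ^+ 2 - F t y)); last by move=> z; rewrite /F mulrBl mul1r.
  rewrite RintB; [|exact: cc_mint|by apply: cc_mint; apply: cc_mull => //; exact: (C1_cut 1 (b t)).1.1].
  rewrite subr_le0 -/(mass2 r t) (mass2_const fl clamped t) -(mass2_const fl clamped tau) -Ftau; exact: mono.
have tt : tau <= t <= t by rewrite lexx ltW.
have := G0 x; have [-> _] := out t x tt xM1.
by rewrite subr0 mul1r => /eqP; rewrite sqrf_eq0 => /eqP.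
Qed.

End FlowBounds.

(** * Propagation of oddness *)

Section Reflection.
Context {R : realType}.
Local Notation leb := (@lebesgue_measure R).
Local Notation mu2 := (leb \x leb)%E.
Local Notation plane := (R * R)%type.
Local Notation mint f := (mu2.-integrable setT (EFin \o f)).
Implicit Types (f g : plane -> R) (x : plane).

Definition sg (j : bool) : R := if j then 1 else - 1.

Lemma continuous_flip2 : continuous (@flip2 R).
Proof.
by apply: cont_pair; [apply: cont_fst; exact: cont_id|apply: cont_opp; apply: cont_snd; exact: cont_id].
Qed.

Lemma norm_flip2 x : `|flip2 x| = `|x|.
Proof.
by apply/eqP; rewrite eq_le !plane_norm_le /= normrN; have := lexx `|x|; have := lexx `|flip2 x|;
  rewrite !plane_norm_le /= normrN => -> ->.
Qed.

Lemma cc_flip2 f : cc f -> cc (fun x => f (flip2 x)).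
Proof.
move=> [cf [M fM]]; split; first exact: cont_comp continuous_flip2 cf.
by exists M => x xM; rewrite fM ?norm_flip2.
Qed.

Lemma C1_flip2 f : C1 f -> C1 (fun x => f (flip2 x)) /\
  forall j, pd j (fun x => f (flip2 x)) = fun x => sg j * pd j f (flip2 x).
Proof.
move=> f1; apply: (@C1_intro R _ (fun j x => sg j * pd j f (flip2 x))).
- exact: cont_comp continuous_flip2 f1.1.
- move=> j; apply: cont_mul; first exact: cont_cst.
  exact: cont_comp continuous_flip2 (f1.2 j).2.
- move=> j x; apply/is_derive_line.
  have /is_derive_line d := C1_is_derive j (flip2 x) f1.
  have d' : is_derive (sg j * (0 : R)) (1 : R) (fun s => f (s *: ej j + flip2 x)) (pd j f (flip2 x)) by rewrite mulr0.
  have := dv_comp (g := fun s : R => sg j * s) d' (dv_mul (dv_cst (sg j) (0 : R) (1 : R)) (dv_id (0 : R))).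
  rewrite mulr1 mul0r addr0 mulrC; congr (is_derive _ _ _ _); apply/funext => s.
  by congr f; case: j {d d'}; apply: injective_projections; rewrite /flip2 /sg /= /GRing.scale/=; ring.
Qed.

Lemma vel_add b f g x : C1 f -> cc f -> C1 (pd true f) -> C1 g -> cc g -> C1 (pd true g) ->
  vel b (fun y => f y + g y) x = vel b f x + vel b g x.
Proof.
move=> f1 cf ff1 g1 cg gg1.
have [_ e1] := C1_add f1 g1; have [_ e2] := C1_add ff1 gg1.
rewrite !velE e1 !e2.
have cff := cc_pd true f1 cf; have cgg := cc_pd true g1 cg.
by case: b; rewrite kconv_add ?mulrDr//; exact: cc_pd.
Qed.

Lemma vel_flip2 b f x : C1 f -> cc f -> C1 (pd true f) ->
  vel b (fun y => f (flip2 y)) x = - sg b * vel b f (flip2 x).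
Proof.
move=> f1 cf ff1; have [_ e1] := C1_flip2 f1; have [_ e2] := C1_flip2 ff1.
have cff := cc_pd true f1 cf.
rewrite !velE e1.
have -> : (fun x0 => sg true * pd true f (flip2 x0)) = fun x0 => pd true f (flip2 x0).
  by apply/funext => y; rewrite /sg mul1r.
rewrite !e2; have k i : kconv (fun y => sg i * pd i (pd true f) (flip2 y)) x = sg i * kconv (pd i (pd true f)) (flip2 x).
  move: (cc_pd i ff1 cff); move: (pd i (pd true f)) => g cg.
  by rewrite (kconv_scale (sg i) x (cc_flip2 cg)) (kconv_flip2 x cg).
by case: b; rewrite k /sg; move: (kconv _ _) => A; ring.
Qed.

Variables (r rt : R -> plane -> R).
Hypothesis fl : flow r rt.
Hypothesis clamped : forall t, t <= 0 -> r t = r 0.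

Definition defect t x : R := r t x + r t (flip2 x).

Let tilde t x : R := r t (flip2 x).

Lemma C1_tilde t : C1 (tilde t) /\ forall j, pd j (tilde t) = fun x => sg j * pd j (r t) (flip2 x).
Proof. exact: C1_flip2 (flow_C1 fl t). Qed.

Lemma C1_pd_tilde t j : C1 (pd j (tilde t)).
Proof.
have [_ ->] := C1_tilde t; have [h _] := C1_flip2 (flow_C1_pd fl t j).
by have [] := C1_scale (sg j) h.
Qed.

Lemma C1_defect t : C1 (defect t) /\ forall j, pd j (defect t) = fun x => pd j (r t) x + pd j (tilde t) x.
Proof. exact: C1_add (flow_C1 fl t) (C1_tilde t).1. Qed.

Lemma C1_pd_defect t j : C1 (pd j (defect t)).
Proof. by have [_ ->] := C1_defect t; have [] := C1_add (flow_C1_pd fl t j) (C1_pd_tilde t j). Qed.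

Lemma cc_defect t : cc (defect t).
Proof. exact: cc_add (flow_cc fl t) (cc_flip2 (flow_cc fl t)). Qed.

(* The reflected density solves the same equation up to sign, so the defect is
   transported up to a term in which the velocity of the defect itself appears. *)
Lemma defect_eq t x : rt t x + rt t (flip2 x) = - adv r t (defect t) x +
  (vel true (defect t) x * pd true (tilde t) x + vel false (defect t) x * pd false (tilde t) x).
Proof.
have f1 := flow_C1 fl t; have cf := flow_cc fl t; have ff1 := flow_C1_pd fl t true.
have v b : vel b (defect t) x = vel b (r t) x + - sg b * vel b (r t) (flip2 x).
  rewrite -(vel_flip2 b x f1 cf ff1).
  exact: (vel_add b x f1 cf ff1 (C1_tilde t).1 (cc_flip2 cf) (C1_pd_tilde t true)).
have p j := congr1 (fun h => h x) ((C1_tilde t).2 j).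
have q j := congr1 (fun h => h x) ((C1_defect t).2 j).
rewrite !(flow_eq fl) /adv !v !q !p /sg.
have alg (a b c d e f g h : R) : - (a * b + c * d) - (e * f + g * h) =
  - (a * (b + 1 * f) + c * (d + (- 1) * h)) + ((a + - (1) * e) * (1 * f) + (c + - - (1) * g) * ((- 1) * h)) by ring.
exact: alg.
Qed.

(** After multiplication by twice the defect, the transport term is the advection of its square and
    integrates to 0. In the remaining term the velocity is that of the defect itself, so
    [vel_pairing] bounds everything by the L^2 norm of the defect. *)
Lemma Rint_defect_le t K : (forall j x, (defect t x * pd j (tilde t) x) ^+ 2 <= K ^+ 2 * defect t x ^+ 2) ->
  `|\int[mu2]_x (2 * defect t x * (rt t x + rt t (flip2 x)))| <=
    2 * (K ^+ 2 + 1) * \int[mu2]_x (defect t x ^+ 2).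
Proof.
move=> hK; have [w1 dw] := C1_defect t; have cw := cc_defect t.
pose h b x := defect t x * pd b (tilde t) x.
have h1 b : C1 (h b) by have [] := C1_mul w1 (C1_pd_tilde t b).
have ch b : cc (h b) by apply: cc_mulr cw (C1_pd_tilde t b).1.
have cv b : continuous (vel b (defect t)).
  have kc i : continuous (kconv (pd i (pd true (defect t)))).
    by apply: kconv_continuous; apply: cc_pd; [exact: C1_pd_defect|exact: cc_pd].
  have [c e] : exists c i, vel b (defect t) = fun x => c * kconv (pd i (pd true (defect t))) x.
    case: b; [exists (2 * pi)^-1, false|exists (- (2 * pi)^-1), true]; apply/funext => x; exact: velE.
  by move: e => [i ->]; apply: cont_mul; [exact: cont_cst|exact: kc].
have ih b : mint (fun x => h b x * vel b (defect t) x) := cc_mint (cc_mulr (ch b) (cv b)).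
have [ww1 _] := C1_mul w1 w1; have cww := cc_mulr cw w1.1.
have iadv : mint (fun x => adv r t (fun y => defect t y * defect t y) x).
  rewrite (_ : (fun x => _) = fun x => defect t x * (2 * adv r t (defect t) x)).
    by apply: cc_mint; apply: cc_mulr cw _; apply: cont_mul; [exact: cont_cst|exact: (adv_continuous fl w1)].
  by apply/funext => x; rewrite (adv_mul r t x w1 w1); ring.
rewrite (Rint_ext2 (g := fun x => 2 * (h true x * vel true (defect t) x + h false x * vel false (defect t) x)
    - adv r t (fun y => defect t y * defect t y) x)); last first.
  move=> x; rewrite defect_eq (adv_mul r t x w1 w1) /h.
  move: (adv _ _ _ _) (vel _ _ _) (vel _ _ _) (pd _ _ _) (pd _ _ _) => A B C D E; ring.
have isum := mintD (ih true) (ih false).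
rewrite RintB; [|exact: mintZ|exact: iadv].
rewrite (Rint_adv fl t ww1 cww) subr0 RintZ// RintD//.
have key b : `|\int[mu2]_x (h b x * vel b (defect t) x)| <= (K ^+ 2 + 1) * \int[mu2]_x (defect t x ^+ 2) / 2.
  apply: (le_trans (vel_pairing b ltr01 (h1 b) (ch b) w1 cw (C1_pd_defect t true))).
  rewrite invr1 !mul1r ler_pM2r// mulrDl mul1r lerD2r -RintZ; last exact/cc_mint/cc_sqr.
  by apply: Rint_le; [exact/cc_mint/cc_sqr|apply: mintZ; exact/cc_mint/cc_sqr|move=> x; exact: hK].
have := key true; have := key false.
rewrite normrM (ger0_norm (ler0n _ 2)).
move: (Rintegral _ _ _) (Rintegral _ _ _) (Rintegral _ _ _) => A B C hB hA.
rewrite -mulrA ler_pM2l//; apply: (le_trans (ler_normD A C)).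
by have := lerD hA hB; rewrite -splitr.
Qed.

(** In place of Gronwall's inequality, the supremum [S] of the squared norm over a time interval of
    length [e] satisfies [S <= C e S <= S / 2]. The uniform support from [local_support] gives the
    gradient bound [K] and the finiteness of [S]. *)
Lemma defect_local tau : 0 <= tau -> (forall x, defect tau x = 0) ->
  exists d, 0 < d /\ forall t x, tau <= t <= tau + d -> defect t x = 0.
Proof.
move=> tau0 w0; have [d [M [d0 hM]]] := local_support fl clamped tau0.
have [K0 [K00 hK0]] := cylinder_bounded tau (tau + d) M (flow_cont fl).
have [K1 [K10 hK1]] := @cylinder_bounded R (fun t => pd true (r t)) tau (tau + d) M (@flow_cont1 R r rt fl true).
have [K2 [K20 hK2]] := @cylinder_bounded R (fun t => pd false (r t)) tau (tau + d) M (@flow_cont1 R r rt fl false).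
pose K := K1 + K2; have K_gt0 : 0 < K by rewrite addr_gt0.
pose C := 2 * (K ^+ 2 + 1); have C0 : 0 < C by rewrite mulr_gt0// ltr_wpDl ?sqr_ge0.
pose e := Num.min d (2 * C)^-1.
have e0 : 0 < e by rewrite lt_min d0 invr_gt0 mulr_gt0.
have ed : e <= d by rewrite ge_min lexx.
have eC : C * e <= 1 / 2.
  have : e <= (2 * C)^-1 by rewrite ge_min lexx orbT.
  by rewrite -(ler_pM2l C0) => /le_trans; apply; rewrite le_eqVlt; apply/orP; left; apply/eqP; field; rewrite gt_eqF.
have out t x : tau <= t <= tau + e -> M < `|x| -> defect t x = 0.
  move=> /andP[h1 h2] xM; have ht : tau <= t <= tau + d by rewrite h1/=; lra.
  by rewrite /defect !hM ?norm_flip2 ?addr0.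
pose Z t := \int[mu2]_x (defect t x ^+ 2).
have ZB t : tau <= t <= tau + e -> Z t <= (K0 + K0) ^+ 2 * \int[mu2]_x ibox M x.
  move=> ht; rewrite -RintZ; last exact: mint_ibox.
  apply: Rint_le; [exact/cc_mint/cc_sqr/cc_defect|by apply: mintZ; exact: mint_ibox|move=> x].
  rewrite iboxE; have [xM|xM] := leP `|x| M; last by rewrite out// expr0n/= mulr0.
  have ht' : tau <= t <= tau + d by move: ht => /andP[h1 h2]; rewrite h1/=; lra.
  rewrite mulr1 -[leLHS]real_normK ?num_real// lerXn2r ?nnegrE ?addr_ge0 ?(ltW K00)//.
  by apply: (le_trans (ler_normD _ _)); apply: lerD; apply: hK0; rewrite ?norm_flip2.
pose A := [set Z t | t in [set t | tau <= t <= tau + e]].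
have hA : has_sup A.
  split; first by exists (Z tau), tau => //=; rewrite lexx lerDl ltW.
  by exists ((K0 + K0) ^+ 2 * \int[mu2]_x ibox M x) => _ [t ht <-]; exact: ZB.
pose S := sup A.
have ZS t : tau <= t <= tau + e -> Z t <= S by move=> ht; apply: (ub_le_sup hA.2); exists t.
have S0 : 0 <= S.
  by apply: (le_trans _ (ZS tau _)); [apply: Rintegral_ge0 => x _; exact: sqr_ge0|rewrite lexx lerDl ltW].
have Zhalf t : tau <= t <= tau + e -> Z t <= S / 2.
  move=> /andP[t1 t2]; move: t1; rewrite le_eqVlt => /orP[/eqP<-|t1].
    rewrite /Z (Rint_ext2 (g := fun=> 0)) ?Rintegral_cst ?mul0r ?divr_ge0// => x.
    by rewrite w0 expr0n.
  have cflip (F : R -> plane -> R) : continuous (fun z : R * plane => F z.1 z.2) ->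
      continuous (fun z : R * plane => F z.1 (flip2 z.2)).
    move=> cF; apply: (@cont_comp _ _ _ (fun z : R * plane => (z.1, flip2 z.2)) (fun z : R * plane => F z.1 z.2)) => //.
    apply: cont_pair; first by apply: cont_fst; exact: cont_id.
    by apply: (@cont_comp _ _ _ snd (@flip2 R)); [apply: cont_snd; exact: cont_id|exact: continuous_flip2].
  have cdef : continuous (fun z : R * plane => defect z.1 z.2).
    by apply: cont_add; [exact: (flow_cont fl)|exact: (cflip r (flow_cont fl))].
  have cdt : continuous (fun z : R * plane => 2 * defect z.1 z.2 * (rt z.1 z.2 + rt z.1 (flip2 z.2))).
    apply: cont_mul; first by apply: cont_mul; [exact: cont_cst|].
    by apply: cont_add; [exact: (flow_cont_t fl)|exact: (cflip rt (flow_cont_t fl))].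
  have sub s : tau <= s <= t -> tau <= s <= tau + e by move=> /andP[h1 h2]; rewrite h1 (le_trans h2).
  have F0 s x : tau <= s <= t -> M < `|x| -> defect s x ^+ 2 = 0 /\ 2 * defect s x * (rt s x + rt s (flip2 x)) = 0.
    by move=> /sub hs xM; rewrite out// expr0n/= mulr0 mul0r.
  have dF (s : R) (x : plane) : tau < s < t -> is_derive s (1 : R) (fun s => defect s x ^+ 2) (2 * defect s x * (rt s x + rt s (flip2 x))).
    move=> /andP[h1 h2]; have s0 := le_lt_trans tau0 h1.
    exact: dv_sqr (dv_add (flow_derive fl x s0) (flow_derive fl (flip2 x) s0)).
  have [i ei] := @Rint_time_derive R (fun s x => defect s x ^+ 2) (fun s x => 2 * defect s x * (rt s x + rt s (flip2 x))) tau t M t1 (cont_exp cdef) cdt F0 dF.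
  have bd s : tau <= s <= t -> \int[mu2]_x (2 * defect s x * (rt s x + rt s (flip2 x))) <= C * S.
    move=> hs; have hse := sub s hs.
    have hsd : tau <= s <= tau + d by move: hse => /andP[h1 h2]; rewrite h1/=; lra.
    apply: (le_trans (ler_norm _)); apply: (le_trans (Rint_defect_le (K := K) _)); last first.
      by apply: ler_wpM2l; [exact: ltW|exact: ZS].
    move=> j x; have [xM|xM] := leP `|x| M; last by rewrite (out s x hse xM) mul0r expr0n/= mulr0.
    rewrite exprMn mulrC; apply: ler_wpM2r; first exact: sqr_ge0.
    rewrite -[leLHS]real_normK ?num_real// lerXn2r ?nnegrE ?(ltW K_gt0)//.
    have [_ ->] := C1_tilde s; rewrite normrM (_ : `|sg j| = 1) ?mul1r; last by rewrite /sg; case: (j); rewrite ?normrN normr1.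
    have fM : `|flip2 x| <= M by rewrite norm_flip2.
    by case: (j); [apply: (le_trans (hK1 _ _ hsd fM)); rewrite lerDl ltW|apply: (le_trans (hK2 _ _ hsd fM)); rewrite lerDr ltW].
  have := Rint_time_le t1 i bd; rewrite ei.
  have -> : \int[mu2]_x (defect tau x ^+ 2) = 0.
    by rewrite (Rint_ext2 (g := fun=> 0)) ?Rintegral_cst ?mul0r// => x; rewrite w0 expr0n.
  rewrite subr0 => /le_trans; apply.
  have h1 : C * S * (t - tau) <= C * S * e by apply: ler_wpM2l; [exact: mulr_ge0 (ltW C0) S0|rewrite lerBlDl].
  apply: (le_trans h1); have := ler_wpM2r S0 eC; lra.
have S2 : S <= S / 2 by apply: ge_sup; [exact: hA.1|move=> _ [t ht <-]; exact: Zhalf].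
exists e; split=> // t x ht.
have Zle0 : Z t <= 0 by have := Zhalf t ht; lra.
have := cc_eq0 (cc_sqr (cc_defect t)) (fun x => sqr_ge0 _) Zle0 x.
by move=> /eqP; rewrite sqrf_eq0 => /eqP.
Qed.

(** Continuation in time: continuity carries oddness to the supremum [tau] of the good times, and
    [defect_local] goes beyond it. *)
Lemma flow_odd : (forall x, r 0 (flip2 x) = - r 0 x) -> forall t x, r t (flip2 x) = - r t x.
Proof.
move=> odd0; suff h t x : defect t x = 0.
  by move=> t x; apply/eqP; rewrite -addr_eq0 addrC; apply/eqP; exact: h.
have w0 y : defect 0 y = 0 by rewrite /defect odd0 subrr.
have [t0|t0] := leP t 0; first by rewrite /defect clamped//; exact: w0.
apply: contrapT => wt.
pose S := [set s | 0 <= s /\ forall u y, 0 <= u <= s -> defect u y = 0].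
have S0 : S 0 by split=> // u y /le_anti <-.
have Sb : has_sup S.
  split; first by exists 0.
  exists t => s [s0 hs]; rewrite leNgt; apply/negP => ts; apply: wt; apply: hs.
  by rewrite !ltW.
pose tau := sup S.
have tau0 : 0 <= tau by apply: (ub_le_sup Sb.2).
have before u y : 0 <= u -> u < tau -> defect u y = 0.
  by move=> u0 /(sup_gt Sb.1)[s [_ hs] us]; apply: hs; rewrite u0 ltW.
have wtau y : defect tau y = 0.
  move: tau0; rewrite le_eqVlt => /orP[/eqP<-//|tp].
  apply/eqP/negP => /negP nz; have gap : 0 < `|defect tau y| by rewrite normr_gt0.
  have cw : continuous (fun s => defect s y).
    by apply: cont_add; [exact: (slice_time (x := y) (flow_cont fl))|exact: (slice_time (x := flip2 y) (flow_cont fl))].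
  have /cvgrPdist_lt/(_ _ gap)/nbhs_ballP[d d0 hd] : defect s y @[s --> tau] --> defect tau y by exact: cw.
  pose s := Num.max 0 (tau - d / 2).
  have st : s < tau by rewrite gt_max tp/= ltrBlDr ltrDl divr_gt0.
  have s0 : 0 <= s by rewrite le_max lexx.
  have := hd s; rewrite (before s y s0 st) subr0 ltxx => h; suff: false by [].
  apply: h; rewrite /ball/= gtr0_norm ?subr_gt0//.
  have : tau - d / 2 <= s by rewrite le_max lexx orbT.
  by move: d0 => /=; lra.
have [d [d0 hd]] := defect_local tau0 wtau.
have : S (tau + d).
  split=> [|u y /andP[u0 ud]]; first by rewrite addr_ge0// ltW.
  by have [h|h] := leP tau u; [apply: hd; rewrite h|exact: before].
by move=> /(ub_le_sup Sb.2); rewrite leNgt ltrDl d0.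
Qed.

End Reflection.

(** * Propagation of positivity *)

Section Positivity.
Context {R : realType}.
Local Notation leb := (@lebesgue_measure R).
Local Notation mu2 := (leb \x leb)%E.
Local Notation plane := (R * R)%type.
Implicit Types (x : plane) (s : R).

(** The square of the negative part, damped as in [sqd] so that its own square is at most [s^2], as
    conservation requires. *)
Definition negsq s : R := sq0 (- s) / (1 + 1 * s ^+ 2).
Definition dnegsq s : R := - (2 * pos1 (- s) / (1 + 1 * s ^+ 2) + sq0 (- s) * (2 * s) / (1 + 1 * s ^+ 2) ^+ 2).

Lemma is_derive_negsq s : is_derive s (1 : R) negsq (dnegsq s).
Proof.
have d0 := lt0r_neq0 (sqd_den s ltr01).
have d1 : is_derive s (1 : R) (fun t => 1 + 1 * t ^+ 2) (2 * s).
  by apply: (dv_eq (dv_add (dv_cst 1 s (1 : R)) (dv_mul (dv_cst 1 s (1 : R)) (dv_sqr (dv_id s))))); ring.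
have d2 := dv_comp (g := fun t => - t) (is_derive_sq0 _) (dv_opp (dv_id s)).
apply: (dv_eq (dv_mul d2 (dv_inv (f := fun t => 1 + 1 * t ^+ 2) d0 d1))).
by rewrite /dnegsq; move: (1 + 1 * s ^+ 2) d0 (sq0 _) (pos1 _) => D D0 a b; field.
Qed.

Lemma negsq_ge0 s : 0 <= negsq s.
Proof. by apply: divr_ge0; [exact: sq0_ge0|exact: ltW (sqd_den s ltr01)]. Qed.

Lemma negsq_pos s : 0 <= s -> negsq s = 0.
Proof. by move=> s0; rewrite /negsq sq0_le0 ?mul0r// oppr_le0. Qed.

Lemma dnegsq0 : dnegsq 0 = 0.
Proof. by rewrite /dnegsq oppr0 sq0_le0// pos1_le0// !mul0r mulr0 !mul0r addr0 oppr0. Qed.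

Lemma sq0_le_sqr s : sq0 (- s) <= s ^+ 2.
Proof.
rewrite /sq0; have [s0|s0] := leP 0 (- s); first by rewrite pos1E// sqrrN.
by rewrite pos1_le0 ?(ltW s0)// expr0n/= sqr_ge0.
Qed.

Lemma negsq_le s : negsq s <= s ^+ 2 /\ negsq s ^+ 2 <= s ^+ 2.
Proof.
have h := sqd_den s ltr01; have s2 := sq0_le_sqr s; have s0 := sq0_ge0 (- s).
have e : negsq s * (1 + 1 * s ^+ 2) = sq0 (- s) by rewrite /negsq divfK// gt_eqF.
have n0 := negsq_ge0 s; have x0 := sqr_ge0 s.
move: (negsq s) (s ^+ 2) (sq0 (- s)) h s2 s0 e n0 x0 => n y q h s2 s0 e n0 y0.
by split; nra.
Qed.

Lemma continuous_den : continuous (fun s : R => 1 + 1 * s ^+ 2).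
Proof. by apply: cont_add; [exact: cont_cst|apply: cont_mul; [exact: cont_cst|apply: cont_exp; exact: cont_id]]. Qed.

Lemma cont_neg (g : R -> R) : continuous g -> continuous (fun s : R => g (- s)).
Proof.
by move=> cg; apply: (@cont_comp _ _ _ (fun s : R => - s) g) => //; apply: cont_opp; exact: cont_id.
Qed.

Lemma continuous_negsq : continuous negsq.
Proof. exact: dv_continuous is_derive_negsq. Qed.

Lemma continuous_dnegsq : continuous dnegsq.
Proof.
have d0 s : 1 + 1 * s ^+ 2 != 0 :> R := lt0r_neq0 (sqd_den s ltr01).
apply: cont_opp; apply: cont_add.
  apply: cont_mul; last by apply: cont_inv => //; exact: continuous_den.
  by apply: cont_mul; [exact: cont_cst|exact: cont_neg (@continuous_pos1 R)].
apply: cont_mul; last by apply: cont_inv; [move=> s; rewrite expf_neq0|apply: cont_exp; exact: continuous_den].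
apply: cont_mul; first exact: cont_neg (@continuous_sq0 R).
by apply: cont_mul; [exact: cont_cst|exact: cont_id].
Qed.

Definition up x : plane := (x.1, pos1 x.2).

Lemma continuous_up : continuous up.
Proof.
apply: cont_pair; first by apply: cont_fst; exact: cont_id.
by apply: (@cont_comp _ _ _ snd pos1); [apply: cont_snd; exact: cont_id|exact: continuous_pos1].
Qed.

Lemma up_id x : 0 <= x.2 -> up x = x.
Proof. by case: x => a b /= b0; rewrite /up /= pos1E. Qed.

Variables (r rt : R -> plane -> R).
Hypothesis fl : flow r rt.
Hypothesis clamped : forall t, t <= 0 -> r t = r 0.
Hypothesis odd : forall t x, r t (flip2 x) = - r t x.
Hypothesis pos0 : forall x, 0 < x.2 -> 0 <= r 0 x.

Lemma axis0 t (a : R) : r t (a, 0) = 0.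
Proof.
have := odd t (a, 0); rewrite {1}/flip2 /= oppr0 => /eqP.
by rewrite -subr_eq0 opprK -mulr2n mulrn_eq0/= => /eqP.
Qed.

Lemma up_le0 t x : x.2 <= 0 -> r t (up x) = 0.
Proof. by move=> h; rewrite /up pos1_le0// axis0. Qed.

(* On the axis the density vanishes, so cutting the quadratic function off
   below the axis leaves it C^1. *)
Definition lower t x : R := negsq (r t (up x)).
Definition dlower j t x : R := dnegsq (r t (up x)) * pd j (r t) (up x).

(** Above the axis this is the chain rule. At points on or below it, an increment [h] reaches height
    at most [|h|]; the density vanishes on the axis and is Lipschitz, so [lower] is of order [h^2]
    there and its derivative is 0. *)
Lemma is_derive_lower j t x : is_derive x (ej j) (lower t) (dlower j t x).
Proof.
have [x0|x0] := ltP 0 x.2.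
  have d := is_derive_chain (is_derive_negsq (r t x)) (C1_is_derive j x (flow_C1 fl t)).
  rewrite /dlower up_id ?(ltW x0)//; apply: near_eq_is_derive d.
  have : \forall y \near x, 0 < y.2.
    have h : (fun y : plane => y.2) y @[y --> x] --> x.2 by exact: cvg_snd.
    have /cvgrPdist_lt/(_ _ x0) := h; apply: filterS => y /=.
    by rewrite ltr_norml => /andP[_]; lra.
  by apply: filterS => y y0; rewrite /lower up_id// ltW.
have -> : dlower j t x = 0 by rewrite /dlower up_le0// dnegsq0 mul0r.
have [L [L0 hL]] := C1_lipschitz (flow_C1 fl t) (flow_cc fl t).
apply/is_derive_line; apply: (@is_derive_quadratic _ _ _ _ (L ^+ 2)) => h.
have -> : lower t (0 *: ej j + x) = 0 by rewrite scale0r add0r /lower up_le0// negsq_pos.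
rewrite addr0 mul0r !subr0 ger0_norm ?negsq_ge0//.
set y := h *: ej j + x; have [n1 _] := negsq_le (r t (up y)); apply: (le_trans n1).
have y2 : `|pos1 y.2| <= `|h|.
  rewrite ger0_norm ?pos1_ge0// /pos1 ge_max normr_ge0/= /y /=.
  by case: (j); rewrite /= /GRing.scale/= ?mulr0 ?mulr1; have := ler_norm h; have := normr_ge0 h; lra.
rewrite -[leLHS]real_normK ?num_real// -exprMn -[(L * h) ^+ 2]real_normK ?num_real//.
rewrite lerXn2r ?nnegrE// normrM (gtr0_norm L0).
have := hL (y.1, 0) (0, - pos1 y.2); rewrite axis0 subr0.
have -> : ((y.1, 0) : plane) - (0, - pos1 y.2) = up y.
  by apply: injective_projections; rewrite /= ?subr0// sub0r opprK.
move=> /le_trans; apply; rewrite /= normr0 add0r normrN; exact: (ler_wpM2l (ltW L0) y2).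
Qed.

Lemma C1_lower t : C1 (lower t) /\ forall j, pd j (lower t) = dlower j t.
Proof.
have cr : continuous (fun x => r t (up x)) := cont_comp continuous_up (flow_cc fl t).1.
apply: (@C1_intro R _ (fun j => dlower j t)).
- exact: cont_comp cr continuous_negsq.
- move=> j; apply: cont_mul; first exact: cont_comp cr continuous_dnegsq.
  exact: cont_comp continuous_up ((flow_C1 fl t).2 j).2.
- by move=> j x; exact: is_derive_lower.
Qed.

Lemma cc_lower t : cc (lower t).
Proof.
split; first exact: (C1_lower t).1.1.
have [_ [M hM]] := flow_cc fl t; exists M => x xM; rewrite /lower.
have [x0|x0] := leP 0 x.2; first by rewrite up_id// hM// negsq_pos.
by rewrite up_le0 ?(ltW x0)// negsq_pos.
Qed.

(** On and below the axis the gradient and the time derivative of [lower] both vanish, so it solves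
    the transport equation in the whole plane. Its integral is conserved, is 0 at the start, and its
    integrand is nonnegative. *)
Lemma flow_ge0 t x : 0 < x.2 -> 0 <= r t x.
Proof.
move=> x0; have [t0|t0] := leP t 0; first by rewrite clamped//; exact: pos0.
have cup (F : R -> plane -> R) : continuous (fun z : R * plane => F z.1 z.2) ->
    continuous (fun z : R * plane => F z.1 (up z.2)).
  move=> cF; apply: (@cont_comp _ _ _ (fun z : R * plane => (z.1, up z.2)) (fun z : R * plane => F z.1 z.2)) => //.
  apply: cont_pair; first by apply: cont_fst; exact: cont_id.
  by apply: (@cont_comp _ _ _ snd up); [apply: cont_snd; exact: cont_id|exact: continuous_up].
have cr := cup r (flow_cont fl).
have mB s : 0 <= s <= t -> mass2 r s <= mass2 r 0 by move=> _; rewrite (mass2_const fl clamped).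
have e : \int[mu2]_x lower t x = \int[mu2]_x lower 0 x.
  apply: (@transport_conserved R r rt fl lower (fun t x => dnegsq (r t (up x)) * rt t (up x)) 0 t 1 (mass2 r 0) (lexx 0) t0 ler01).
  - by move=> s; exact: (C1_lower s).1.
  - exact: cc_lower.
  - exact: cont_comp cr continuous_negsq.
  - by apply: cont_mul; [exact: cont_comp cr continuous_dnegsq|exact: (cup rt (flow_cont_t fl))].
  - by move=> s y s0; exact: (dv_comp (g := fun s => r s (up y)) (is_derive_negsq _) (flow_derive fl (up y) s0)).
  - move=> s y; have [_ dl] := C1_lower s; rewrite /adv !dl /dlower.
    have [y0|y0] := leP y.2 0; first by rewrite up_le0// dnegsq0 !mul0r !mulr0 addr0 oppr0.
    rewrite up_id ?(ltW y0)// (flow_eq fl).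
    have alg (d u v p q : R) : d * - (u * p + v * q) = - (u * (d * p) + v * (d * q)) by ring.
    exact: alg.
  - move=> s y; rewrite mul1r /lower; have [y0|y0] := leP y.2 0.
      by rewrite up_le0// negsq_pos// expr0n/= sqr_ge0.
    by rewrite up_id ?(ltW y0)//; exact: (negsq_le _).2.
  - exact: mB.
have e0 : \int[mu2]_x lower 0 x = 0.
  rewrite (Rint_ext2 (g := fun=> 0)) ?Rintegral_cst ?mul0r// => y; rewrite /lower.
  have [y0|y0] := leP y.2 0; first by rewrite up_le0// negsq_pos.
  by rewrite up_id ?(ltW y0)// negsq_pos// pos0.
have := cc_eq0 (cc_lower t) (fun y => negsq_ge0 _) (etrans (congr1 (fun z => z <= 0) (etrans e e0)) (lexx 0)) x.
rewrite /lower up_id ?(ltW x0)// => n0; rewrite leNgt; apply/negP => rn.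
move/eqP: n0; rewrite /negsq mulf_eq0 invr_eq0 (gt_eqF (sqd_den _ ltr01)) orbF /sq0 sqrf_eq0 pos1E ?oppr_ge0 ?(ltW rn)//.
by rewrite oppr_eq0 lt_eqF.
Qed.

End Positivity.

(** * Potential energy and dissipation *)

Section PotentialEnergy.
Context {R : realType}.
Local Notation leb := (@lebesgue_measure R).
Local Notation mu2 := (leb \x leb)%E.
Local Notation plane := (R * R)%type.
Local Notation mint f := (mu2.-integrable setT (EFin \o f)).
Local Notation mint1 f := (leb.-integrable setT (EFin \o f)).
Local Notation ind a b := (\1_(`[a, b]%classic : set R)).
Implicit Types (x : plane).

Variables (r rt : R -> plane -> R).
Hypothesis fl : flow r rt.
Hypothesis clamped : forall t, t <= 0 -> r t = r 0.
Hypothesis odd : forall t x, r t (flip2 x) = - r t x.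
Hypothesis pos0 : forall x, 0 < x.2 -> 0 <= r 0 x.

(** The rate of decrease of the potential energy: by transport the derivative of the integral of
    [x_2 rho] is that of [rho u_2]. *)
Definition dissip t : R := - \int[mu2]_x (r t x * vel false (r t) x).

Lemma dissipE t : dissip t = (2 * pi)^-1 * energy (pd true (r t)).
Proof.
have f1 := flow_C1 fl t; have cf := flow_cc fl t; have ff1 := flow_C1_pd fl t true.
have cp := cc_pd true f1 cf; have [k1 k2] := kconv_C1 ff1 cp.
have ck i : mint (fun x => r t x * kconv (pd i (pd true (r t))) x).
  by rewrite -k2; apply: cc_mint; exact: cc_mulr cf (k1.2 i).2.
rewrite /dissip (Rint_ext2 (g := fun x => - (2 * pi)^-1 * (r t x * kconv (pd true (pd true (r t))) x))); last first.
  by move=> x; rewrite velE mulrCA.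
rewrite RintZ// mulNr opprK; congr (_ * _).
rewrite -k2 (Rint_parts true f1 k1 cf) /energy.
rewrite -RintN; last by have := (mint_kconv cp cp).1; congr (_.-integrable _ _); apply/funext => x /=; congr EFin; rewrite mulrC.
by apply: Rint_ext2 => x; rewrite mulrN mulrC.
Qed.

Lemma dissip_ge0 t : 0 <= dissip t.
Proof.
rewrite dissipE; apply: mulr_ge0; first by rewrite invr_ge0 mulr_ge0// pi_ge0.
have f1 := flow_C1 fl t; have cf := flow_cc fl t.
by apply: energy_ge0; [exact: cc_pd|exact: Rint_pd].
Qed.

Definition hcut (q : R) x : R := cut (q ^- 2) 1 x * cj false x.

Lemma C1_hcut q : C1 (hcut q) /\ forall j, pd j (hcut q) = fun x =>
  cut (q ^- 2) 1 x * (false == j)%:R + cj false x * dcut (q ^- 2) 1 j x.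
Proof.
have [c1 d1] := C1_cut (q ^- 2 : R) 1; have [h1 e1] := @C1_cj R false.
have [p1 dp] := C1_mul c1 h1; split=> // j.
by rewrite dp e1 d1.
Qed.

Lemma cc_hcut q : 0 < q -> cc (hcut q).
Proof. by move=> q0; apply: cc_mulr; [apply: cc_cut; rewrite invr_gt0 exprn_gt0|exact: continuous_cj]. Qed.

(** Height and density are both odd in [x_2], so their product is nonnegative below the axis as
    well. *)
Lemma hcut_ge0 q t x : 0 <= hcut q x * r t x.
Proof.
rewrite /hcut /= -mulrA; apply: mulr_ge0; first exact: cut_ge0.
have [x0|x0|x0] := ltgtP 0 x.2; last by rewrite -x0 mul0r.
  by apply: mulr_ge0; [exact: ltW|exact: (flow_ge0 fl clamped odd pos0)].
have f0 : 0 < (flip2 x).2 by rewrite /= oppr_gt0.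
have := flow_ge0 fl clamped odd pos0 t f0; rewrite odd oppr_ge0 => r0.
by rewrite -mulrNN; apply: mulr_ge0; rewrite oppr_ge0 ?(ltW x0).
Qed.

Definition flux q t : R := \int[mu2]_x (hcut q x * rt t x).

Lemma fluxE q t : 0 < q -> flux q t = \int[mu2]_x (r t x * adv r t (hcut q) x).
Proof.
move=> q0; have [h1 _] := C1_hcut q; rewrite -(Rint_test_adv fl t h1 (cc_hcut q0) (flow_C1 fl t)).
by apply: Rint_ext2 => x; rewrite (flow_eq fl).
Qed.

Lemma flux_lim t M q : (forall x, M < `|x| -> r t x = 0) -> 0 < q -> 0 <= M -> 2 * M ^+ 2 < q ^+ 2 ->
  flux q t = - dissip t.
Proof.
move=> rM q0 M0 Mq; have [h1 dh] := C1_hcut q.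
rewrite fluxE// /dissip opprK; apply: Rint_ext2 => x.
have [xM|/rM->] := leP `|x| M; last by rewrite !mul0r.
congr (_ * _); rewrite /adv !dh (cut_near_eq1 (ltW Mq) q0 M0 xM).
have s0 : q ^- 2 * dot x x - 1 <= 0.
  rewrite subr_le0 mulrC ler_pdivrMr ?exprn_gt0// mul1r; apply: le_trans (ltW Mq).
  by apply: (le_trans (dot_le_norm_sqr x)); rewrite ler_pM2l// lerXn2r ?nnegrE.
have d0 : dstep (q ^- 2 * dot x x - 1) = 0 by rewrite /dstep [sq0 (_ - 1)]sq0_le0// !mulr0 oppr0.
by rewrite /dcut d0 !mul0r !mulr0 !addr0 mulr0 add0r !mulr1.
Qed.

(** Uniform in [q], since the gradient of the truncated height is: the cutoff contributes at most 1,
    and its derivative times the height at most [2 q * (36 / q) = 72]. This serves as the dominating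
    function in time. *)
Lemma flux_bound q t : 0 < q -> `|flux q t| <= (73 ^+ 2 + 1) * mass2 r 0.
Proof.
move=> q0; have [h1 dh] := C1_hcut q; rewrite fluxE//.
have f1 := flow_C1 fl t; have cf := flow_cc fl t; have cr := cc_sqr cf.
pose z b x := r t x * pd b (hcut q) x.
have C1h j : C1 (pd j (hcut q)).
  rewrite dh; have [c1 _] := C1_cut (q ^- 2 : R) 1.
  have [m1 _] := C1_mul c1 (@C1_cst R (false == j)%:R).1.
  have [m2 _] := C1_mul (@C1_cj R false).1 (C1_dcut (q ^- 2 : R) 1 j).
  by have [] := C1_add m1 m2.
have z1 b : C1 (z b) by have [] := C1_mul f1 (C1h b).
have cz b : cc (z b) by exact: cc_mulr cf (C1h b).1.
have iz b : mint (fun x => z b x * vel b (r t) x) := cc_mint (cc_mulr (cz b) (flow_C1_vel fl t b).1).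
have pb b x : `|pd b (hcut q) x| <= 73.
  rewrite dh; apply: (le_trans (ler_normD _ _)).
  have c1 : `|cut (q ^- 2) 1 x * (false == b)%:R| <= 1.
    by rewrite normrM ger0_norm ?cut_ge0// mulr_ile1 ?cut_ge0 ?cut_le1//; case: (b); rewrite ?normr0 ?normr1.
  have c2 : `|cj false x * dcut (q ^- 2) 1 b x| <= 72.
    have [h|h] := leP (q ^+ 2) (`|x| ^+ 2 / 2); first by rewrite (cut_radius q0 h) mulr0 normr0.
    have xr : `|x| <= 2 * q.
      rewrite -(@ler_pXn2r _ 2) ?nnegrE// ?mulr_ge0 ?(ltW q0)//.
      by rewrite exprMn; nra.
    have cx : `|cj false x| <= 2 * q.
      by apply: le_trans xr; have := lexx `|x|; rewrite plane_norm_le /cj => /andP[].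
    rewrite normrM; have -> : 72 = 2 * q * (36 / q) by field; rewrite gt_eqF.
    by apply: ler_pM => //; exact: dcut_le.
  by have := lerD c1 c2; lra.
have zb b : \int[mu2]_x (z b x ^+ 2) <= 73 ^+ 2 * mass2 r 0.
  rewrite -(mass2_const fl clamped t) /mass2 -RintZ; last exact: cc_mint.
  apply: Rint_le; [exact/cc_mint/cc_sqr|by apply: mintZ; exact: cc_mint|move=> x].
  rewrite /z exprMn mulrC; apply: ler_wpM2r; first exact: sqr_ge0.
  by rewrite -[leLHS]real_normK ?num_real// lerXn2r ?nnegrE.
have key b : `|\int[mu2]_x (z b x * vel b (r t) x)| <= (73 ^+ 2 + 1) * mass2 r 0 / 2.
  apply: (le_trans (vel_pairing b ltr01 (z1 b) (cz b) f1 cf (flow_C1_pd fl t true))).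
  rewrite invr1 !mul1r ler_pM2r// mulrDl mul1r; apply: lerD; first exact: zb.
  by have := mass2_const fl clamped t; rewrite /mass2 => ->.
rewrite (Rint_ext2 (g := fun x => z true x * vel true (r t) x + z false x * vel false (r t) x)); last first.
  move=> x; rewrite /adv /z; move: (pd _ _ _) (pd _ _ _) (vel _ _ _) (vel _ _ _) => A B C D; ring.
rewrite RintD//; apply: (le_trans (ler_normD _ _)).
by have := lerD (key true) (key false); rewrite -splitr.
Qed.

Definition height0 : R := \int[mu2]_x `|cj false x * r 0 x|.

(* The potential energy is bounded below by 0 and decays at rate [dissip]. *)
Lemma dissip_integral (T : R) : 0 < T ->
  mint1 (fun t => dissip t * ind 0 T t) /\ \int[leb]_t (dissip t * ind 0 T t) <= height0.
Proof.
move=> T0; pose q n : R := n.+1%:R; have q0 n : 0 < q n by rewrite ltr0n.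
pose g n t := flux (q n) t * ind 0 T t.
have ch n := cc_hcut (q0 n); have C1h n := (C1_hcut (q n)).1.
have gP n : mint1 (g n) /\ - height0 <= \int[leb]_t g n t.
  have [_ [M hM]] := ch n.
  have chz : continuous (fun z : R * plane => hcut (q n) z.2).
    by apply: (@cont_comp _ _ _ snd (hcut (q n))); [apply: cont_snd; exact: cont_id|exact: (C1h n).1].
  have F0 t x : 0 <= t <= T -> M < `|x| -> hcut (q n) x * r t x = 0 /\ hcut (q n) x * rt t x = 0.
    by move=> _ /hM ->; rewrite !mul0r.
  have dF (t : R) (x : plane) : 0 < t < T -> is_derive t (1 : R) (fun t => hcut (q n) x * r t x) (hcut (q n) x * rt t x).
    move=> /andP[t0 _]; apply: (dv_eq (dv_mul (dv_cst (hcut (q n) x) t (1 : R)) (flow_derive fl x t0))).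
    by rewrite mulr0 addr0.
  have [i e] := @Rint_time_derive R (fun t x => hcut (q n) x * r t x) (fun t x => hcut (q n) x * rt t x) 0 T M T0
    (cont_mul chz (flow_cont fl)) (cont_mul chz (flow_cont_t fl)) F0 dF.
  split=> //; rewrite /g /flux e.
  have p1 : 0 <= \int[mu2]_x (hcut (q n) x * r T x) by apply: Rintegral_ge0 => x _; exact: hcut_ge0.
  have p2 : \int[mu2]_x (hcut (q n) x * r 0 x) <= height0.
    apply: Rint_le.
    - by apply: cc_mint; exact: cc_mull (flow_cc fl 0) (C1h n).1.
    - by apply: mint_norm; apply: cc_mint; exact: (cc_mull (flow_cc fl 0) (@continuous_cj R false)).
    - move=> x; apply: (le_trans (ler_norm _)); rewrite /hcut -mulrA normrM ger0_norm ?cut_ge0//.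
      by rewrite ler_piMl ?cut_le1.
  by rewrite lerBrDr; apply: le_trans p1; rewrite addrC subr_le0.
(* For each [t] the sequence equals its limit once [q n] is beyond the support, but the rank depends
   on [t]; dominated convergence then passes to the limit in the time integral. *)
have gcvg t : g n t @[n --> \oo] --> - (dissip t * ind 0 T t).
  have [_ [M hM]] := flow_cc fl t.
  apply: cvg_near_cst; exists (Num.truncn (2 * `|M|)).+1 => // n /= hn.
  rewrite /g (@flux_lim t `|M| (q n)) ?mulNr//.
    by move=> x xM; apply: hM; exact: le_lt_trans (ler_norm M) xM.
  have h : 2 * `|M| < q n.
    by apply: (lt_le_trans (truncnS_gt _)); rewrite ler_nat (leq_trans hn).
  have m0 := normr_ge0 M; have := q0 n; nra.
have bd n t : `|g n t| <= (73 ^+ 2 + 1) * mass2 r 0 * ind 0 T t.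
  rewrite /g normrM; have i0 : (0 : R) <= ind 0 T t by rewrite indicE; case: (_ \in _).
  by rewrite (ger0_norm i0); apply: ler_wpM2r => //; exact: flux_bound.
have mg n := mint_meas (gP n).1.
have mf : measurable_fun setT (fun t : measurableTypeR R => - (dissip t * ind 0 T t) : measurableTypeR R).
  by apply: (measurable_fun_cvg mg) => t _; exact: gcvg.
have iG : mint1 (fun t => (73 ^+ 2 + 1) * mass2 r 0 * ind 0 T t) by apply: mintZ; exact: mint_itv.
have [i c] := dominated_cvg mg mf iG bd gcvg.
have i' : mint1 (fun t => dissip t * ind 0 T t).
  by have := mintN i; congr (_.-integrable _ _); apply/funext => t /=; rewrite opprK.
split=> //; rewrite -lerN2 -(RintN i').
rewrite -(cvg_lim _ c)//; apply: limr_ge; first by apply/cvg_ex; eexists; exact: c.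
by apply: nearW => n; exact: (gP n).2.
Qed.

End PotentialEnergy.

(** * From the dissipation to the H^s norm *)

Section Spectral.
Context {R : realType}.
Local Notation leb := (@lebesgue_measure R).
Local Notation mu2 := (leb \x leb)%E.
Local Notation plane := (R * R)%type.
Local Notation mint f := (mu2.-integrable setT (EFin \o f)).
Implicit Types (f : plane -> R) (xi : plane) (s : R).

Lemma mint_of_ge0 (g : plane -> R) (m : R) :
  @measurable_fun _ _ (measurableTypeR R * measurableTypeR R)%type (measurableTypeR R) setT g ->
  (forall x, 0 <= g x) -> (\int[mu2]_x (g x)%:E = m%:E)%E -> mint g /\ \int[mu2]_x g x = m.
Proof.
move=> mg g0 e; split; last by rewrite /Rintegral e.
apply/integrableP; split; first exact/measurable_EFinP.
rewrite (_ : (\int[mu2]_x `|_| = m%:E)%E) ?ltry// -e; apply: eq_integral => x _.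
by rewrite /= ger0_norm.
Qed.

Lemma fourier_sqr f xi : cc f ->
  ComplexField.Normc.normc (fourier f xi) ^+ 2 = pspec f xi / (2 * pi) ^+ 2.
Proof.
move=> cf.
have eR : \int[mu2]_x complex.Re (expi (- dot xi x) * (f x)%:C)%C = fcos f xi.
  by apply: Rint_ext2 => x; rewrite /= mulr0 subr0 cosN mulrC.
have eI : \int[mu2]_x complex.Im (expi (- dot xi x) * (f x)%:C)%C = - fsin f xi.
  rewrite /fsin -RintN; last exact/cc_mint/cc_sin.
  by apply: Rint_ext2 => x; rewrite /= mulr0 add0r sinN mulNr mulrC.
rewrite /fourier /cintegral eR eI /=.
rewrite !mul0r subr0 addr0 sqr_sqrtr ?addr_ge0 ?sqr_ge0//.
have alg (p c d : R) : 0 < p -> (p^-1 * c) ^+ 2 + (p^-1 * - d) ^+ 2 = (c ^+ 2 + d ^+ 2) / p ^+ 2.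
  by move=> p0; field; rewrite gt_eqF.
by apply: alg; rewrite mulr_gt0// pi_gt0.
Qed.

Definition hweight s f xi : R := enorm xi `^ (2 * s) * (pspec f xi / (2 * pi) ^+ 2).

Lemma hdot_normE s f : cc f -> hdot_norm s f = sqrte (\int[mu2]_xi (hweight s f xi)%:E)%E.
Proof.
by move=> cf; rewrite /hdot_norm; congr sqrte; apply: eq_integral => xi _; rewrite fourier_sqr.
Qed.

Lemma hweight_ge0 s f xi : 0 <= hweight s f xi.
Proof. by rewrite mulr_ge0 ?powR_ge0// divr_ge0 ?pspec_ge0 ?sqr_ge0. Qed.

Lemma measurable_hweight s f : cc f ->
  @measurable_fun _ _ (measurableTypeR R * measurableTypeR R)%type (measurableTypeR R) setT (hweight s f).
Proof.
move=> cf; apply: measurable_funM.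
  apply: (measurableT_comp (f := fun a : R => a `^ (2 * s))); first exact: measurable_powR.
  by apply: continuous_measurable_plane; exact: continuous_enorm.
apply: measurable_funM; last exact: measurable_cst.
by apply: continuous_measurable_plane; exact: pspec_continuous.
Qed.

Lemma enorm_ge0 xi : 0 <= enorm xi. Proof. exact: sqrtr_ge0. Qed.

Definition slab (a h : R) xi : R := \1_(`[- a, a]%classic) xi.1 * \1_(`[- h, h]%classic) xi.2.

Lemma slabE a h xi : slab a h xi = ((`|xi.1| <= a) && (`|xi.2| <= h))%:R.
Proof.
rewrite /slab !indicE !mem_setE !in_itv/= -!ler_norml.
by case: (_ <= a); case: (_ <= h); rewrite ?mulr1 ?mulr0 ?mul0r.
Qed.

Lemma slab_int a h : 0 < a -> 0 < h -> mint (slab a h) /\ \int[mu2]_xi slab a h xi = 4 * a * h.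
Proof.
move=> a0 h0; have i1 := mint_itv (- a) a; have i2 := mint_itv (- h) h.
split; first exact: (@mint_tensor R _ _ _ _ leb leb _ _ i1 i2).
rewrite /slab (@Rint_tensor R _ _ _ _ leb leb _ _ i1 i2) !Rint_ind_time ?gtrN//; ring.
Qed.

(* Off the box [|xi_1| <= a, |xi_2| <= h] either the frequency exceeds [h] or
   [|xi_1| / |xi|] is at least [a / h]. *)
Lemma spectral_split f s m K a h : C1 f -> cc f -> 0 < s ->
  (forall xi, pspec f xi <= K) -> 0 < a -> 0 < h ->
  (\int[mu2]_xi (hweight s f xi)%:E = m%:E)%E ->
  (2 * pi) ^+ 2 * \int[mu2]_x (f x ^+ 2) <=
    K * (4 * a * h) + (2 * pi) ^+ 2 / h `^ (2 * s) * m + 2 * pi * h ^+ 2 / a ^+ 2 * energy (pd true f).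
Proof.
move=> f1 cf s0 fK a0 h0 em; have pi0 := @pi_gt0 R.
have cS := pspec_continuous cf.
have [i1 e1] := mint_of_ge0 (continuous_measurable_plane cS) (pspec_ge0 f) (plancherel f1 cf).
have [i2 e2] := mint_of_ge0 (measurable_hweight s cf) (hweight_ge0 s f) em.
pose W xi := cj true xi ^+ 2 * pspec f xi / (2 * pi * dot xi xi).
have W0 xi : 0 <= W xi.
  apply: divr_ge0; last by rewrite !mulr_ge0 ?pi_ge0 ?dot_ge0.
  by apply: mulr_ge0; [exact: sqr_ge0|exact: pspec_ge0].
have mW : @measurable_fun _ _ (measurableTypeR R * measurableTypeR R)%type (measurableTypeR R) setT W.
  apply: measurable_over_dot; apply: cont_mul => //.
  by apply: cont_exp; exact: continuous_cj.
have [i3 e3] := mint_of_ge0 mW W0 (esym (energy_pd_spectral true f1 cf)).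
have [i4 e4] := slab_int a0 h0.
rewrite -e1 -e2 -e3 -e4 -!RintZ//.
have j2 := mintZ ((2 * pi) ^+ 2 / h `^ (2 * s)) i2.
have j3 := mintZ (2 * pi * h ^+ 2 / a ^+ 2) i3; have j4 := mintZ K i4.
have j42 := mintD j4 j2.
rewrite -(RintD j4 j2) -(RintD j42 j3).
apply: Rint_le; [exact: i1|exact: mintD j42 j3|move=> xi].
have S0 := pspec_ge0 f xi.
have K0 : 0 <= K by exact: le_trans S0 (fK xi).
have hp : 0 < h `^ (2 * s) by rewrite powR_gt0.
have t2 : 0 <= (2 * pi) ^+ 2 / h `^ (2 * s) * hweight s f xi.
  by rewrite mulr_ge0 ?hweight_ge0// divr_ge0 ?sqr_ge0// ltW.
have t3 : 0 <= 2 * pi * h ^+ 2 / a ^+ 2 * W xi.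
  by rewrite mulr_ge0// divr_ge0 ?sqr_ge0// !mulr_ge0 ?sqr_ge0// ltW.
have t4 : 0 <= K * slab a h xi by rewrite mulr_ge0// slabE.
have [big|small] := ltP h (enorm xi).
  suff hS : pspec f xi <= (2 * pi) ^+ 2 / h `^ (2 * s) * hweight s f xi.
    by apply: (le_trans hS); rewrite addrAC lerDr addr_ge0.
  have hle : h `^ (2 * s) <= enorm xi `^ (2 * s).
    by apply: ge0_ler_powR; rewrite ?nnegrE ?enorm_ge0 ?(ltW big) ?(ltW h0)// mulr_ge0// ltW.
  have -> : (2 * pi) ^+ 2 / h `^ (2 * s) * hweight s f xi = enorm xi `^ (2 * s) / h `^ (2 * s) * pspec f xi.
    rewrite /hweight; have alg (p H E S : R) : 0 < p -> 0 < H -> (2 * p) ^+ 2 / H * (E * (S / (2 * p) ^+ 2)) = E / H * S.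
      by move=> p0 H0; field; rewrite !gt_eqF.
    exact: alg.
  by rewrite ler_peMl// ler_pdivlMr// mul1r.
have [in_|out] := boolP ((`|xi.1| <= a) && (`|xi.2| <= h)).
  have -> : K * slab a h xi = K by rewrite slabE in_ mulr1.
  by apply: (le_trans (fK xi)); rewrite -addrA lerDl addr_ge0.
have x1 : a < `|xi.1|.
  rewrite ltNge; apply/negP => h1; move/negP: out; apply.
  by rewrite h1/= (le_trans (enorm_ge_snd xi)).
suff hS : pspec f xi <= 2 * pi * h ^+ 2 / a ^+ 2 * W xi.
  by apply: (le_trans hS); rewrite lerDr addr_ge0.
have x2 : a ^+ 2 <= xi.1 ^+ 2.
  by rewrite -[leRHS]real_normK ?num_real// lerXn2r ?nnegrE ?(ltW a0)// ltW.
have a20 : 0 < a ^+ 2 by rewrite exprn_gt0.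
have d0 : 0 < dot xi xi.
  by rewrite /dot -!expr2; apply: ltr_pwDl (sqr_ge0 xi.2); exact: lt_le_trans a20 x2.
have dh : dot xi xi <= h ^+ 2.
  by rewrite -(sqr_sqrtr (ltW d0)) lerXn2r ?nnegrE ?(ltW h0)//; exact: sqrtr_ge0.
rewrite /W /cj; have -> : 2 * pi * h ^+ 2 / a ^+ 2 * (xi.1 ^+ 2 * pspec f xi / (2 * pi * dot xi xi)) =
    (h ^+ 2 / dot xi xi) * (xi.1 ^+ 2 / a ^+ 2) * pspec f xi.
  have alg (p A D H X S : R) : 0 < p -> 0 < A -> 0 < D -> 2 * p * H / A * (X * S / (2 * p * D)) = H / D * (X / A) * S.
    by move=> p0 A0 D0; field; rewrite !gt_eqF.
  exact: alg.
rewrite ler_peMl// mulr_ege1// ler_pdivlMr// mul1r//.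
Qed.

(** The constant left by the choices in [hdot_inv_le]. Its square is the factor [(h / a)^2] without
    [h^4], for [a = (2 pi)^2 N / (16 K h)]; the power of [4 / N] comes from [h^4] when
    [h^(2 s) = 4 m / N]; and [2 / N] from half of the mass being left to the dissipation. *)
Definition hconst (s K N : R) : R :=
  2 * (16 * K / ((2 * pi) ^+ 2 * N)) ^+ 2 / N * (4 / N) `^ (2 / s).

Lemma hconst_ge0 s K N : 0 < N -> 0 <= hconst s K N.
Proof.
move=> N0; apply: mulr_ge0; last exact: powR_ge0.
by apply: divr_ge0; [apply: mulr_ge0 => //; exact: sqr_ge0|exact: ltW].
Qed.

Lemma hdot_inv_le f s K N : C1 f -> cc f -> 0 < s ->
  (forall xi, pspec f xi <= K) -> 0 < K -> \int[mu2]_x (f x ^+ 2) = N -> 0 < N ->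
  ((poweR (hdot_norm s f) (4 / s))^-1 <=
    (hconst s K N * ((2 * pi)^-1 * energy (pd true f)))%:E)%E.
Proof.
move=> f1 cf s0 fK K0 eN N0; have pi0 := @pi_gt0 R.
have e0 : 0 <= energy (pd true f) by apply: energy_ge0; [exact: cc_pd|exact: Rint_pd].
have s4 : 4 / s != 0 by rewrite mulf_neq0// invr_eq0 gt_eqF.
have rhs0 : 0 <= hconst s K N * ((2 * pi)^-1 * energy (pd true f)).
  by rewrite mulr_ge0 ?hconst_ge0// mulr_ge0// invr_ge0 mulr_ge0// ltW.
rewrite hdot_normE//.
have : (0 <= \int[mu2]_xi (hweight s f xi)%:E)%E by apply: integral_ge0 => xi _; rewrite lee_fin hweight_ge0.
(* An infinite norm has inverse 0, below the nonnegative right side. *)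
case em : (\int[mu2]_xi (hweight s f xi)%:E)%E => [m| |] //; last first.
  by move=> _; rewrite /sqrte poweRyr// invey lee_fin.
rewrite lee_fin => m0.
pose A := (2 * pi) ^+ 2 * N; have A0 : 0 < A by rewrite mulr_gt0// exprn_gt0// mulr_gt0.
pose D := (2 * pi)^-1 * energy (pd true f).
have D0 : 0 <= D by rewrite mulr_ge0// invr_ge0 mulr_ge0// ltW.
pose ka := (16 * K / A) ^+ 2.
have ka0 : 0 < ka by rewrite exprn_gt0// divr_gt0// mulr_gt0.
have key h : 0 < h -> 3 / 4 * N <= m / h `^ (2 * s) + ka * h ^+ 4 * D.
  (* This [a] makes the box term [4 K a h] equal to [A / 4], a quarter of the spectral mass. *)
  move=> h0; have a0 : 0 < A / (16 * K * h) by rewrite divr_gt0// !mulr_gt0.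
  have := spectral_split f1 cf s0 fK a0 h0 em; rewrite eN.
  have hp : 0 < h `^ (2 * s) by rewrite powR_gt0.
  have alg (p E H : R) : 0 < p -> 0 < H -> A = (2 * p) ^+ 2 * N ->
      (2 * p) ^+ 2 * N <= K * (4 * (A / (16 * K * h)) * h) + (2 * p) ^+ 2 / H * m +
        2 * p * h ^+ 2 / (A / (16 * K * h)) ^+ 2 * E ->
      3 / 4 * N <= m / H + ka * h ^+ 4 * ((2 * p)^-1 * E).
    move=> p0 H0 eA hle; have p20 : 0 < (2 * p) ^+ 2 by rewrite exprn_gt0// mulr_gt0.
    rewrite -(ler_pM2l p20).
    have -> : (2 * p) ^+ 2 * (3 / 4 * N) = (2 * p) ^+ 2 * N - A / 4 by rewrite eA; field.
    have -> : (2 * p) ^+ 2 * (m / H + ka * h ^+ 4 * ((2 * p)^-1 * E)) =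
      (2 * p) ^+ 2 / H * m + 2 * p * h ^+ 2 / (A / (16 * K * h)) ^+ 2 * E.
      by rewrite /ka; field; rewrite !gt_eqF.
    have e4 : K * (4 * (A / (16 * K * h)) * h) = A / 4 by field; rewrite !gt_eqF.
    by move: hle; rewrite e4; lra.
  exact: alg.
(* For [m = 0] the bound [key] with [h] small would give [3 N / 4 <= N / 4]. Positivity is needed
   because [h] is a power of [m] below. *)
have mp : 0 < m.
  rewrite lt_neqAle m0 andbT eq_sym; apply/eqP => mz.
  pose h := Num.min 1 (N / (4 * (ka * D + 1))).
  have kD : 0 <= ka * D by rewrite mulr_ge0// ltW.
  have q0 : 0 < N / (4 * (ka * D + 1)) by rewrite divr_gt0// mulr_gt0// ltr_wpDl.
  have h0 : 0 < h by rewrite lt_min ltr01.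
  have h1 : h <= 1 by rewrite ge_min lexx.
  have h4 : h ^+ 4 <= N / (4 * (ka * D + 1)).
    apply: (@le_trans _ _ h); last by rewrite ge_min lexx orbT.
    by rewrite -[leRHS]expr1; apply: ler_wiXn2l => //; exact: ltW.
  have := key h h0; rewrite mz mul0r add0r.
  have : ka * D * h ^+ 4 <= ka * D * (N / (4 * (ka * D + 1))) by exact: ler_wpM2l.
  have -> : ka * h ^+ 4 * D = ka * D * h ^+ 4 by ring.
  have : ka * D * (N / (4 * (ka * D + 1))) <= N / 4.
    rewrite mulrA ler_pdivrMr ?mulr_gt0// ?ltr_wpDl//.
    have -> : N / 4 * (4 * (ka * D + 1)) = ka * D * N + N by field.
    by rewrite lerDl ltW.
  lra.
have qp : 0 < 4 * m / N by rewrite divr_gt0// mulr_gt0.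
(* High frequencies then carry exactly [N / 4], so at least [N / 2] falls to the dissipation
   term. *)
pose h := (4 * m / N) `^ ((2 * s)^-1).
have h0 : 0 < h by rewrite powR_gt0.
have s2 : 2 * s != 0 by rewrite mulf_neq0// gt_eqF.
have hs : h `^ (2 * s) = 4 * m / N by rewrite /h -powRrM mulVf// powRr1// ltW.
have h4 : h ^+ 4 = (4 / N) `^ (2 / s) * m `^ (2 / s).
  rewrite -powR_mulrn ?ltW// /h -powRrM -powRM ?divr_ge0 ?(ltW N0) ?(ltW mp)//.
  by rewrite mulrAC; congr (_ `^ _); field; rewrite gt_eqF.
have := key h h0; rewrite hs h4 => kk.
have M0 : 0 < m `^ (2 / s) by rewrite powR_gt0.
have eh : (Num.sqrt m) `^ (4 / s) = m `^ (2 / s).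
  rewrite -powR12_sqrt ?ltW// -powRrM; congr (_ `^ _); field; by rewrite gt_eqF.
have -> : sqrte m%:E = (Num.sqrt m)%:E by [].
rewrite poweR_EFin eh inver gt_eqF// lee_fin -/D /hconst -/A -/ka.
rewrite -[leLHS]mul1r ler_pdivrMr//.
have -> : 2 * ka / N * (4 / N) `^ (2 / s) * D * m `^ (2 / s) = ka * ((4 / N) `^ (2 / s) * m `^ (2 / s)) * D * (2 / N) by ring.
move: kk; set X := ka * _ * D => kk.
have e5 : m / (4 * m / N) = N / 4 by field; rewrite !gt_eqF.
rewrite e5 in kk; rewrite mulrA ler_pdivlMr// mul1r; lra.
Qed.

End Spectral.

(** * The integral bound and the growth of the norm *)

Section Conclusion.
Context {R : realType}.
Local Notation leb := (@lebesgue_measure R).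
Local Notation mu2 := (leb \x leb)%E.
Local Notation plane := (R * R)%type.
Local Notation mint1 f := (leb.-integrable setT (EFin \o f)).
Local Notation ind a b := (\1_(`[a, b]%classic : set R)).

(* No measurability is needed: the integral of a nonnegative function is a
   supremum over simple functions below it. *)
Lemma le_integral_pointwise {d} {T : measurableType d} (mu : {measure set T -> \bar R})
    (D : set T) (f g : T -> \bar R) :
  (forall x, D x -> 0 <= f x)%E -> (forall x, D x -> f x <= g x)%E ->
  (\int[mu]_(x in D) f x <= \int[mu]_(x in D) g x)%E.
Proof.
move=> f0 fg; rewrite !ge0_integralE//; last by move=> x Dx; exact: le_trans (f0 x Dx) (fg x Dx).
apply: le_ereal_sup => _ [h hf <-]; exists h => // x; apply: le_trans (hf x) _.
by rewrite !patchE; case: ifPn => // /set_mem; exact: fg.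
Qed.

Lemma ge0_integral_half_line (g : R -> R) (B : R) : (forall t, 0 <= g t) ->
  (forall T, 0 < T -> mint1 (fun t => g t * ind 0 T t) /\ \int[leb]_t (g t * ind 0 T t) <= B) ->
  (\int[leb]_(t in `[0%R, +oo[) (g t)%:E <= B%:E)%E.
Proof.
move=> g0 gB; pose A n := `[0, n.+1%:R]%classic : set R.
have UA : (`[0%R, +oo[%classic : set R) = \bigcup_n A n.
  apply/seteqP; split=> [t|t [n _]]; rewrite /A /= !in_itv/= ?andbT => t0; last by have /andP[] := t0.
  by exists (Num.truncn t) => //=; rewrite in_itv/= t0/= ltW// truncnS_gt.
have eA n : (\int[leb]_(t in A n) (g t)%:E = \int[leb]_t (g t * ind 0 n.+1%:R t)%:E)%E.
  rewrite [LHS]integral_mkcond; apply: eq_integral => t _.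
  by rewrite patchE indicE /A; case: ifPn => _; rewrite ?mulr1 ?mulr0.
have n0 n : 0 < n.+1%:R :> R by rewrite ltr0n.
have cA := @ge0_nondecreasing_set_cvg_integral _ (measurableTypeR R) R A (fun t => (g t)%:E) leb.
have mA n : measurable_fun (A n) (fun t : measurableTypeR R => (g t)%:E).
  apply/measurable_EFinP.
  apply: (eq_measurable_fun (fun t : measurableTypeR R => g t * ind 0 n.+1%:R t)).
    by move=> t tA; rewrite indicE tA mulr1.
  by apply: measurable_funTS; exact: mint_meas (gB _ (n0 n)).1.
have nd : nondecreasing_seq A.
  move=> n m nm; apply/subsetPset => t; rewrite /A /= !in_itv/= => /andP[-> t2] /=.
  by rewrite (le_trans t2)// ler_nat.
have {cA}c := cA nd (fun n => measurable_itv _) mA (fun n t _ => g0 t).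
rewrite UA -(cvg_lim _ c)//; apply: lime_le; first by apply/cvg_ex; eexists; exact: c.
apply: nearW => n; rewrite eA Rint_EFin ?lee_fin; last exact: (gB _ (n0 n)).1.
exact: (gB _ (n0 n)).2.
Qed.

(** The second integral dominates the initial potential energy. The [+ 1] makes the bound on the
    spectrum strictly positive, as [hdot_inv_le] asks. *)
Definition integral_const (s : R) (rho0 : plane -> R) : R :=
  hconst s (2 * l1 rho0 ^+ 2 + 1) (\int[mu2]_x (rho0 x ^+ 2)) *
  \int[mu2]_x `|cj false x * rho0 x|.

Lemma decay_integral_le (rho0 : plane -> R) (s : R) (rho : R -> plane -> R) :
  Cc_smooth rho0 -> (exists x, rho0 x != 0) ->
  (forall x1 x2 : R, rho0 (x1, - x2) = - rho0 (x1, x2)) ->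
  (forall x1 x2 : R, 0 < x2 -> 0 <= rho0 (x1, x2)) -> 0 < s ->
  global_smooth_solution rho0 rho ->
  (\int[leb]_(t in `[0%R, +oo[) (poweR (hdot_norm s (rho t)) (4 / s))^-1 <=
    (integral_const s rho0)%:E)%E.
Proof.
move=> Cc0 [x0 nz] odd0 pos0 s0 sol; have [rt fl] := solution_flow sol.
set r := fun t => rho (Num.max 0 t) in fl.
have clamped t : t <= 0 -> r t = r 0 by move=> t0; rewrite /r (max_idPl t0) maxxx.
have r0 : r 0 = rho0 by rewrite /r maxxx; apply/funext => x; exact: (gss_init sol).
have odd := flow_odd fl clamped (fun x => _ : r 0 (flip2 x) = - r 0 x).
have {}odd : forall t x, r t (flip2 x) = - r t x.
  by apply: odd => x; rewrite r0 /flip2 odd0; case: x.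
have {}pos0 x : 0 < x.2 -> 0 <= r 0 x by rewrite r0; case: x => a b; exact: pos0.
have cc0 := Cc_smooth_cc Cc0.
set N := \int[mu2]_x (rho0 x ^+ 2); have N0 : 0 < N.
  rewrite ltNge; apply/negP => Nle; move/negP: nz; apply.
  have := cc_eq0 (cc_sqr cc0) (fun x => sqr_ge0 _) Nle x0.
  by move/eqP; rewrite sqrf_eq0.
set K := 2 * l1 rho0 ^+ 2 + 1; have K0 : 0 < K by rewrite ltr_wpDl// mulr_ge0// sqr_ge0.
have H0 := hconst_ge0 s K N0.
have bd t : (0 <= t)%R -> ((poweR (hdot_norm s (rho t)) (4 / s))^-1 <= (hconst s K N * dissip r t)%:E)%E.
  move=> t0; have rt' : rho t = r t by rewrite /r (max_idPr t0).
  rewrite rt' (dissipE fl t); apply: hdot_inv_le => //; [exact: (flow_C1 fl)|exact: (flow_cc fl)| |].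
    move=> xi; apply: (le_trans (pspec_le xi (flow_cc fl t))); rewrite /K.
    have h := l1_le fl clamped t; rewrite r0 in h.
    have h2 : l1 (r t) ^+ 2 <= l1 rho0 ^+ 2 by rewrite lerXn2r ?nnegrE ?l1_ge0.
    by apply: (le_trans (ler_wpM2l (ler0n _ 2) h2)); rewrite lerDl.
  by have := mass2_const fl clamped t; rewrite /mass2 r0.
apply: (@le_trans _ _ (\int[leb]_(t in `[0%R, +oo[) (hconst s K N * dissip r t)%:E)%E).
  apply: le_integral_pointwise => t; rewrite /= in_itv/= andbT => t0; last exact: bd.
  by rewrite inve_ge0; exact: poweR_ge0.
have D0 := dissip_ge0 fl.
apply: ge0_integral_half_line => [t|T T0]; first exact: mulr_ge0.
have [i e] := dissip_integral fl clamped odd pos0 T0.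
have eq t : hconst s K N * dissip r t * ind 0 T t = hconst s K N * (dissip r t * ind 0 T t) by rewrite mulrA.
split; first by have := mintZ (hconst s K N) i; congr (_.-integrable _ _); apply/funext => t /=; rewrite eq.
rewrite (Rint_ext1 eq) RintZ//; apply: ler_wpM2l => //.
by move: e; rewrite /height0 r0.
Qed.

(* If the limsup were finite, the integrand would be bounded below by a multiple
   of [1 / t] near infinity. *)
Lemma limsup_of_integral (s C : R) (H : R -> \bar R) : 0 < s -> (forall t, 0 <= H t)%E ->
  (\int[leb]_(t in `[0%R, +oo[) (poweR (H t) (4 / s))^-1 <= C%:E)%E ->
  limf_esup (fun t : R => (t `^ (- (s / 4)))%:E * H t)%E (pinfty_nbhs R) = +oo%E.
Proof.
move=> s0 H0 HC; apply/eqP/negP => /negP; rewrite -ltey => /ereal_inf_lt[_ [V [T0 [_ hT0]] <-] hV].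
have [M [M0 hM]] : exists M : R, 0 < M /\ forall t, T0 < t -> ((t `^ (- (s / 4)))%:E * H t <= M%:E)%E.
  set S := ereal_sup _ in hV.
  have le t : T0 < t -> ((t `^ (- (s / 4)))%:E * H t <= S)%E.
    by move=> /hT0 Vt; apply: ereal_sup_ubound; exists t.
  case: S hV le => [m| |] // _ le; [exists (`|m| + 1)|exists 1]; split=> //; try by rewrite ltr_wpDl.
    by move=> t /le h; apply: (le_trans h); rewrite lee_fin (le_trans (ler_norm m))// lerDl.
  by move=> t /le h; apply: (le_trans h); exact: leNye.
pose a := Num.max 1 (T0 + 1); have a0 : 0 < a by rewrite lt_max ltr01.
have aT t : a <= t -> T0 < t by apply: lt_le_trans; rewrite lt_max ltrDl ltr01 orbT.
pose c := (M `^ (4 / s))^-1; have c0 : 0 < c by rewrite invr_gt0 powR_gt0.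
have F0 t : (0 <= (poweR (H t) (4 / s))^-1)%E by rewrite inve_ge0; exact: poweR_ge0.
(* From [H t <= M t^(s / 4)] the power [4 / s] is at most a multiple of [t]. Where [H t = 0] the
   inverse is [+oo], and the bound holds as well. *)
have low t : a <= t -> ((c * t^-1)%:E <= (poweR (H t) (4 / s))^-1)%E.
  move=> at_; have t0 := lt_le_trans a0 at_; have := hM t (aT t at_); have := H0 t.
  have p0 : 0 < t `^ (- (s / 4)) by rewrite powR_gt0.
  case: (H t) => [x| |] //; last by rewrite mulry gtr0_sg// mul1e leye_eq.
  rewrite lee_fin -EFinM lee_fin => x0 xM.
  rewrite poweR_EFin inver; case: eqP => [_|/eqP nz]; first exact: leey.
  have xp : 0 < x `^ (4 / s) by rewrite lt_neqAle eq_sym nz powR_ge0.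
  have Mt : 0 < M `^ (4 / s) * t by rewrite mulr_gt0// powR_gt0.
  rewrite lee_fin /c -invfM lef_pV2 ?posrE//.
  have xle : x <= M * t `^ (s / 4).
    by move: xM; rewrite powRN mulrC ler_pdivrMr ?powR_gt0.
  apply: (@le_trans _ _ ((M * t `^ (s / 4)) `^ (4 / s))).
    by apply: ge0_ler_powR; rewrite ?nnegrE ?divr_ge0 ?(ltW s0) ?mulr_ge0 ?powR_ge0 ?(ltW M0).
  rewrite powRM ?powR_ge0 ?(ltW M0)// -powRrM.
  have -> : s / 4 * (4 / s) = 1 by field; rewrite gt_eqF.
  by rewrite powRr1// ltW.
have bound b : a < b -> c * ln b - c * ln a <= C.
  move=> ab; rewrite -lee_fin.
  have dl (t : R) : a <= t <= b -> is_derive t 1 (fun t => c * ln t) (c * t^-1).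
    move=> /andP[at_ _]; have t0 := lt_le_trans a0 at_.
    by apply: (dv_eq (dv_mul (dv_cst c t (1 : R)) (is_derive1_ln t0))); rewrite mulr0 addr0.
  have cl (t : R) : a <= t <= b -> {for t, continuous (fun t : R => c * t^-1)}.
    move=> /andP[at_ _]; apply: cvgM; first exact: cvg_cst.
    by apply: cvgV; [rewrite gt_eqF// (lt_le_trans a0)|exact: cvg_id].
  rewrite -(Rint_FTC ab dl cl); apply: le_trans HC.
  rewrite integral_mkcond [leRHS]integral_mkcond; apply: le_integral_pointwise => t _; rewrite !patchE.
    case: ifPn => // /set_mem; rewrite /= in_itv/= => /andP[at_ _].
    by rewrite lee_fin mulr_ge0 ?(ltW c0)// invr_ge0 (le_trans (ltW a0)).
  case: ifPn => [/set_mem|_]; last by case: ifPn.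
  rewrite /= in_itv/= => /andP[at_ _]; rewrite mem_setE in_itv/= (le_trans (ltW a0) at_)/=.
  exact: low.
(* Chosen so that [c (ln b - ln a) = |C| + c], which exceeds [C]. *)
pose b := expR (ln a + (`|C| / c + 1)).
have h1 : 0 < `|C| / c + 1 by rewrite ltr_wpDl// divr_ge0// ltW.
have ab : a < b by rewrite /b -{1}(lnK (x := a)) ?posrE// ltr_expR ltrDl.
have := bound b ab; rewrite /b expRK mulrDr addrAC subrr add0r mulrDr mulr1 mulrC divfK ?gt_eqF//.
by have := ler_norm C; lra.
Qed.

End Conclusion.

(* [^-1] in the time integral is the inverse of \bar R, for which 0^-1 = +oo. *)
Theorem theorem1p1 (R : realType) (rho0 : R * R -> R)
    (rho0_Cc : Cc_smooth rho0)
    (rho0_neq0 : exists x, rho0 x != 0)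
    (rho0_odd : forall x1 x2 : R, rho0 (x1, - x2) = - rho0 (x1, x2))
    (rho0_ge0 : forall x1 x2 : R, 0 < x2 -> 0 <= rho0 (x1, x2)) :
  (forall s : R, 0 < s -> exists C : R,
     forall rho : R -> R * R -> R, global_smooth_solution rho0 rho ->
       (\int[@lebesgue_measure R]_(t in `[0%R, +oo[)
          (poweR (hdot_norm s (rho t)) (4 / s))^-1 <= C%:E)%E) /\
  (forall rho : R -> R * R -> R, global_smooth_solution rho0 rho ->
     forall s : R, 0 < s ->
       limf_esup (fun t : R => (t `^ (- (s / 4)))%:E * hdot_norm s (rho t))%E
         (pinfty_nbhs R) = +oo%E).
Proof.
split=> [s s0|rho sol s s0].
  exists (integral_const s rho0) => rho sol.
  exact: decay_integral_le.
apply: (limsup_of_integral s0 (C := integral_const s rho0)); last exact: decay_integral_le.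
by move=> t; exact: sqrte_ge0.
Qed.
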